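(* Let $k,\ell\ge 1$ be integers, let $n=k+\ell+1$, and let $f_1,f_2:\mathbb{R}\to\mathbb{R}$ be smooth $T$-periodic functions (for some $T>0$) with $f_2>0$ and $f=\sqrt{1-f_1^2-f_2^2}>0$. Suppose that $$\phi:\mathbb{S}^k\times\mathbb{S}^\ell\times\mathbb{S}^1\to\mathbb{S}^{n+1}\subset\mathbb{R}^{k+1}\times\mathbb{R}^{\ell+1}\times\mathbb{R},\qquad \phi(y,z,t)=\bigl(f(t)\,y,\;f_2(t)\,z,\;f_1(t)\bigr),$$ where $\mathbb{S}^1=\mathbb{R}/T\mathbb{Z}$, is a minimal immersion. Then the stability index of this immersion is at least $$k\ell+3k+3\ell+8.$$
   Context: $\mathbb{S}^m$ is the unit sphere in $\mathbb{R}^{m+1}$ with its round metric. An immersed hypersurface of $\mathbb{S}^{n+1}$ is minimal if its mean curvature vanishes identically. The stability operator of a compact minimal immersed hypersurface $M^n$ of $\mathbb{S}^{n+1}$ acts on smooth functions $u$ on $M$ by $J(u)=-\Delta u-nu-|A|^2u$, where $\Delta$ is the Laplace–Beltrami operator of the metric induced on $M$ by the immersion (the trace of the Hessian, so that $-\Delta$ is nonnegative), and $|A|^2=\kappa_1^2+\dots+\kappa_n^2$, with $\kappa_1,\dots,\kappa_n$ the principal curvatures of $M$ in $\mathbb{S}^{n+1}$. A real number $\lambda$ is an eigenvalue of $J$ if $J(u)=\lambda u$ for some nonzero smooth function $u$ on $M$, and its multiplicity is the dimension of the space of such $u$ (together with $0$). The stability index of $M$ is the number of negative eigenvalues of $J$,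 counted with multiplicity. Here $M=\mathbb{S}^k\times\mathbb{S}^\ell\times\mathbb{S}^1$ with the immersion $\phi$. *)

(* Defs.v *)
From HB Require Import structures.
From mathcomp Require Import all_boot all_order all_algebra.
From mathcomp Require Import all_classical all_reals all_analysis.
From mathcomp Require Import ring.

Set Implicit Arguments.
Unset Strict Implicit.
Unset Printing Implicit Defensive.

Import Order.TTheory GRing.Theory Num.Theory numFieldNormedType.Exports.

Local Open Scope classical_set_scope.
Local Open Scope ring_scope.

(** * Smooth functions *)

Definition smooth_line (R : realType) (f : R -> R) : Prop :=
  forall (m : nat) (t : R), derivable (derive1n m f) t 1.

Fixpoint Cdiff (R : realType) (n m : nat) (h : 'rV[R]_n -> R) : Prop :=
  continuous h /\
  if m is m'.+1 then
    forall i : 'I_n,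
      (forall x, derivable h x (delta_mx 0 i)) /\
      Cdiff m' (fun x => 'D_(delta_mx 0 i) h x)
  else True.

Definition smooth (R : realType) (n : nat) (h : 'rV[R]_n -> R) : Prop :=
  forall m : nat, Cdiff m h.

(** * Hypersurfaces of the unit sphere in local coordinates

   [X : 'rV_n -> 'rV_p] is the expression of a map into the unit sphere of
   ['rV_p] in a coordinate system whose domain is all of ['rV_n]; it is a
   hypersurface of that sphere when [p = n + 2]. *)

Section Hypersurface.
Variable R : realType.

Definition dotp (p : nat) (u v : 'rV[R]_p) : R := (u *m v^T) 0 0.

Variables n p : nat.
Implicit Types (X : 'rV[R]_n -> 'rV[R]_p) (v : 'rV[R]_n -> R) (x : 'rV[R]_n).

Definition pd (i : 'I_n) v : 'rV[R]_n -> R := fun x => 'D_(delta_mx 0 i) v x.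

(* Row i is the i-th coordinate tangent vector. *)
Definition jac X x : 'M[R]_(n, p) :=
  \matrix_(i, a) pd i (fun z => X z 0 a) x.

Definition local_immersion X : Prop :=
  (forall a, smooth (fun x => X x 0 a)) /\ (forall x, row_free (jac X x)).

Definition metric X x : 'M[R]_n := jac X x *m (jac X x)^T.

(* The Levi-Civita symbols: Gamma^m_ij. *)
Definition christoffel X (m i j : 'I_n) x : R :=
  \sum_(q < n) invmx (metric X x) m q / 2 *
    (pd i (fun z => metric X z j q) x + pd j (fun z => metric X z i q) x
     - pd q (fun z => metric X z i j) x).

Definition hessian X v x : 'M[R]_n :=
  \matrix_(i, j) (pd i (pd j v) x - \sum_(m < n) christoffel X m i j x * pd m v x).

(* The trace of the Hessian with respect to the induced metric. *)
Definition laplacian X v x : R := \tr (invmx (metric X x) *m hessian X v x).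

Definition is_unit_normal X x (N : 'rV[R]_p) : Prop :=
  [/\ dotp N N = 1, dotp N (X x) = 0 & forall i, dotp N (row i (jac X x)) = 0].

(* For a hypersurface there are two unit normals, opposite to each other; the
   choice made here, point by point, affects neither the vanishing of the mean
   curvature nor |A|^2, as the normal is never differentiated. *)
Definition unit_normal X x : 'rV[R]_p := xget 0 (is_unit_normal X x).

(* The normal is tangent to the sphere, so that its product with the flat
   second derivative of X is the second fundamental form within the sphere. *)
Definition second_form X x : 'M[R]_n :=
  \matrix_(i, j)
    dotp (\row_a pd i (pd j (fun z => X z 0 a)) x) (unit_normal X x).

(* Acts on coordinate row vectors on the right. *)
Definition shape_op X x : 'M[R]_n := second_form X x *m invmx (metric X x).

Definition mean_curvature X x : R := n%:R^-1 * \tr (shape_op X x).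

(* The eigenvalues of the shape operator, listed with multiplicity. *)
Definition principal_curvatures X x : seq R :=
  xget [::]
    [set s : seq R | char_poly (shape_op X x) = \prod_(c <- s) ('X - c%:P)].

Definition sqnormA X x : R := \sum_(c <- principal_curvatures X x) c ^+ 2.

Definition stability_op X v x : R :=
  - laplacian X v x - n%:R * v x - sqnormA X x * v x.

End Hypersurface.

(** * The manifold S^k x S^l x R/TZ *)

Definition sphere (R : realType) (m : nat) : Type :=
  {y : 'rV[R]_(m + 1) | dotp y y = 1}.

(* Inverse of the stereographic projection from the pole (0, 1) if [b] is
   false, and from the pole (0, -1) if [b] is true. *)
Definition stereo_vec (R : realType) (m : nat) (b : bool) (x : 'rV[R]_m) :
    'rV[R]_(m + 1) :=
  (1 + dotp x x)^-1 *: row_mx (2 *: x) ((-1) ^+ b * (dotp x x - 1))%:M.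

Lemma dotp_ge0 (R : realType) (m : nat) (x : 'rV[R]_m) : 0 <= dotp x x.
Proof.
by rewrite /dotp mxE; apply: sumr_ge0 => i _; rewrite mxE -expr2 sqr_ge0.
Qed.

Lemma dotp_row_mx (R : realType) (m1 m2 : nat)
    (x1 y1 : 'rV[R]_m1) (x2 y2 : 'rV[R]_m2) :
  dotp (row_mx x1 x2) (row_mx y1 y2) = dotp x1 y1 + dotp x2 y2.
Proof. by rewrite /dotp tr_row_mx mul_row_col mxE. Qed.

Lemma dotpZ (R : realType) (m : nat) (a b : R) (x y : 'rV[R]_m) :
  dotp (a *: x) (b *: y) = a * b * dotp x y.
Proof.
by rewrite /dotp linearZ /= -scalemxAl -scalemxAr !mxE mulrA.
Qed.

Lemma dotp_scalar (R : realType) (a b : R) :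
  dotp (a%:M : 'rV[R]_1) b%:M = a * b.
Proof. by rewrite /dotp tr_scalar_mx -scalar_mxM mxE eqxx mulr1n. Qed.

Lemma stereo_vecP (R : realType) (m : nat) (b : bool) (x : 'rV[R]_m) :
  dotp (stereo_vec b x) (stereo_vec b x) = 1.
Proof.
have h : 1 + dotp x x != 0 by rewrite gt_eqF // ltr_wpDr ?dotp_ge0.
have e : (-1) ^+ b * (-1) ^+ b = 1 :> R by rewrite -expr2 sqrr_sign.
rewrite /stereo_vec dotpZ dotp_row_mx dotpZ dotp_scalar mulrACA e mul1r.
by field.
Qed.

Definition stereo (R : realType) (m : nat) (b : bool) (x : 'rV[R]_m) :
    sphere R m :=
  exist _ (stereo_vec b x) (stereo_vecP b x).

Lemma stereo_surj (R : realType) (m : nat) (y : sphere R m) :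
  exists b x, stereo b x = y.
Proof.
case: y => y yy; rewrite /stereo.
suff [b [x e]] : exists b x, stereo_vec b x = y.
  by exists b, x; apply: eq_exist.
move: yy; rewrite -[y]hsubmxK [rsubmx y]mx11_scalar.
move: (lsubmx y) (rsubmx y 0 0) => a h.
rewrite dotp_row_mx dotp_scalar => ah.
pose b := 0 < h; pose e : R := (-1) ^+ b.
have ee : e * e = 1 by rewrite /e -expr2 sqrr_sign.
have eh : 1 - e * h != 0.
  rewrite gt_eqF // subr_gt0 (@le_lt_trans _ _ 0) // /e /b.
  by case: ltP => /= h0; rewrite ?expr1 ?mulN1r ?oppr_le0 ?expr0 ?mul1r // ltW.
exists b, ((1 - e * h)^-1 *: a); rewrite /stereo_vec -/e dotpZ.
have -> : dotp a a = (1 - e * h) * (1 + e * h).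
  have -> : (1 - e * h) * (1 + e * h) = 1 - e * e * (h * h) by ring.
  by rewrite ee mul1r -ah addrK.
have -> : (1 - e * h)^-1 * (1 - e * h)^-1 * ((1 - e * h) * (1 + e * h))
          = (1 + e * h) / (1 - e * h) by field.
have -> : 1 + (1 + e * h) / (1 - e * h) = 2 / (1 - e * h) by field.
have -> : e * ((1 + e * h) / (1 - e * h) - 1) = e * e * h * 2 / (1 - e * h).
  by field.
rewrite ee mul1r scale_row_mx !scalerA scale_scalar_mx.
by congr row_mx; [rewrite -[RHS]scale1r; congr (_ *: _) | congr _%:M]; field.
Qed.

(* S^k x S^l x R, where the last factor is the universal cover of R/TZ:
   functions on S^k x S^l x R/TZ are the functions on it that are T-periodic
   in the last variable. *)
Definition SSR (R : realType) (k l : nat) : Type :=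
  (sphere R k * sphere R l * R)%type.

Definition chart (R : realType) (k l : nat) (b : bool * bool)
    (x : 'rV[R]_(k + l + 1)) : SSR R k l :=
  (stereo b.1 (lsubmx (lsubmx x)), stereo b.2 (rsubmx (lsubmx x)),
   rsubmx x 0 0).

Lemma chart_surj (R : realType) (k l : nat) (q : SSR R k l) :
  exists b x, chart b x = q.
Proof.
case: q => -[y z] t.
have [b [x <-]] := stereo_surj y; have [b' [x' <-]] := stereo_surj z.
exists (b, b'), (row_mx (row_mx x x') t%:M).
by rewrite /chart /= !row_mxKl !row_mxKr mxE eqxx mulr1n.
Qed.

Definition smooth_fun (R : realType) (k l : nat) (T : R)
    (u : SSR R k l -> R) : Prop :=
  (forall y z t, u (y, z, t + T) = u (y, z, t)) /\
  forall b, smooth (fun x => u (chart b x)).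

Section Index.
Variables (R : realType) (k l : nat) (T : R) (p : nat).
Variable phi : SSR R k l -> 'rV[R]_p.

Definition minimal_immersion : Prop :=
  forall b, local_immersion (fun x => phi (chart b x)) /\
    forall x, mean_curvature (fun x' => phi (chart b x')) x = 0.

Definition eigenspace (lambda : R) : set (SSR R k l -> R) :=
  [set u | smooth_fun T u /\
    forall b x,
      stability_op (fun x' => phi (chart b x')) (fun x' => u (chart b x')) x
      = lambda * u (chart b x)].

Definition is_eigenvalue (lambda : R) : Prop :=
  exists2 u, eigenspace lambda u & exists q, u q != 0.

Definition lin_indep (m : nat) (u : 'I_m -> SSR R k l -> R) : Prop :=
  forall c : 'I_m -> R,
    (forall q, \sum_(i < m) c i * u i q = 0) -> forall i, c i = 0.

Definition multiplicity (lambda : R) : \bar R :=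
  ereal_sup [set m%:R%:E | m in
    [set m : nat | exists u : 'I_m -> SSR R k l -> R,
       (forall i, eigenspace lambda (u i)) /\ lin_indep u]].

Definition stability_index : \bar R :=
  \esum_(lambda in [set lambda | is_eigenvalue lambda /\ lambda < 0])
    multiplicity lambda.

End Index.

Definition profile (R : realType) (f1 f2 : R -> R) (t : R) : R :=
  Num.sqrt (1 - f1 t ^+ 2 - f2 t ^+ 2).

Definition phi_map (R : realType) (k l : nat) (f1 f2 : R -> R)
    (q : SSR R k l) : 'rV[R]_((k + 1) + (l + 1) + 1) :=
  let: (y, z, t) := q in
  row_mx (row_mx (profile f1 f2 t *: sval y) (f2 t *: sval z)) (f1 t)%:M.

(* Main.v *)
Require Import Defs.
From HB Require Import structures.
From mathcomp Require Import all_boot all_order all_algebra.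
From mathcomp Require Import all_classical all_reals all_analysis.
From mathcomp Require Import ring lra zify.
Import Order.TTheory GRing.Theory Num.Theory numFieldNormedType.Exports.
Local Open Scope ring_scope.

Set Implicit Arguments.
Unset Strict Implicit.
Unset Printing Implicit Defensive.
Local Open Scope classical_set_scope.

(** Let u = Y(y) Z(z) h(t), where each of Y and Z is either constant or a
   coordinate of its sphere, and let a, c in {0, 1} tell which of them are
   coordinates. Then J(u) = Y Z L_ac(h) for a periodic Sturm-Liouville operator
   L_ac in t with potential a k / f^2 + c l / f2^2 - n - |A|^2
   ([stability_sep]). There are k + 1 coordinates on the first sphere and l + 1 on
   the second, so that the index is at least
     (k+1)(l+1) N_11 + (k+1) N_10 + (l+1) N_01 + N_00,
   where N_ac is the number of negative eigenvalues of L_ac. As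
     k l + 3 k + 3 l + 8 = (k+1)(l+1) + 2 (k+1) + 2 (l+1) + 3,
   it remains to find 1, 2, 2 and 3 negative eigenvalues respectively.

   Some eigenfunctions are provided by geometry. The curve g = (f, f2, f1) lies on
   the unit sphere of dimension 2; let tan be its unit tangent and nor = g x tan.
   The coordinates of the unit normal of a minimal hypersurface are eigenfunctions
   of J with eigenvalue - n, so that nor1, nor2 and nor3 are eigenfunctions of
   L_10, L_01 and L_00 for - n ([sl_eigen_nor]). Rotations give functions in the
   kernel of J, so that tan3 and tan2 are in the kernels of L_11 and L_10
   ([sl_eigen_tan]). Now nor1, nor2, nor3 are, up to positive factors, the
   derivatives of quotients of the components of g, and tan3 that of f1: by
   periodicity they change sign. An eigenfunction that changes sign is not a ground
   state ([sl_sign_change]), and a smaller eigenvalue exists. This gives all the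
   required eigenvalues, except for the third one of L_00. Here L_10 has three
   nonpositive eigenvalues (a smallest one, - n and 0), and L_00 < L_10, as the
   potentials differ by k / f^2 > 0; the min-max principle ([sl_eigen_compare])
   gives three negative eigenvalues of L_00.

   The spectral theory is established by the direct method. The energy is minimised
   on the orthogonal of finitely many known eigenfunctions; an energy bound implies
   equicontinuity, a uniform limit exists by the theorem of Arzela and Ascoli, it
   is a weak solution because the energy is a nonnegative form once shifted by its
   minimum, and the lemma of du Bois-Reymond makes it a solution
   ([sl_min_eigenfunction]).

   The passage from J to L_ac takes place in stereographic charts of the spheres,
   where the two fundamental forms of the immersion are diagonal. *)

(** * Derivatives and antiderivatives *)
Section PointwiseDerivatives.
Variables (R : realType) (V : normedModType R).
Implicit Types (f g : V -> R) (x v : V).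

(** The rules are stated for explicit functions of a bound variable, so that a
   tactic can select them by the shape of the function and unification then
   produces the derivative. *)
Lemma is_derive_add f g x v df dg :
  is_derive x v f df -> is_derive x v g dg ->
  is_derive x v (fun y => f y + g y) (df + dg).
Proof. exact: is_deriveD. Qed.

Lemma is_derive_opp f x v df :
  is_derive x v f df -> is_derive x v (fun y => - f y) (- df).
Proof. exact: is_deriveN. Qed.

Lemma is_derive_mul f g x v df dg :
  is_derive x v f df -> is_derive x v g dg ->
  is_derive x v (fun y => f y * g y) (f x * dg + g x * df).
Proof. exact: is_deriveM. Qed.

Lemma is_derive_inv f x v df : f x != 0 ->
  is_derive x v f df ->
  is_derive x v (fun y => (f y)^-1) (- (f x) ^- 2 * df).
Proof.
move=> fx [dfx <-]; apply: DeriveDef; first exact: derivableV.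
by rewrite deriveV.
Qed.

Lemma is_derive_exp f x v df n :
  is_derive x v f df ->
  is_derive x v (fun y => f y ^+ n) (n%:R * f x ^+ n.-1 * df).
Proof.
move=> h; have := is_deriveX n h.
by rewrite exprfctE.
Qed.

Lemma is_derive_const x v (c : R) : is_derive x v (fun _ => c) 0.
Proof. exact: is_derive_cst. Qed.

Lemma is_derive_bigsum (I : finType) (h : I -> V -> R) (dh : I -> R) x v :
  (forall i, is_derive x v (h i) (dh i)) ->
  is_derive x v (fun y => \sum_i h i y) (\sum_i dh i).
Proof.
move=> hd; elim: (index_enum I) => [|i s IH].
  under eq_fun do rewrite big_nil.
  by rewrite big_nil; exact: is_derive_const.
under eq_fun do rewrite big_cons.
by rewrite big_cons; apply: is_derive_add.
Qed.
End PointwiseDerivatives.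

Section FTC.
Variable R : realType.
Implicit Types f g F G : R -> R.

Definition has_deriv f f' := forall t : R, is_derive t 1 f (f' t).

Lemma has_deriv_continuous f f' : has_deriv f f' -> continuous f.
Proof.
move=> fd t; apply/differentiable_continuous/derivable1_diffP.
by have [] := fd t.
Qed.

Lemma has_deriv_unique f f' f'' : has_deriv f f' -> has_deriv f f'' -> f' = f''.
Proof. by move=> h' h''; apply/funext => t; have [_ <-] := h' t; have [_ <-] := h'' t. Qed.

Lemma deriv_const_itv F G f (a b : R) : a <= b ->
  (forall t, a <= t <= b -> is_derive t 1 F (f t)) ->
  (forall t, a <= t <= b -> is_derive t 1 G (f t)) ->
  F b - F a = G b - G a.
Proof.
move=> ab dF dG.
have dH t : a <= t <= b -> is_derive t 1 (fun t => F t - G t) 0.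
  move=> tab; apply: (@is_derive_eq _ _ _ _ _ _ _ (f t - f t)); last by rewrite subrr.
  by apply: is_derive_add; [exact: dF|apply: is_derive_opp; exact: dG].
have [||c _] := @MVT_segment R (fun t => F t - G t) (fun=> 0) a b ab.
- by move=> t; rewrite in_itv/= => /andP[/ltW ? /ltW ?]; apply: dH; apply/andP.
- apply: derivable_within_continuous => t; rewrite in_itv/= => tab.
  by have [] := dH _ tab.
- by rewrite mul0r => e; lra.
Qed.

Let Fint f (N : R) x := (\int[@lebesgue_measure R]_(t in `[- N, x]) f t -
  \int[@lebesgue_measure R]_(t in `[- N, 0]) f t)%R.

Let Fint_deriv f (N : R) : continuous f -> forall x : R, - N < x ->
  is_derive x 1 (Fint f N) (f x).
Proof.
move=> cf x Nx.
have [] := @continuous_FTC1_closed R f (- N) x (x + 1) _ _ Nx (cf x).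
- by rewrite ltrDl.
- apply: continuous_compact_integrable; first exact: segment_compact.
  exact: continuous_subspaceT.
move=> d1 d2.
have H := @DeriveDef _ _ _ _ _ _ _ d1 erefl.
apply: (@is_derive_eq _ _ _ _ _ _ _ (f x + 0)); last by rewrite addr0.
apply: is_derive_add; first by rewrite -d2 derive1E.
Qed.

(** The fundamental theorem of calculus differentiates an integral only to the
   right of its base point. Normalised to vanish at 0, the integrals with
   different base points agree where they are both differentiable, so that the
   base point may be moved along with the argument. *)
Lemma antiderivative_exists f : continuous f -> exists F, has_deriv F f.
Proof.
move=> cf; pose F x := Fint f (`|x| + 1) x.
exists F => x.
have eqF y : `|y| < `|x| + 1 -> F y = Fint f (`|x| + 2) y.
  move=> yx; rewrite /F.
  have h0 N : Fint f N 0 = 0 by rewrite /Fint subrr.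
  have Hd (N t : R) : - N < t -> is_derive t 1 (Fint f N) (f t) by exact: Fint_deriv.
  have [y0|y0] := lerP 0 y.
    have := @deriv_const_itv (Fint f (`|y| + 1)) (Fint f (`|x| + 2)) f 0 y y0.
    rewrite !h0 !subr0; apply => t /andP[t0 _]; apply: Hd;
      rewrite (lt_le_trans _ t0) // oppr_lt0; have := normr_ge0 y;
      have := normr_ge0 x; lra.
  have := @deriv_const_itv (Fint f (`|y| + 1)) (Fint f (`|x| + 2)) f y 0 (ltW y0).
  rewrite !h0 !sub0r => h; apply: oppr_inj; apply: h => t /andP[yt _]; apply: Hd;
    rewrite (lt_le_trans _ yt) //; move: yx; rewrite (ltr0_norm y0); lra.
have nx : - (`|x| + 2) < x by have := ler_normr x (- x); rewrite normrN => _;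
   have := ler_norm (- x); rewrite normrN; lra.
have D := @Fint_deriv f (`|x| + 2) cf x nx.
have near_eq : \forall y \near x, Fint f (`|x| + 2) y = F y.
  near=> y; symmetry; apply: eqF.
  have : `|x - y| < 1 by near: y; apply: cvgr_dist_lt.
  by have := lerB_dist y x; rewrite distrC; lra.
exact: (near_eq_is_derive near_eq D).
Unshelve. all: by end_near. Qed.
End FTC.

Section Continuity.
Variables (R : realType) (V : topologicalType).
Implicit Types f g : V -> R.

Lemma continuous_add f g : continuous f -> continuous g ->
  continuous (fun x => f x + g x).
Proof. by move=> cf cg x; apply: continuousD; [exact: cf|exact: cg]. Qed.

Lemma continuous_opp f : continuous f -> continuous (fun x => - f x).
Proof. by move=> cf x; apply: continuousN; exact: cf. Qed.

Lemma continuous_mul f g : continuous f -> continuous g ->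
  continuous (fun x => f x * g x).
Proof. by move=> cf cg x; apply: continuousM; [exact: cf|exact: cg]. Qed.

Lemma continuous_inv f : (forall x, f x != 0) -> continuous f ->
  continuous (fun x => (f x)^-1).
Proof. by move=> f0 cf x; apply: continuousV; [exact: f0|exact: cf]. Qed.

Lemma continuous_exp f n : continuous f -> continuous (fun x => f x ^+ n).
Proof.
move=> cf; elim: n => [|n IH].
  by under eq_fun do rewrite expr0; exact: cst_continuous.
by under eq_fun do rewrite exprS; exact: continuous_mul.
Qed.

Lemma continuous_const (c : R) : continuous (fun _ : V => c).
Proof. exact: cst_continuous. Qed.

Lemma continuous_bigsum (I : finType) (h : I -> V -> R) :
  (forall i, continuous (h i)) -> continuous (fun y => \sum_i h i y).
Proof.
move=> hd; elim: (index_enum I) => [|i s IH].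
  by under eq_fun do rewrite big_nil; exact: continuous_const.
by under eq_fun do rewrite big_cons; apply: continuous_add.
Qed.
End Continuity.

Lemma is_derive_sqrt (R : realType) (f : R -> R) (t df : R) : 0 < f t ->
  is_derive t 1 f df ->
  is_derive t 1 (fun s => Num.sqrt (f s)) ((2 * Num.sqrt (f t))^-1 * df).
Proof. by move=> f0 hf; apply: is_derive1_comp; exact: is_derive1_sqrt. Qed.

Lemma is_derive_expR_comp (R : realType) (f : R -> R) (t df : R) :
  is_derive t 1 f df ->
  is_derive t 1 (fun s => expR (f s)) (expR (f t) * df).
Proof. by move=> hf; apply: is_derive1_comp. Qed.

Ltac continuity := repeat first
 [ match goal with
   | H : continuous ?f |- continuous ?f => exact: H
   | H : forall i, continuous (?u i) |- continuous (?u ?j) => exact: (H j)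
   end
 | lazymatch goal with
   | |- continuous (fun _ => ?c) => exact: continuous_const
   | |- continuous (fun x => @?f x + @?g x) => apply: (@continuous_add _ _ f g)
   | |- continuous (fun x => - @?f x) => apply: (@continuous_opp _ _ f)
   | |- continuous (fun x => @?f x * @?g x) => apply: (@continuous_mul _ _ f g)
   | |- continuous (fun x => (@?f x)^-1) => apply: (@continuous_inv _ _ f)
   | |- continuous (fun x => @?f x ^+ ?n) => apply: (@continuous_exp _ _ f n)
   | |- continuous (fun t => ?f t) => progress change (continuous f)
   end ].

Ltac derivation := repeat first
 [ match goal with
   | H : is_derive ?x ?v ?f _ |- is_derive ?x ?v ?f _ => exact: H
   | |- is_true _ => assumption
   | H : has_deriv ?f ?g |- is_derive ?x 1 (fun t => ?f t) _ => exact: (H x)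
   | H : has_deriv ?f ?g |- is_derive ?x 1 ?f _ => exact: (H x)
   end
 | lazymatch goal with
   | |- is_derive ?x ?v (fun _ => ?c) _ => eapply is_derive_const
   | |- is_derive ?x ?v (fun y => @?f y + @?g y) _ =>
       eapply (@is_derive_add _ _ f g x v)
   | |- is_derive ?x ?v (fun y => - @?f y) _ => eapply (@is_derive_opp _ _ f x v)
   | |- is_derive ?x ?v (fun y => @?f y * @?g y) _ =>
       eapply (@is_derive_mul _ _ f g x v)
   | |- is_derive ?x ?v (fun y => (@?f y)^-1) _ =>
       eapply (@is_derive_inv _ _ f x v)
   | |- is_derive ?x ?v (fun y => Num.sqrt (@?f y)) _ =>
       eapply (@is_derive_sqrt _ f x)
   | |- is_derive ?x ?v (fun y => expR (@?f y)) _ =>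
       eapply (@is_derive_expR_comp _ f x)
   | |- is_derive ?x ?v (fun y => @?f y ^+ ?n) _ =>
       eapply (@is_derive_exp _ _ f x v _ n)
   | |- is_derive ?x ?v (fun y => y) _ => eapply is_derive_id
   end ].

Ltac derive_by := eapply is_derive_eq; [ by derivation | ].

(** * Integration over a period *)
Section Circle.
Variables (R : realType) (T : R).
Hypothesis T_gt0 : 0 < T.
Implicit Types f g u v F G : R -> R.

Lemma has_deriv_eq f f' g : (forall t, f' t = g t) -> has_deriv f f' -> has_deriv f g.
Proof. by move=> e h t; rewrite -e. Qed.

Lemma deriv0_const F : has_deriv F (fun=> 0) -> forall a b, F a = F b.
Proof.
move=> hF a b; wlog ab : a b / a <= b.
  by move=> h; have [/h //|/ltW/h ->] := lerP a b.
have := @deriv_const_itv R F (fun=> 0) (fun=> 0) a b ab (fun t _ => hF t)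
  (fun t _ => is_derive_const _ _ _).
by rewrite subrr; move=> /eqP; rewrite subr_eq0 => /eqP.
Qed.

Lemma deriv_ge0_homo F f (a b : R) : a <= b ->
  (forall t, a <= t <= b -> is_derive t 1 F (f t)) ->
  (forall t, a <= t <= b -> 0 <= f t) -> F a <= F b.
Proof.
move=> ab dF f0.
have [||c cab] := @MVT_segment R F f a b ab.
- by move=> t; rewrite in_itv/= => /andP[/ltW ? /ltW ?]; apply: dF; apply/andP.
- apply: derivable_within_continuous => t; rewrite in_itv/= => tab.
  by have [] := dF _ tab.
- move=> e; rewrite -subr_ge0 e mulr_ge0 ?subr_ge0 //; apply: f0.
  by rewrite in_itv/= in cab.
Qed.

Definition prim f : R -> R := xget (fun=> 0) [set F | has_deriv F f].

Lemma primP f : continuous f -> has_deriv (prim f) f.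
Proof.
move=> /antiderivative_exists[F hF].
exact: (@xgetPex _ (fun=> 0) [set F | has_deriv F f] (ex_intro _ F hF)).
Qed.

(** Only continuous functions are integrated below. With the integral defined by
   an antiderivative, its properties follow from the mean value theorem, without
   measurability or integrability conditions. *)
Definition intT f := prim f T - prim f 0.

Lemma intT_deriv F f : continuous f -> has_deriv F f -> intT f = F T - F 0.
Proof.
move=> cf hF; apply: (@deriv_const_itv _ _ _ f) => [|t _|t _]; first exact: ltW.
  exact: primP.
exact: hF.
Qed.

Lemma intTD f g : continuous f -> continuous g ->
  intT (fun t => f t + g t) = intT f + intT g.
Proof.
move=> cf cg; rewrite (@intT_deriv (fun t => prim f t + prim g t)).
- by rewrite /intT; ring.
- by continuity.
- by move=> t; apply: is_derive_add; exact: primP.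
Qed.

Lemma intTZ (c : R) f : continuous f -> intT (fun t => c * f t) = c * intT f.
Proof.
move=> cf; rewrite (@intT_deriv (fun t => c * prim f t)).
- by rewrite /intT; ring.
- by continuity.
- move=> t; have hf := primP cf.
  by derive_by; ring.
Qed.

Lemma intTN f : continuous f -> intT (fun t => - f t) = - intT f.
Proof.
move=> cf; rewrite -mulN1r -intTZ //; congr intT.
by apply/funext => t; rewrite mulN1r.
Qed.

Lemma intTB f g : continuous f -> continuous g ->
  intT (fun t => f t - g t) = intT f - intT g.
Proof. by move=> cf cg; rewrite intTD ?intTN //; continuity. Qed.

Lemma intT_sum (I : finType) (h : I -> R -> R) :
  (forall i, continuous (h i)) ->
  intT (fun t => \sum_i h i t) = \sum_i intT (h i).
Proof.
move=> ch; rewrite (@intT_deriv (fun t => \sum_i prim (h i) t)).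
- by rewrite -sumrB.
- exact: continuous_bigsum.
- by move=> t; apply: is_derive_bigsum => i; exact: primP.
Qed.

Lemma intT_ge0 f : continuous f -> (forall t, 0 <= f t) -> 0 <= intT f.
Proof.
move=> cf f0; rewrite /intT subr_ge0.
apply: (@deriv_ge0_homo _ f) => [|t _|//]; first exact: ltW.
exact: primP.
Qed.

Lemma intT_le f g : continuous f -> continuous g ->
  (forall t, f t <= g t) -> intT f <= intT g.
Proof.
move=> cf cg fg; rewrite -subr_ge0 -intTB //; apply: intT_ge0.
  by continuity.
by move=> t; rewrite subr_ge0.
Qed.

Lemma intT_const (c : R) : intT (fun=> c) = c * T.
Proof.
rewrite (@intT_deriv (fun t => c * t)); first by ring.
  exact: continuous_const.
by move=> t; derive_by; ring.
Qed.

Lemma intT0 : intT (fun=> 0) = 0.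
Proof. by rewrite intT_const mul0r. Qed.

Lemma intT_abs_le f (c : R) : continuous f -> (forall t, `|f t| <= c) ->
  `|intT f| <= c * T.
Proof.
move=> cf fc; rewrite ler_norml -mulNr -!intT_const.
apply/andP; split; apply: intT_le => //; try exact: continuous_const.
  by move=> t; have := fc t; rewrite ler_norml => /andP[].
by move=> t; have := fc t; rewrite ler_norml => /andP[].
Qed.

(** The point s does not depend on the function, so that several periodic
   functions are moved at once. *)
Lemma period_reduction (t : R) :
  exists2 s, 0 <= s <= T & forall f, periodic f T -> f t = f s.
Proof.
have Tn0 : T != 0 by rewrite gt_eqF.
pose m := Num.floor (t / T).
have /andP[h1 h2] : m%:~R * T <= t < (m%:~R + 1) * T.
  by rewrite -ler_pdivlMr // -ltr_pdivrMr // -intrD1 Num.Theory.floor_itv.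
exists (t - m%:~R * T) => [|f pf]; first by apply/andP; split; lra.
case: (m) => n.
  by rewrite -[in LHS](subrK (n%:~R * T) t) -pmulrn mulr_natl periodicn.
by rewrite NegzE mulrNz mulNr opprK -pmulrn mulr_natl periodicn.
Qed.

Lemma periodic_bounded f : continuous f -> periodic f T ->
  exists M, forall t, `|f t| <= M.
Proof.
move=> cf pf; have cn : continuous (fun t => `|f t|).
  by move=> t; apply: continuous_comp; [exact: cf|exact: norm_continuous].
have [c _ hc] := @EVT_max R (fun t => `|f t|) 0 T (ltW T_gt0)
   (continuous_subspaceT cn).
exists `|f c| => t; have [s sT e] := period_reduction t.
by rewrite (e _ pf); apply: hc; rewrite in_itv.
Qed.

Lemma periodic_pos_lower_bound f : continuous f -> periodic f T ->
  (forall t, 0 < f t) -> exists2 c, 0 < c & forall t, c <= f t.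
Proof.
move=> cf pf f0.
have [c _ hc] := @EVT_min R f 0 T (ltW T_gt0) (continuous_subspaceT cf).
exists (f c) => // t; have [s sT e] := period_reduction t.
by rewrite (e _ pf); apply: hc; rewrite in_itv.
Qed.

(** An antiderivative of f is nondecreasing with equal values at 0 and T, yet it
   would increase strictly near a point where f is positive. *)
Lemma intT_eq0 f : continuous f -> periodic f T -> (forall t, 0 <= f t) ->
  intT f = 0 -> forall t, f t = 0.
Proof.
move=> cf pf f0 int0 t; apply/eqP; rewrite eq_le f0 andbT leNgt; apply/negP => ft.
have [s /andP[s0 sT] e] := period_reduction t.
have fs : 0 < f s by rewrite -(e _ pf).
have hF := primP cf.
have dF a b : a <= b -> prim f a <= prim f b.
  by move=> ab; apply: (@deriv_ge0_homo _ f) => // x _; exact: hF.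
have near_pos : \forall x \near s, 0 < f x.
  exact: (cvgr_gt _ (cf s) _ fs).
have [d /= d0 hd] := near_pos.
(* An interval [a, b] of [0, T] with an end at s, on which f is positive. *)
pose d' := Num.min d T / 2.
have d'0 : 0 < d' by rewrite divr_gt0 // lt_min d0.
have d'd : d' < d.
  have : Num.min d T <= d by rewrite ge_min lexx.
  by rewrite /d'; lra.
have d'T : d' <= T / 2 by rewrite ler_pM2r ?invr_gt0 // ge_min lexx orbT.
have [a [b [ab a0 bT hab]]] : exists a b, [/\ a < b, 0 <= a, b <= T &
    forall x, a <= x <= b -> 0 < f x].
  have [sh|sh] := lerP s (T / 2).
    exists s, (s + d'); split; [lra|lra|lra|] => x /andP[x1 x2].
    by apply: hd; rewrite /ball_/= distrC ger0_norm; lra.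
  exists (s - d'), s; split; [lra|lra|lra|] => x /andP[x1 x2].
  by apply: hd; rewrite /ball_/= ger0_norm; lra.
have [||c] := @MVT R (prim f) f a b ab.
- by move=> x _; exact: hF.
- exact/continuous_subspaceT/has_deriv_continuous/hF.
rewrite in_itv/= => /andP[/ltW c1 /ltW c2] eq.
have : 0 < prim f b - prim f a.
  by rewrite eq mulr_gt0 ?subr_gt0 //; apply: hab; rewrite c1 c2.
have := dF 0 a a0; have := dF b T bT; move: int0; rewrite /intT; lra.
Qed.

Lemma intT_gt0 f : continuous f -> periodic f T -> (forall t, 0 <= f t) ->
  (exists t, f t != 0) -> 0 < intT f.
Proof.
move=> cf pf f0 [t ft]; rewrite lt_neqAle intT_ge0 // andbT eq_sym.
by apply: contraNN ft => /eqP h; rewrite (intT_eq0 cf pf f0 h).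
Qed.

Lemma is_derive_shiftT F f (t : R) : has_deriv F f ->
  is_derive t 1 (fun s => F (s + T)) (f (t + T)).
Proof.
move=> hF; have [] := hF (t + T); rewrite /derivable /derive.
have -> : (fun h : R => h^-1 *: ((F \o shift (t + T)) (h *: 1) - F (t + T))) =
    (fun h : R => h^-1 *: (((fun s => F (s + T)) \o shift t) (h *: 1)
      - F (t + T))) by apply/funext => h /=; rewrite addrA.
by move=> d e; apply: DeriveDef.
Qed.

Lemma intT_deriv_periodic F f : continuous f -> has_deriv F f ->
  periodic F T -> intT f = 0.
Proof.
by move=> cf hF pF; rewrite (intT_deriv cf hF) -[T in F T]add0r pF subrr.
Qed.

Lemma periodic_antiderivative F f : continuous f -> periodic f T ->
  has_deriv F f -> intT f = 0 -> periodic F T.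
Proof.
move=> cf pf hF int0 t.
have d0 : has_deriv (fun s => F (s + T) - F s) (fun=> 0).
  move=> s; have := is_derive_shiftT s hF => h.
  apply: (is_derive_eq (is_derive_add h (is_derive_opp (hF s)))).
  by rewrite pf subrr.
have := deriv0_const d0 t 0; rewrite add0r -(intT_deriv cf hF) int0.
by move=> /eqP; rewrite subr_eq0 => /eqP.
Qed.

Lemma periodic_deriv F f : has_deriv F f -> periodic F T -> periodic f T.
Proof.
move=> hF pF t; have [_ <-] := is_derive_shiftT t hF; have [_ <-] := hF t.
by rewrite (_ : (fun s => F (s + T)) = F) //; apply/funext => s; rewrite pF.
Qed.

Lemma intT_by_parts u u' v v' : has_deriv u u' -> has_deriv v v' ->
  continuous u' -> continuous v' -> periodic u T -> periodic v T ->
  intT (fun t => u' t * v t) = - intT (fun t => u t * v' t).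
Proof.
move=> hu hv cu' cv' pu pv.
have cu := has_deriv_continuous hu; have cv := has_deriv_continuous hv.
apply/eqP; rewrite -subr_eq0 opprK -intTD; try by continuity.
apply/eqP/(@intT_deriv_periodic (fun t => u t * v t)); try by continuity.
  by move=> t; derive_by; ring.
by move=> t; rewrite pu pv.
Qed.
End Circle.

(** * Compactness of equicontinuous families *)
Lemma ultra_fmap (X Y : Type) (f : X -> Y) (F : set_system X) :
  UltraFilter F -> UltraFilter (f @ F).
Proof.
move=> FU; split; first exact: fmap_proper_filter.
move=> G GP sFG; rewrite predeqE => A; split; last exact: sFG.
move=> GA; have [//|FnA] := in_ultra_setVsetC (f @^-1` A) FU.
have GnA : G (~` A) by apply: sFG.
have G0 := filterI GA GnA; rewrite setICr in G0.
by case: (filter_not_empty G (G0 _)).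
Qed.

Section Ascoli.
Variables (R : realType) (T : R).
Hypothesis T_gt0 : 0 < T.

(** The theorem of Arzela and Ascoli for periodic functions. Bounded sequences of
   reals converge along an ultrafilter, which replaces the extraction of
   subsequences; equicontinuity reduces uniform convergence to convergence at
   the finitely many points of a grid. *)
Lemma equicontinuous_uniform_limit (u : nat -> R -> R) (M : R) :
  (forall n, periodic (u n) T) -> (forall n t, `|u n t| <= M) ->
  (forall e : R, 0 < e -> exists2 d : R, 0 < d &
     forall n s t, `|s - t| < d -> `|u n s - u n t| <= e) ->
  exists F : set_system nat, exists g : R -> R,
   [/\ ProperFilter F, \oo `<=` F, continuous g, periodic g T &
     forall e : R, 0 < e -> \forall n \near F, forall t, `|u n t - g t| <= e].
Proof.
move=> pu bu equi.
have [F [FU ooF]] := ultraFilterLemma (eventually_filter).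
have lim t : exists l : R, u ^~ t @ F --> l.
  have := @segment_compact R (- M) M; rewrite compact_ultra.
  move=> /(_ (u ^~ t @ F) (ultra_fmap _ FU)) [|l [_ hl]]; last by exists l.
  apply: (@filterE _ F) => n /=.
  by rewrite in_itv/= -ler_norml.
pose g t := projT1 (cid (lim t)).
have glim t (e : R) : 0 < e -> \forall n \near F, `|u n t - g t| < e.
  move=> e0; rewrite /g; case: cid => l /= hl.
  by have /cvgrPdistC_lt := hl => /(_ _ e0).
have gequi (e : R) : 0 < e -> exists2 d : R, 0 < d &
     forall s t, `|s - t| < d -> `|g s - g t| <= e.
  move=> e0; have [d d0 hd] := equi _ e0; exists d => // s t st.
  apply/ler_addgt0Pr => /= eta eta0.
  have e2 : 0 < eta / 2 by rewrite divr_gt0.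
  have [n [hs ht]] : exists n, `|u n s - g s| < eta / 2 /\ `|u n t - g t| < eta / 2.
    by near F => n; exists n; split; near: n; exact: glim.
  have := hd n s t st.
  have -> : g s - g t = (g s - u n s) + (u n s - u n t) + (u n t - g t) by ring.
  have := ler_normD (g s - u n s + (u n s - u n t)) (u n t - g t).
  have := ler_normD (g s - u n s) (u n s - u n t).
  by rewrite (distrC (g s)); lra.
have cg : continuous g.
  move=> t; apply/cvgrPdist_le => /= e e0.
  have [d d0 hd] := gequi _ e0.
  near=> s; apply: hd; near: s; exact: cvgr_dist_lt.
have pg : periodic g T.
  move=> t; apply/eqP; rewrite -subr_eq0 -normr_le0.
  apply/ler_addgt0Pr => /= eta eta0; rewrite add0r.
  have e2 : 0 < eta / 2 by rewrite divr_gt0.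
  have [n [/= hs ht]] : exists n, `|u n t - g t| < eta / 2 /\
    `|u n (t + T) - g (t + T)| < eta / 2.
    by near F => n; exists n; split; near: n; exact: glim.
  rewrite pu in ht.
  have -> : g (t + T) - g t = (u n t - g t) - (u n t - g (t + T)) by ring.
  by have := ler_normB (u n t - g t) (u n t - g (t + T)); lra.
exists F, g; split=> //; first exact: ultra_proper.
move=> e e0.
have e3 : 0 < e / 3 by rewrite divr_gt0.
have [d1 d10 hd1] := equi _ e3; have [d2 d20 hd2] := gequi _ e3.
(* The grid of mesh d on [0, T] has at most m + 1 points. *)
pose d := Num.min d1 d2; have d0 : 0 < d by rewrite lt_min d10.
pose m := Num.truncn (T / d).
have fin : \forall n \near F, forall j : 'I_m.+1,
    `|u n (j%:R * d) - g (j%:R * d)| < e / 3.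
  by apply: filter_forall => j; exact: glim.
apply: filterS fin => n hn t.
have [s /andP[s0 sT] es] := period_reduction T_gt0 t.
rewrite (es _ (pu n)) (es _ pg).
have sd0 : 0 <= s / d by rewrite divr_ge0 // ltW.
pose j := Num.truncn (s / d).
have jm : (j < m.+1)%N.
  by rewrite ltnS; apply: le_truncn; rewrite ler_pM2r ?invr_gt0.
have /andP[j1 j2] : j%:R * d <= s < (j%:R + 1) * d.
  rewrite -ler_pdivlMr // -ltr_pdivrMr // natr1.
  exact: truncn_itv.
have dist : `|s - j%:R * d| < d by rewrite ger0_norm; lra.
have a1 := hd1 n _ _ (lt_le_trans dist _).
have a2 := hd2 _ _ (lt_le_trans dist _).
have a3 := hn (Ordinal jm).
have {}a1 : `|u n s - u n (j%:R * d)| <= e / 3 by apply: a1; rewrite ge_min lexx.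
have {}a2 : `|g s - g (j%:R * d)| <= e / 3 by apply: a2; rewrite ge_min lexx orbT.
have -> : u n s - g s = (u n s - u n (j%:R * d)) + (u n (j%:R * d) - g (j%:R * d))
   - (g s - g (j%:R * d)) by ring.
rewrite /= in a3.
have := ler_normB (u n s - u n (j%:R * d) + (u n (j%:R * d) - g (j%:R * d))) (g s - g (j%:R * d)).
have := ler_normD (u n s - u n (j%:R * d)) (u n (j%:R * d) - g (j%:R * d)).
lra.
Unshelve. all: by end_near. Qed.
End Ascoli.

(** * Periodic Sturm-Liouville operators *)

(** The discriminant test. When c = 0 the coefficient b must vanish, and a
   negative c is excluded by a large s of either sign. *)
Lemma quadratic_psd_cauchy (R : realFieldType) (a b c : R) :
  (forall s, 0 <= a + 2 * s * b + s ^+ 2 * c) -> b ^+ 2 <= a * c.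
Proof.
move=> h; have a0 : 0 <= a by have := h 0; rewrite expr2 !(mulr0, mul0r) !addr0.
have [c0|c0|c0] := ltgtP c 0; last first.
- have [->|bn0] := eqVneq b 0; first by rewrite c0 expr2 !mulr0.
  have := h (- (a + 1) / (2 * b)); rewrite c0 mulr0 addr0.
  have -> : 2 * (- (a + 1) / (2 * b)) * b = - (a + 1) by field.
  by lra.
- have := h (- b / c).
  have -> : a + 2 * (- b / c) * b + (- b / c) ^+ 2 * c = (a * c - b ^+ 2) / c.
    by field; rewrite gt_eqF.
  by rewrite pmulr_lge0 ?invr_gt0 // subr_ge0.
- pose s := (a + 1 + `|b|) / - c + 1.
  exfalso.
  have bc : 0 < - c by rewrite oppr_gt0.
  have n0 := normr_ge0 b.
  have s1 : 1 <= s by rewrite /s lerDr; apply: divr_ge0; lra.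
  have sc : s * - c = a + 1 + `|b| - c by rewrite /s mulrDl mul1r divfK ?gt_eqF.
  have h1 := h s; have h2 := h (- s).
  have h3 : 0 <= a + s ^+ 2 * c by move: h1 h2; rewrite sqrrN; lra.
  have : s * (s * - c) >= 1 * (a + 1).
    apply: ler_pM => //; first by rewrite addr_ge0.
    by rewrite sc; have := normr_ge0 b; lra.
  by move: h3; rewrite expr2; lra.
Qed.

Section SturmLiouville.
Variables (R : realType) (T : R) (p w r : R -> R).
Hypotheses (T_gt0 : 0 < T).
Hypotheses (cp : continuous p) (pp : periodic p T) (p_gt0 : forall t, 0 < p t).
Hypotheses (cw : continuous w) (pw : periodic w T) (w_gt0 : forall t, 0 < w t).
Hypotheses (cr : continuous r) (pr : periodic r T).
Implicit Types u v m g phi : R -> R.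

Local Notation int := (intT T).

(** The function m is the image of u under the operator - (p u')' + r u. The
   operator is used through its graph: the energy of u is then the integral of
   m u, with no reference to second derivatives. *)
Definition sl_eq u m := [/\ continuous m, periodic u T &
  exists2 du, has_deriv u du &
    has_deriv (fun t => p t * du t) (fun t => r t * u t - m t)].

Definition wdot u v := int (fun t => w t * u t * v t).

Let p_neq0 t : p t != 0. Proof. by rewrite gt_eqF. Qed.

Let flux_continuous du F : has_deriv (fun t => p t * du t) F -> continuous du.
Proof.
move=> /has_deriv_continuous cpd.
have -> : du = fun t => (p t * du t) / p t.
  by apply/funext => t; rewrite mulrC mulKf.
by continuity.
Qed.

Lemma sl_continuous u m : sl_eq u m -> continuous u.
Proof. by case=> _ _ [du /has_deriv_continuous]. Qed.

Lemma sl_periodic_r u m : sl_eq u m -> periodic m T.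
Proof.
case=> cm pu [du hu hpu] t.
have pdu := periodic_deriv hu pu.
have /periodic_deriv/(_ _) := hpu => /(_ T) h.
have /h/(_ t) : periodic (fun t => p t * du t) T by move=> s; rewrite pp pdu.
by rewrite pr pu; lra.
Qed.

(** Integration by parts; the right-hand side is symmetric in u and v. *)
Lemma sl_energy u m du v n dv :
  continuous m -> periodic u T -> has_deriv u du ->
  has_deriv (fun t => p t * du t) (fun t => r t * u t - m t) ->
  sl_eq v n -> has_deriv v dv ->
  int (fun t => m t * v t) = int (fun t => p t * du t * dv t + r t * u t * v t).
Proof.
move=> cm pu hu hpu [cn pv [dv' hv' hpv]] hv.
have edv := has_deriv_unique hv' hv.
rewrite edv in hpv.
have cu := has_deriv_continuous hu; have cv := has_deriv_continuous hv.
have cdu := flux_continuous hpu; have cdv := flux_continuous hpv.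
have pdu := periodic_deriv hu pu.
have cF : continuous (fun t => r t * u t - m t) by continuity.
have := intT_by_parts T_gt0 hpu hv cF cdv.
have -> : (fun t => (r t * u t - m t) * v t) =
  (fun t => r t * u t * v t - m t * v t) by apply/funext => t; ring.
rewrite intTB; try by continuity.
rewrite intTD; try by continuity.
have ppdu : periodic (fun t => p t * du t) T by move=> t; rewrite pp pdu.
by move=> /(_ ppdu pv); lra.
Qed.

Lemma sl_sym u m v n : sl_eq u m -> sl_eq v n ->
  int (fun t => m t * v t) = int (fun t => u t * n t).
Proof.
move=> uD vD; case: (uD) => cm pu [du hu hpu]; case: (vD) => cn pv [dv hv hpv].
rewrite (sl_energy cm pu hu hpu vD hv).
transitivity (int (fun t => n t * u t)); last first.
  by congr intT; apply/funext => t; rewrite mulrC.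
rewrite (sl_energy cn pv hv hpv uD hu).
by congr intT; apply/funext => t; ring.
Qed.

Lemma sl_lin (a b : R) u m v n : sl_eq u m -> sl_eq v n ->
  sl_eq (fun t => a * u t + b * v t) (fun t => a * m t + b * n t).
Proof.
move=> [cm pu [du hu hpu]] [cn pv [dv hv hpv]]; split.
- by continuity.
- by move=> t; rewrite pu pv.
- exists (fun t => a * du t + b * dv t) => t; first by derive_by; ring.
  have -> : (fun t => p t * (a * du t + b * dv t)) =
     (fun t => a * (p t * du t) + b * (p t * dv t)) by apply/funext => s; ring.
  apply: (is_derive_eq (is_derive_add (is_derive_mul (is_derive_const t 1 a) (hpu t))
    (is_derive_mul (is_derive_const t 1 b) (hpv t)))).
  by ring.
Qed.

Lemma sl_zero : sl_eq (fun=> 0) (fun=> 0).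
Proof.
split=> [||]; [exact: continuous_const|by []|exists (fun=> 0) => t].
  exact: is_derive_const.
under eq_fun do rewrite mulr0.
by rewrite mulr0 subrr; exact: is_derive_const.
Qed.

Lemma sl_sum (I : finType) (c : I -> R) (u m : I -> R -> R) :
  (forall i, sl_eq (u i) (m i)) ->
  sl_eq (fun t => \sum_i c i * u i t) (fun t => \sum_i c i * m i t).
Proof.
move=> h; elim: (index_enum I) => [|i s IH].
  by under eq_fun do rewrite big_nil; under [X in sl_eq _ X]eq_fun do
    rewrite big_nil; exact: sl_zero.
under eq_fun do rewrite big_cons; under [X in sl_eq _ X]eq_fun do rewrite big_cons.
under eq_fun do rewrite -[X in _ + X]mul1r.
under [X in sl_eq _ X]eq_fun do rewrite -[X in _ + X]mul1r.
exact: sl_lin.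
Qed.

Lemma wdotC u v : wdot u v = wdot v u.
Proof. by congr intT; apply/funext => t; ring. Qed.

Lemma wdot_lin (a b : R) u v g : continuous u -> continuous v -> continuous g ->
  wdot (fun t => a * u t + b * v t) g = a * wdot u g + b * wdot v g.
Proof.
move=> cu cv cg; rewrite /wdot -!intTZ; try by continuity.
rewrite -intTD; try by continuity.
by congr intT; apply/funext => t; ring.
Qed.

Lemma wdot_sum (I : finType) (c : I -> R) (u : I -> R -> R) g :
  (forall i, continuous (u i)) -> continuous g ->
  wdot (fun t => \sum_i c i * u i t) g = \sum_i c i * wdot (u i) g.
Proof.
move=> cu cg; transitivity (\sum_i int (fun t => c i * (w t * u i t * g t))).
  rewrite -intT_sum //; last by move=> i; continuity.
  congr intT; apply/funext => t.
  by rewrite mulr_sumr mulr_suml; apply: eq_bigr => i _; ring.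
by apply: eq_bigr => i _; rewrite intTZ //; continuity.
Qed.

Lemma wdot_ge0 u : continuous u -> 0 <= wdot u u.
Proof.
move=> cu; apply: intT_ge0 => //; first by continuity.
by move=> t; rewrite -mulrA mulr_ge0 ?(ltW (w_gt0 _)) // -expr2 sqr_ge0.
Qed.

Lemma wdot_eq0 u : continuous u -> periodic u T -> wdot u u = 0 -> u = (fun=> 0).
Proof.
move=> cu pu h; apply/funext => t.
have := @intT_eq0 R T T_gt0 (fun t => w t * u t * u t) _ _ _ h t.
have f0 s : 0 <= w s * u s * u s by rewrite -mulrA mulr_ge0 ?(ltW (w_gt0 _)) // -expr2 sqr_ge0.
move=> /(_ _ _ f0) e; apply/eqP/negPn/negP => ut.
have : w t * u t * u t != 0 by rewrite !mulf_neq0 // gt_eqF.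
rewrite e ?eqxx //; first by continuity.
by move=> s; rewrite pw pu.
Qed.

Lemma wdot_gt0 u : continuous u -> periodic u T -> (exists t, u t != 0) ->
  0 < wdot u u.
Proof.
move=> cu pu [t ut]; rewrite lt_neqAle wdot_ge0 // andbT eq_sym.
by apply: contraNN ut => /eqP h; rewrite (wdot_eq0 cu pu h).
Qed.

(** The lemma of du Bois-Reymond. Let G solve (p G')' = (r - V) g. Then g - G is
   orthogonal to every function (p phi')', that is, to every function of mean
   zero, so that it is constant and g inherits the equation of G. *)
Lemma sl_weak_strong g (V : R -> R) :
  continuous g -> periodic g T -> continuous V -> periodic V T ->
  (forall phi n, sl_eq phi n ->
     int (fun t => g t * (n t - V t * phi t)) = 0) ->
  sl_eq g (fun t => V t * g t).
Proof.
move=> cg pg cV pV weak.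
have cip : continuous (fun t => (p t)^-1) by apply: continuous_inv.
(* The constant in the antiderivative of psi is chosen to make phi periodic. *)
have solve psi : continuous psi -> periodic psi T -> int psi = 0 ->
   exists phi dphi, [/\ has_deriv phi dphi, periodic phi T &
     has_deriv (fun t => p t * dphi t) psi].
  move=> cpsi ppsi int0.
  have hP := primP cpsi; have cP := has_deriv_continuous hP.
  have pP := periodic_antiderivative T_gt0 cpsi ppsi hP int0.
  pose ci := int (fun t => (p t)^-1); pose c := int (fun t => prim psi t / p t) / ci.
  have ci0 : ci != 0.
    rewrite gt_eqF //; apply: intT_gt0 => //.
    - by move=> t; rewrite pp.
    - by move=> t; rewrite invr_ge0 ltW.
    - by exists 0; rewrite invr_eq0.
  pose dphi t := (prim psi t - c) / p t.
  have cdphi : continuous dphi by rewrite /dphi; continuity; exact: continuous_const.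
  have idphi : int dphi = 0.
    have -> : dphi = fun t => prim psi t / p t - c * (p t)^-1.
      by apply/funext => t; rewrite /dphi; ring.
    rewrite intTB ?intTZ; try by continuity; try exact: continuous_const.
    by rewrite -/ci /c divfK ?subrr.
  exists (prim dphi), dphi; split.
  - exact: primP.
  - apply: (periodic_antiderivative T_gt0 cdphi) => //; last exact: primP.
    by move=> t; rewrite /dphi pP pp.
  - have -> : (fun t => p t * dphi t) = (fun t => prim psi t - c).
      by apply/funext => t; rewrite /dphi mulrC divfK.
    by move=> t; derive_by; ring.
pose U t := r t - V t.
have cU : continuous U by rewrite /U; continuity.
have weak' phi dphi psi : continuous psi -> has_deriv phi dphi ->
   periodic phi T -> has_deriv (fun t => p t * dphi t) psi ->
   int (fun t => g t * psi t) = int (fun t => U t * g t * phi t).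
  move=> cpsi hphi pphi hpsi; have cphi := has_deriv_continuous hphi.
  have sl : sl_eq phi (fun t => r t * phi t - psi t).
    split=> //; first by continuity.
    exists dphi => // t; apply: (is_derive_eq (hpsi t)).
    by rewrite opprB addrC subrK.
  have := weak _ _ sl => h; apply/eqP; rewrite -subr_eq0 -oppr_eq0 opprB.
  rewrite -intTB; try by continuity.
  rewrite -[X in _ == X]h; apply/eqP; congr intT; apply/funext => t.
  by rewrite /U; ring.
have intU : int (fun t => U t * g t) = 0.
  have h0 : has_deriv (fun t => p t * 0) (fun=> 0).
    move=> t; under eq_fun do rewrite mulr0.
    exact: is_derive_const.
  have := @weak' (fun=> 1) (fun=> 0) (fun=> 0) (@continuous_const _ _ _)
    (fun t => is_derive_const _ _ _) (fun=> erefl) h0.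
  have -> : (fun t => g t * 0) = (fun=> 0) by apply/funext => t; rewrite mulr0.
  rewrite intT0 // => e; symmetry; rewrite [LHS]e; congr intT.
  by apply/funext => t; rewrite mulr1.
have cUg : continuous (fun t => U t * g t) by continuity.
(* Testing with constants shows that (r - V) g has mean zero. *)
have [|G [dG [hG pG hpG]]] := solve _ cUg _ intU.
  by move=> t; rewrite /U pr pV pg.
have cG := has_deriv_continuous hG.
pose d t := g t - G t; pose mn := int d / T; pose psi t := d t - mn.
have cd : continuous d by rewrite /d; continuity.
have cpsi : continuous psi by rewrite /psi; continuity; exact: continuous_const.
have ppsi : periodic psi T by move=> t; rewrite /psi /d pg pG.
have ipsi : int psi = 0.
  rewrite intTB ?intT_const //; last exact: continuous_const.
  by rewrite /mn divfK ?subrr ?gt_eqF.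
have [phi [dphi [hphi pphi hpsi]]] := solve _ cpsi ppsi ipsi.
have cphi := has_deriv_continuous hphi.
have e1 := weak' _ _ _ cpsi hphi pphi hpsi.
have cdG := flux_continuous hpG; have cdphi := flux_continuous hpsi.
have pdG := periodic_deriv hG pG; have pdphi := periodic_deriv hphi pphi.
have e2 : int (fun t => U t * g t * phi t) = int (fun t => G t * psi t).
  rewrite (intT_by_parts T_gt0 hpG hphi) //; last by move=> t; rewrite pp pdG.
  apply/eqP; rewrite eq_sym -eqr_oppLR -mulN1r; apply/eqP.
  rewrite -intTZ //; last by continuity.
  have := intT_by_parts T_gt0 hpsi hG cpsi cdG.
  rewrite (_ : (fun t => psi t * G t) = (fun t => G t * psi t)); last first.
    by apply/funext => t; rewrite mulrC.
  move=> h; rewrite intTZ; try by continuity.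
  rewrite mulN1r h ?opprK //.
    by congr intT; apply/funext => t; ring.
  by move=> t; rewrite pp pdphi.
have ipsi2 : int (fun t => psi t * psi t) = 0.
  have -> : (fun t => psi t * psi t) =
     (fun t => g t * psi t - G t * psi t - mn * psi t).
    by apply/funext => t; rewrite /psi /d; ring.
  rewrite !intTB ?intTZ //; try by continuity.
  by rewrite e1 e2 ipsi; ring.
have psi0 t : psi t = 0.
  apply/eqP; rewrite -sqrf_eq0 expr2; apply/eqP.
  apply: (@intT_eq0 R T T_gt0 (fun t => psi t * psi t)) => //.
  - by continuity.
  - by move=> s; rewrite ppsi.
  - by move=> s; rewrite -expr2 sqr_ge0.
have eg : g = fun t => G t + mn.
  by apply/funext => t; have := psi0 t; rewrite /psi /d; lra.
split=> //; first by continuity.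
exists dG => t; first by rewrite eg; derive_by; ring.
by apply: (is_derive_eq (hpG t)); rewrite /U; ring.
Qed.

Section Family.
Variables (J : finType) (e : J -> R -> R) (lam : J -> R).
Hypothesis e_eig : forall j, sl_eq (e j) (fun t => lam j * (w t * e j t)).
Hypothesis e_orth : forall i j, i != j -> wdot (e i) (e j) = 0.

Definition perp u := forall j, wdot u (e j) = 0.

Let ce j : continuous (e j). Proof. exact: sl_continuous (e_eig j). Qed.

Let proj_coef u j := wdot u (e j) / wdot (e j) (e j).

Lemma perp_lin (a b : R) u v : continuous u -> continuous v ->
  perp u -> perp v -> perp (fun t => a * u t + b * v t).
Proof. by move=> cu cv hu hv j; rewrite wdot_lin // hu hv; ring. Qed.

(** A function is corrected by eigenfunctions to become orthogonal to the
   family; the correction of m is known, as the e j satisfy their equations. *)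
Lemma sl_decomp u m : sl_eq u m -> exists c : J -> R, exists u' m',
  [/\ sl_eq u' m', perp u', u = (fun t => u' t + \sum_j c j * e j t) &
   m = (fun t => m' t + \sum_j c j * (lam j * (w t * e j t)))].
Proof.
move=> um; pose c := proj_coef u; exists c.
exists (fun t => 1 * u t + (-1) * \sum_j c j * e j t).
exists (fun t => 1 * m t + (-1) * \sum_j c j * (lam j * (w t * e j t))).
have cs : continuous (fun t => \sum_j c j * e j t).
  by apply: continuous_bigsum => j; continuity.
have cu := sl_continuous um.
split.
- by apply: sl_lin => //; exact: (sl_sum c e_eig).
- move=> j; rewrite wdot_lin // wdot_sum // (bigD1 j) //= big1.
    rewrite /c /proj_coef addr0.
    have [e0|en0] := eqVneq (wdot (e j) (e j)) 0; last by rewrite divfK //; ring.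
    have [_ pe _] := e_eig j.
    have -> : e j = fun=> 0 by apply: wdot_eq0.
    rewrite (_ : wdot u _ = 0); first by ring.
    by rewrite /wdot -[RHS](intT0 T_gt0); congr intT; apply/funext => t; rewrite mulr0.
  by move=> i ij; rewrite e_orth // mulr0.
- by apply/funext => t; ring.
- by apply/funext => t; ring.
Qed.

(** Lower bounds of the Rayleigh quotient on the orthogonal of the family. *)
Definition energy_above (l : R) := forall u m, sl_eq u m -> perp u ->
  l * wdot u u <= int (fun t => m t * u t).

(** The Cauchy-Schwarz inequality for the nonnegative form energy - l * norm. On
   the left the operator is applied to v, so that only values of u occur: this
   side passes to uniform limits of u. *)
Lemma energy_cauchy l u m v n : energy_above l ->
  sl_eq u m -> perp u -> sl_eq v n -> perp v ->
  (int (fun t => u t * (n t - l * (w t * v t)))) ^+ 2 <=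
  (int (fun t => m t * u t) - l * wdot u u) *
  (int (fun t => n t * v t) - l * wdot v v).
Proof.
move=> psd um pu vn pv; apply: quadratic_psd_cauchy => s.
have cu := sl_continuous um; have cv := sl_continuous vn.
have [cm _ _] := um; have [cn _ _] := vn.
have := psd _ _ (sl_lin 1 s um vn) (perp_lin 1 s cu cv pu pv).
rewrite -subr_ge0; congr (0 <= _).
have e1 : int (fun t => (1 * m t + s * n t) * (1 * u t + s * v t)) =
   int (fun t => m t * u t) + s * int (fun t => m t * v t) +
   s * int (fun t => u t * n t) + s ^+ 2 * int (fun t => n t * v t).
  rewrite -!intTZ // -?intTD //; try by continuity.
  by congr intT; apply/funext => t; ring.
have e2 : wdot (fun t => 1 * u t + s * v t) (fun t => 1 * u t + s * v t) =
   wdot u u + 2 * s * wdot u v + s ^+ 2 * wdot v v.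
  rewrite /wdot -!intTZ // -?intTD //; try by continuity.
  by congr intT; apply/funext => t; ring.
have e3 : int (fun t => u t * (n t - l * (w t * v t))) =
   int (fun t => u t * n t) - l * wdot u v.
  rewrite /wdot -!intTZ // -?intTB //; try by continuity.
  by congr intT; apply/funext => t; ring.
by rewrite e1 e2 e3 (sl_sym um vn); ring.
Qed.

(** By [energy_cauchy], a small excess energy of u i makes its integral against
   (L - l w) phi small for every phi orthogonal to the family, where L denotes the
   operator. At the limit g is a weak solution, hence a solution. *)
Lemma sl_minimizing_limit (I : Type) (F : set_system I) {FF : ProperFilter F}
  (u m : I -> R -> R) g l :
  energy_above l -> continuous g -> periodic g T ->
  (forall i, sl_eq (u i) (m i)) -> (forall i, perp (u i)) ->
  (forall eps : R, 0 < eps -> \forall i \near F, forall t, `|u i t - g t| <= eps) ->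
  (forall eps : R, 0 < eps -> \forall i \near F,
     int (fun t => m i t * u i t) - l * wdot (u i) (u i) <= eps) ->
  sl_eq g (fun t => l * w t * g t) /\ perp g.
Proof.
move=> psd cg pg um pu ug qu.
have lim h : continuous h -> periodic h T -> forall eps : R, 0 < eps ->
   \forall i \near F, `|int (fun t => u i t * h t) - int (fun t => g t * h t)| <= eps.
  move=> ch ph eps eps0; have [M hM] := periodic_bounded T_gt0 ch ph.
  have M0 : 0 <= M by rewrite (le_trans _ (hM 0)).
  have d0 : 0 < eps / ((M + 1) * T).
    by rewrite divr_gt0 // mulr_gt0 //; rewrite ltr_wpDl.
  apply: filterS (ug _ d0) => i hi; have cui := sl_continuous (um i).
  rewrite -intTB //; try by continuity.
  have -> : eps = eps / ((M + 1) * T) * (M + 1) * T by field; rewrite ?gt_eqF //; lra.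
  apply: intT_abs_le => //; first by continuity.
  move=> t; rewrite -mulrBl normrM; apply: ler_pM => //.
  by have := hM t; lra.
have small (x K : R) : 0 <= K -> (forall eps : R, 0 < eps -> x ^+ 2 <= K * eps) -> x = 0.
  move=> K0 hx; apply/eqP; rewrite -sqrf_eq0 -normr_le0 ger0_norm ?sqr_ge0 //.
  apply/ler_addgt0Pr => /= eps eps0; rewrite add0r.
  apply: le_trans (hx (eps / (K + 1)) _) _; first by rewrite divr_gt0 // ltr_wpDl.
  rewrite mulrA ler_pdivrMr; last by lra.
  by rewrite mulrC ler_pM2l //; lra.
have pg_ : perp g.
  move=> j; have [_ pe _] := e_eig j.
  apply: (@small _ 1) => // eps eps0.
  have ch : continuous (fun t => w t * e j t) by continuity.
  have ph : periodic (fun t => w t * e j t) T by move=> t; rewrite pw pe.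
  have s0 : 0 < Num.sqrt eps by rewrite sqrtr_gt0.
  have [i] := filter_ex (lim _ ch ph _ s0).
  have E v : int (fun t => v t * (w t * e j t)) = wdot v (e j).
    by congr intT; apply/funext => t; ring.
  rewrite !E pu sub0r normrN -ler_sqr ?nnegrE ?sqrtr_ge0 //.
  by rewrite real_normK ?num_real // sqr_sqrtr ?(ltW eps0) // mul1r.
split=> //.
have cl : continuous (fun t => l * w t) by continuity.
apply: sl_weak_strong => //; first by move=> t; rewrite pw.
move=> phi n phin.
have [c [phi' [n' [sl' perp' -> ->]]]] := sl_decomp phin.
have cphi' := sl_continuous sl'; have [cn' pphi' _] := sl'.
have pn' := sl_periodic_r sl'.
have cs (f : J -> R) : continuous (fun t => \sum_j f j * e j t).
  by apply: continuous_bigsum => j; continuity.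
have -> : (fun t => g t * (n' t + \sum_j c j * (lam j * (w t * e j t)) -
    l * w t * (phi' t + \sum_j c j * e j t))) =
  (fun t => g t * (n' t - l * (w t * phi' t)) +
     w t * (\sum_j (c j * (lam j - l)) * e j t) * g t).
  apply/funext => t.
  have -> : \sum_j c j * (lam j * (w t * e j t)) =
     w t * (\sum_j c j * (lam j - l) * e j t) + l * w t * \sum_j c j * e j t.
    by rewrite !mulr_sumr -big_split; apply: eq_bigr => j _ /=; ring.
  by ring.
rewrite intTD //; try by continuity.
rewrite -/(wdot _ g) wdot_sum // big1 ?addr0; last first.
  by move=> j _; rewrite wdotC pg_ mulr0.
set h := fun t => n' t - l * (w t * phi' t).
have ch : continuous h by rewrite /h; continuity.
have ph : periodic h T by move=> t; rewrite /h pn' pw pphi'.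
pose q := int (fun t => n' t * phi' t) - l * wdot phi' phi'.
have q0 : 0 <= q by rewrite subr_ge0; exact: psd.
apply: (@small _ (2 * q + 2)) => [|eps eps0]; first by lra.
have s0 : 0 < Num.sqrt eps by rewrite sqrtr_gt0.
have [i [h1 h2]] : exists i,
   `|int (fun t => u i t * h t) - int (fun t => g t * h t)| <= Num.sqrt eps /\
   int (fun t => m i t * u i t) - l * wdot (u i) (u i) <= eps.
  by near F => i; exists i; split; near: i; [exact: lim|exact: qu].
have h3 := energy_cauchy psd (um i) (pu i) sl' perp'.
rewrite -/h -/q in h3.
set a := int (fun t => u i t * h t) in h1 h3; set b := int (fun t => g t * h t) in h1 *.
have h4 : a ^+ 2 <= eps * q.
  by apply: le_trans h3 _; apply: ler_wpM2r.
have h5 : (a - b) ^+ 2 <= eps.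
  rewrite -[leRHS]sqr_sqrtr ?(ltW eps0) // -real_normK ?num_real // ler_sqr ?nnegrE //.
have := sqr_ge0 (a + (a - b)).
have : (a + (a-b)) ^+ 2 + b ^+ 2 = 2 * a ^+ 2 + 2 * (a - b) ^+ 2 by ring.
lra.
Unshelve. all: by end_near. Qed.

Let u_energy u m du : sl_eq u m -> has_deriv u du ->
  int (fun t => m t * u t) = int (fun t => p t * du t ^+ 2 + r t * u t ^+ 2).
Proof.
move=> um hu; case: (um) => cm pu [du' hu' hpu].
have edu := has_deriv_unique hu' hu.
rewrite edu in hpu; rewrite (sl_energy cm pu hu hpu um hu).
by congr intT; apply/funext => t; ring.
Qed.

(** The zero-order term r u^2 is controlled by a multiple of the weight. *)
Lemma dirichlet_bound : exists C, 0 <= C /\ forall u m du, sl_eq u m -> has_deriv u du ->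
  int (fun t => p t * du t ^+ 2) <= int (fun t => m t * u t) + C * wdot u u.
Proof.
have cq : continuous (fun t => r t / w t) by continuity; move=> t; rewrite gt_eqF.
have [|C hC] := periodic_bounded T_gt0 cq; first by move=> t; rewrite pr pw.
exists C; split; first by rewrite (le_trans _ (hC 0)).
move=> u m du um hu; rewrite (u_energy um hu).
have [cm pu [du' hu' hpu]] := um.
have edu := has_deriv_unique hu' hu.
rewrite edu in hpu; have cdu := flux_continuous hpu; have cu := sl_continuous um.
rewrite /wdot -intTZ // -?intTD //; try by continuity.
apply: intT_le => //; try by continuity.
move=> t; rewrite -addrA lerDl.
have -> : r t * u t ^+ 2 + C * (w t * u t * u t) =
  (r t / w t + C) * (w t * u t ^+ 2) by field; rewrite gt_eqF.
rewrite mulr_ge0 //; last by rewrite mulr_ge0 ?sqr_ge0 // ltW.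
by have := hC t; rewrite ler_norml; lra.
Qed.

(** A bound on the integral of u'^2 makes u Hoelder continuous with exponent 1/2.
   The free parameter a of Young's inequality stands for the optimal choice
   a = sqrt ((t - s) / K), and avoids the Cauchy-Schwarz inequality for
   integrals. *)
Lemma h1_modulus u m du K : sl_eq u m -> has_deriv u du -> continuous du ->
  int (fun t => du t ^+ 2) <= K ->
  forall (a : R), 0 < a -> forall s t, s <= t -> t <= s + T ->
  `|u t - u s| <= (a * K + (t - s) / a) / 2.
Proof.
move=> um hu cdu hK a a0 s t st tsT; have [_ pu _] := um.
have pdu := periodic_deriv hu pu.
have cd2 : continuous (fun t => du t ^+ 2) by continuity.
have hP := primP cd2; set P := prim _ in hP.
have PK : P t - P s <= K.
  have mono x y : x <= y -> P x <= P y.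
    by move=> xy; apply: (deriv_ge0_homo xy (fun t _ => hP t)) => z _; exact: sqr_ge0.
  have cst : has_deriv (fun x => P (x + T) - P x) (fun=> 0).
    move=> x; apply: (is_derive_eq (is_derive_add (is_derive_shiftT T x hP)
      (is_derive_opp (hP x)))).
    by rewrite pdu subrr.
  have e0 : P (s + T) - P s = P T - P 0 by rewrite (deriv0_const cst s 0) add0r.
  by have := mono _ _ tsT; move: hK; rewrite /intT -/P -e0; lra.
(* Young's inequality 2 |u'| <= a u'^2 + 1/a, integrated. *)
have main (eps : R) : eps ^+ 2 = 1 -> eps * (u t - u s) <= (a * K + (t - s) / a) / 2.
  move=> e1; pose H x := (a * P x + x * a^-1) / 2 - eps * u x.
  pose dH x := (a * du x ^+ 2 + a^-1) / 2 - eps * du x.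
  have hH : forall x, s <= x <= t -> is_derive x 1 H (dH x).
    by move=> x _; rewrite /H /dH; derive_by; ring.
  have : H s <= H t.
    apply: (deriv_ge0_homo st hH) => x _; rewrite /dH.
    have -> : (a * du x ^+ 2 + a^-1) / 2 - eps * du x =
       (a * du x ^+ 2 * eps ^+ 2 + a^-1) / 2 - eps * du x by rewrite e1 mulr1.
    have -> : (a * du x ^+ 2 * eps ^+ 2 + a^-1) / 2 - eps * du x =
       (a * eps * du x - 1) ^+ 2 / (2 * a) by field; rewrite gt_eqF.
    by rewrite divr_ge0 ?sqr_ge0 // mulr_ge0 // ltW.
  have : a * (P t - P s) <= a * K by rewrite ler_pM2l.
  by rewrite /H; lra.
rewrite ler_norml; apply/andP; split.
  by have := main (-1); rewrite sqrrN expr1n => /(_ erefl); lra.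
by have := main 1; rewrite expr1n => /(_ erefl); lra.
Qed.

Lemma sl_scale (a : R) u m : sl_eq u m -> sl_eq (fun t => a * u t) (fun t => a * m t).
Proof.
move=> um; have := sl_lin a 0 um um.
by under eq_fun do rewrite mul0r addr0; under [X in sl_eq _ X]eq_fun do
  rewrite mul0r addr0.
Qed.

Lemma wdot_scale (a : R) u v : continuous u -> continuous v ->
  wdot (fun t => a * u t) v = a * wdot u v.
Proof.
move=> cu cv; rewrite /wdot -intTZ //; try by continuity.
by congr intT; apply/funext => t; ring.
Qed.

(** A function of norm 1 is not large everywhere, and its modulus of continuity
   extends the bound at one point to a whole period. *)
Lemma unit_energy_bounds (E : R) : exists M K : R, 0 < K /\
  forall u m, sl_eq u m -> wdot u u = 1 -> int (fun t => m t * u t) <= E ->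
  (forall t, `|u t| <= M) /\
  forall (a : R), 0 < a -> forall s t, s <= t -> t <= s + T ->
    `|u t - u s| <= (a * K + (t - s) / a) / 2.
Proof.
have [C [C0 hC]] := dirichlet_bound.
have [p0 p00 hp0] := periodic_pos_lower_bound T_gt0 cp pp p_gt0.
have W0 : 0 < int w by apply: intT_gt0 => //; [move=> t; exact: ltW|
  exists 0; rewrite gt_eqF].
(* The square of c times the integral of w exceeds 1. *)
pose K := `|E + C| / p0 + 1; pose c := 1 + (int w)^-1.
have K0 : 0 < K by rewrite ltr_wpDl // divr_ge0 // ltW.
exists (c + (K + T) / 2), K; split=> // u m um u1 uE.
have [_ pu [du hu hpu]] := um; have cu := sl_continuous um.
have cdu := flux_continuous hpu.
have hK : int (fun t => du t ^+ 2) <= K.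
  have h1 := hC _ _ _ um hu; rewrite u1 mulr1 in h1.
  have h2 : p0 * int (fun t => du t ^+ 2) <= int (fun t => p t * du t ^+ 2).
    rewrite -intTZ //; try by continuity.
    apply: intT_le => //; try by continuity.
    by move=> t; rewrite ler_wpM2r ?sqr_ge0.
  rewrite /K; apply: (@le_trans _ _ (`|E + C| / p0)); last by lra.
  rewrite ler_pdivlMr // mulrC; have := ler_norm (E + C); lra.
have modul := h1_modulus um hu cdu hK.
split=> [t|//].
have [t0 ht0] : exists t0, `|u t0| <= c.
  apply/not_existsP => hn.
  have hn' t0 : c < `|u t0| by rewrite ltNge; apply/negP => /hn.
  have c0 : 0 < c by rewrite ltr_pwDl // invr_ge0 ltW.
  have : c ^+ 2 * int w <= wdot u u.
    rewrite -intTZ //; apply: intT_le => //; try by continuity.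
    move=> s; rewrite -mulrA -expr2 mulrC ler_wpM2l ?(ltW (w_gt0 _)) //.
    by apply: ltW; rewrite -[ltRHS]real_normK ?num_real // ltr_sqr ?nnegrE ?(ltW c0).
  rewrite u1 /c.
  have -> : (1 + (int w)^-1) ^+ 2 * int w = int w + 2 + (int w)^-1.
    by field; rewrite gt_eqF.
  have : 0 < (int w)^-1 by rewrite invr_gt0.
  by lra.
have [s /andP[s0 sT] es] := period_reduction T_gt0 (t - t0).
have pus : periodic (fun x => u (x + t0)) T by move=> x; rewrite addrAC pu.
have -> : u t = u (s + t0) by rewrite -(es _ pus) subrK.
have h0 : t0 <= s + t0 by rewrite lerDr.
have h1 : s + t0 <= t0 + T by rewrite addrC lerD2l.
have := modul 1 ltr01 t0 (s + t0) h0 h1.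
rewrite divr1 mul1r addrK.
have := ler_normD (u (s + t0) - u t0) (u t0); rewrite subrK.
by lra.
Qed.

(** The direct method: a normalised minimising sequence of the Rayleigh quotient
   on the orthogonal of the family is bounded and equicontinuous, hence has a
   uniform limit, and this limit is an eigenfunction for the infimum. *)
Theorem sl_min_eigenfunction u0 m0 : sl_eq u0 m0 -> perp u0 ->
  (exists t, u0 t != 0) ->
  exists l g, [/\ l * wdot u0 u0 <= int (fun t => m0 t * u0 t),
    sl_eq g (fun t => l * w t * g t), perp g, energy_above l & exists t, g t != 0].
Proof.
move=> um0 perp0 nz0.
pose S := [set q | exists u m, [/\ sl_eq u m, perp u, wdot u u = 1 &
  q = int (fun t => m t * u t)]].
have normalize u m : sl_eq u m -> perp u -> (exists t, u t != 0) ->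
    S (int (fun t => m t * u t) / wdot u u).
  move=> um pu nz; have [cm pru _] := um; have cu := sl_continuous um.
  have N0 := wdot_gt0 cu pru nz.
  pose a := (Num.sqrt (wdot u u))^-1.
  have aa : a * a * wdot u u = 1.
    rewrite /a -invfM -expr2 sqr_sqrtr ?ltW // mulVf // gt_eqF //.
  have au := sl_scale a um; have cau := sl_continuous au.
  exists (fun t => a * u t), (fun t => a * m t); split=> //.
  - by move=> j; rewrite wdot_scale // pu mulr0.
  - by rewrite wdot_scale // wdotC wdot_scale // mulrA.
  - have -> : (fun t => a * m t * (a * u t)) = (fun t => a * a * (m t * u t)).
      by apply/funext => t; ring.
    rewrite intTZ //; try by continuity.
    by apply: (@mulIf _ (wdot u u)); [rewrite gt_eqF | rewrite divfK ?gt_eqF // mulrAC aa mul1r].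
have [C [C0 hC]] := dirichlet_bound.
have infS : has_inf S.
  split; first by exists (int (fun t => m0 t * u0 t) / wdot u0 u0); exact: normalize.
  exists (- C) => q [u [m [um pu u1 ->]]].
  have [_ _ [du hu hpu]] := um.
  have := hC _ _ _ um hu; rewrite u1 mulr1.
  have : 0 <= int (fun t => p t * du t ^+ 2).
    have cdu := flux_continuous hpu.
    apply: intT_ge0 => //; first by continuity.
    by move=> t; rewrite mulr_ge0 ?sqr_ge0 // ltW.
  by lra.
pose l := inf S.
have psd : energy_above l.
  move=> u m um pu; have [cm pru _] := um; have cu := sl_continuous um.
  have [nz|/forallNP z] := pselect (exists t, u t != 0).
    rewrite -ler_pdivlMr; last exact: wdot_gt0.
    by apply: ge_inf; [exact: infS.2|exact: normalize].
  have u0E : u = fun=> 0 by apply/funext => t; apply/eqP/negPn/negP/z.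
  rewrite u0E; have -> : (fun t => m t * 0) = (fun=> 0).
    by apply/funext => t; rewrite mulr0.
  have -> : wdot (fun=> 0) (fun=> 0) = 0.
    by rewrite /wdot; under eq_fun do rewrite mulr0; rewrite intT0.
  by rewrite mulr0 intT0.
have step n : exists um : (R -> R) * (R -> R), [/\ sl_eq um.1 um.2, perp um.1,
    wdot um.1 um.1 = 1 & int (fun t => um.2 t * um.1 t) < l + n.+1%:R^-1].
  have e0 : 0 < n.+1%:R^-1 :> R by rewrite invr_gt0.
  have [q [u [m [um pu u1 ->]]] hq] := inf_adherent e0 infS.
  by exists (u, m).
have [um hum] := choice step.
pose u n := (um n).1; pose m n := (um n).2.
have hs n : sl_eq (u n) (m n) by have [] := hum n.
have hp n : perp (u n) by have [] := hum n.
have h1 n : wdot (u n) (u n) = 1 by have [] := hum n.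
have hq n : int (fun t => m n t * u n t) < l + n.+1%:R^-1 by have [] := hum n.
have hq1 n : int (fun t => m n t * u n t) <= l + 1.
  by rewrite (le_trans (ltW (hq n))) // lerD2l invf_le1 // ler1n.
have [M [K [K0 hb]]] := unit_energy_bounds (l + 1).
have bound n := (hb _ _ (hs n) (h1 n) (hq1 n)).1.
have modul n := (hb _ _ (hs n) (h1 n) (hq1 n)).2.
have pru n : periodic (u n) T by have [] := hs n.
have [|F [g [FF ooF cg pg ug]]] := equicontinuous_uniform_limit T_gt0 pru bound.
  move=> eps eps0; exists (Num.min T (eps ^+ 2 / K)).
    by rewrite lt_min T_gt0 divr_gt0 // exprn_gt0.
  have key n s t : s <= t -> `|s - t| < Num.min T (eps ^+ 2 / K) ->
      `|u n t - u n s| <= eps.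
    move=> st; rewrite distrC ger0_norm ?subr_ge0 // lt_min => /andP[d1 d2].
    have a0 : 0 < eps / K by rewrite divr_gt0.
    apply: le_trans (modul n (eps / K) a0 s t st _) _; first by lra.
    have -> : eps / K * K = eps by rewrite divfK // gt_eqF.
    have : (t - s) / (eps / K) <= eps.
      rewrite ler_pdivrMr //; apply: (le_trans (ltW d2)).
      by rewrite expr2 mulrA.
    by lra.
  move=> n s t; have /orP[st|ts] := le_total s t.
    by move=> h; rewrite distrC; exact: (key n s t st h).
  by rewrite distrC; exact: key.
have small_q (eps : R) : 0 < eps -> \forall n \near F,
     int (fun t => m n t * u n t) - l * wdot (u n) (u n) <= eps.
  move=> eps0; apply: ooF; near=> n.
  rewrite h1 mulr1 lerBlDl; apply: ltW; apply: lt_trans (hq n) _.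
  by rewrite ltrD2l; near: n; exact: near_infty_natSinv_lt (PosNum eps0).
have [geq gperp] := sl_minimizing_limit psd cg pg hs hp ug small_q.
exists l, g; split=> //.
  exact: psd.
apply/not_existsP => gz.
have g0 t : g t = 0 by apply/eqP/negPn/negP/gz.
(* If g vanished, some u n would be uniformly smaller than its norm allows. *)
have [Mw hw] := periodic_bounded T_gt0 cw pw.
have Mw0 : 0 <= Mw by rewrite (le_trans _ (hw 0)).
pose d := (Mw * T + 2)^-1.
have MT : 0 <= Mw * T by rewrite mulr_ge0 // ltW.
have d0 : 0 < d by rewrite invr_gt0; lra.
have [n hn] := filter_ex (ug _ d0).
have cu := sl_continuous (hs n).
have : `|wdot (u n) (u n)| <= Mw * d * d * T.
  apply: intT_abs_le => //; first by continuity.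
  move=> t; have := hn t; rewrite g0 subr0 => ht.
  by rewrite !normrM !ler_pM ?mulr_ge0.
rewrite h1 normr1; have -> : Mw * d * d * T = (Mw * T) * d * d by ring.
have : Mw * T * d < 1 by rewrite /d ltr_pdivrMr ?mul1r; lra.
have : d < 1 by rewrite invf_lt1; lra.
move=> hd1 hd2; rewrite leNgt => /negP; apply.
by rewrite mulr_ilt1 // ?mulr_ge0 // ltW.
Unshelve. all: by end_near. Qed.
End Family.

(** Uniqueness for the Cauchy problem: E = u^2 + (p u')^2 satisfies |E'| <= C E. *)
Lemma sl_unique (V : R -> R) u du t0 : continuous V -> periodic V T ->
  sl_eq u (fun t => V t * u t) -> has_deriv u du -> u t0 = 0 -> du t0 = 0 ->
  forall t, u t = 0.
Proof.
move=> cV pV [_ pu [du' hu' hpu]] hu u0 du0.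
have edu := has_deriv_unique hu' hu.
rewrite edu in hpu.
have cb : continuous (fun t => (p t)^-1 + r t - V t) by continuity.
have [|C hC] := periodic_bounded T_gt0 cb; first by move=> t; rewrite pp pr pV.
pose q t := p t * du t; rewrite -/q in hpu.
pose E t := u t ^+ 2 + q t ^+ 2.
pose dE t := 2 * (u t * q t) * ((p t)^-1 + r t - V t).
have hE : has_deriv E dE.
  by move=> t; rewrite /E /dE; derive_by; rewrite /= /q; field.
have Ebound t : `|dE t| <= C * E t.
  rewrite /dE normrM mulrC; apply: ler_pM => //.
  rewrite ler_norml /E; have := sqr_ge0 (u t + q t); have := sqr_ge0 (u t - q t).
  have -> : (u t + q t) ^+ 2 = u t ^+ 2 + q t ^+ 2 + 2 * (u t * q t) by ring.
  have -> : (u t - q t) ^+ 2 = u t ^+ 2 + q t ^+ 2 - 2 * (u t * q t) by ring.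
  by lra.
have E0 : E t0 = 0 by rewrite /E /q u0 du0 mulr0 expr2 mulr0 addr0.
have Eu t : E t <= 0 -> u t = 0.
  move=> h; apply/eqP; rewrite -sqrf_eq0 eq_le sqr_ge0 andbT (le_trans _ h) //.
  by rewrite /E lerDl sqr_ge0.
(* By Gronwall, E exp(-Ct) decreases and E exp(Ct) increases. *)
move=> t; apply: Eu; have /orP[tt|tt] := le_total t0 t.
  have H := @deriv_ge0_homo R (fun s => - (E s * expR (- C * s)))
    (fun s => (C * E s - dE s) * expR (- C * s)) t0 t tt.
  have : - (E t0 * expR (- C * t0)) <= - (E t * expR (- C * t)).
    apply: H => s _; first by derive_by; ring.
    rewrite mulr_ge0 ?expR_ge0 // subr_ge0.
    by rewrite (le_trans _ (Ebound s)) // ler_norm.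
  by rewrite E0 mul0r oppr0 oppr_ge0 pmulr_lle0 // expR_gt0.
have H := @deriv_ge0_homo R (fun s => E s * expR (C * s))
    (fun s => (C * E s + dE s) * expR (C * s)) t t0 tt.
have : E t * expR (C * t) <= E t0 * expR (C * t0).
  apply: H => s _; first by derive_by; ring.
  rewrite mulr_ge0 ?expR_ge0 // -[dE s]opprK subr_ge0.
  by rewrite (le_trans _ (Ebound s)) // -normrN ler_norm.
by rewrite E0 mul0r pmulr_lle0 // expR_gt0.
Qed.

(** An eigenfunction that changes sign is not a ground state. Otherwise |h|, with
   the same Rayleigh quotient, would be an eigenfunction too, and so would
   h + |h|; this function vanishes near b but not at a, against uniqueness for
   the Cauchy problem. As |h| need not be differentiable, it is approached by
   sqrt (h^2 + eps^2), whose excess energy is of order eps^2. *)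
Theorem sl_sign_change l h a b : sl_eq h (fun t => l * w t * h t) ->
  0 < h a -> h b < 0 ->
  exists l' g, [/\ l' < l, sl_eq g (fun t => l' * w t * g t) & exists t, g t != 0].
Proof.
move=> hl ha hb; have [cm ph [dh hh hph]] := hl.
have ch := has_deriv_continuous hh; have cdh := flux_continuous hph.
have cl : continuous (fun t => l * w t) by continuity.
(* The absolute minimum: orthogonality to the empty family. *)
pose e (_ : void) (_ : R) : R := 0.
have e_eig j : sl_eq (e j) (fun t => 0 * (w t * e j t)) by case: j.
have e_orth i j : i != j -> wdot (e i) (e j) = 0 by case: i.
have [||l0 [g [hl0 geq gp psd gnz]]] := sl_min_eigenfunction e_eig e_orth hl.
- by case.
- by exists a; rewrite gt_eqF.
have [ltl|lel] := ltrP l0 l; first by exists l0, g.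
exfalso.
have N0 : 0 < wdot h h by apply: wdot_gt0 => //; exists a; rewrite gt_eqF.
have e1 : int (fun t => l * w t * h t * h t) = l * wdot h h.
  by rewrite -intTZ //; [congr intT; apply/funext => t; ring|continuity].
have {lel hl0} el : l0 = l.
  by apply/eqP; rewrite eq_le lel andbT -(ler_pM2r N0) -e1.
rewrite el in psd geq.
pose eps (n : nat) : R := n.+1%:R^-1.
have eps0 n : 0 < eps n by rewrite invr_gt0.
pose s (n : nat) (t : R) := h t ^+ 2 + eps n ^+ 2.
have s0 n t : 0 < s n t by rewrite /s ltr_wpDl ?sqr_ge0 // exprn_gt0.
pose u n t := Num.sqrt (s n t).
have u0 n t : 0 < u n t by rewrite sqrtr_gt0.
have uu n t : u n t * u n t = s n t by rewrite -expr2 sqr_sqrtr // ltW.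
pose du n t := h t * dh t / u n t.
have hu n : has_deriv (u n) (du n).
  move=> t; rewrite /u /s /du; eapply is_derive_eq.
    apply: is_derive_sqrt; first exact: s0.
    by derivation.
  by rewrite -/(s n t) -/(u n t) /=; field; rewrite gt_eqF.
pose F t := r t * h t - l * w t * h t.
pose dF n t := F t * h t / u n t + p t * dh t ^+ 2 * eps n ^+ 2 / u n t ^+ 3.
have hpdu n : has_deriv (fun t => p t * du n t) (dF n).
  have -> : (fun t => p t * du n t) = (fun t => (p t * dh t) * (h t * (u n t)^-1)).
    by apply/funext => t; rewrite /du; ring.
  move=> t; have hun := hu n.
  pose q s := p s * dh s; have hq : has_deriv q F by [].
  rewrite -/q; eapply is_derive_eq.
    apply: is_derive_mul; first exact: (hq t).
    apply: is_derive_mul; first exact: (hh t).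
    by apply: is_derive_inv; [rewrite gt_eqF|exact: (hu n t)].
  have un0 : u n t != 0 by rewrite gt_eqF.
  have ee : eps n ^+ 2 = u n t * u n t - h t ^+ 2 by rewrite uu /s addrC addKr.
  by rewrite /dF /q /du ee; field.
have cu n := has_deriv_continuous (hu n).
have un0 n t : u n t != 0 by rewrite gt_eqF.
have cF : continuous F by rewrite /F; continuity.
pose m n t := r t * u n t - dF n t.
have cm' n : continuous (m n).
  have cun := cu n; have := un0 n => unn0.
  rewrite /m /dF; continuity => // t; first by rewrite expf_neq0.
have um n : sl_eq (u n) (m n).
  split=> //; first by move=> t; rewrite /u /s ph.
  exists (du n) => // t; apply: (is_derive_eq (hpdu n t)).
  by rewrite /m opprB addrC subrK.
have perpu n : perp e (u n) by case.
have close n t : `|u n t - `|h t| | <= eps n.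
  rewrite ger0_norm.
    rewrite lerBlDr -ler_sqr ?nnegrE ?addr_ge0 ?(ltW (u0 _ _)) ?(ltW (eps0 _)) //.
    rewrite expr2 uu /s sqrrD real_normK ?num_real // addrC lerD2r lerDl.
    by rewrite mulrn_wge0 // mulr_ge0 // ltW.
  rewrite subr_ge0 -ler_sqr ?nnegrE ?(ltW (u0 _ _)) //.
  by rewrite [leRHS]expr2 uu /s real_normK ?num_real // lerDl sqr_ge0.
have cabs : continuous (fun t => `|h t|).
  by move=> t; apply: continuous_comp; [exact: ch|exact: norm_continuous].
have pabs : periodic (fun t => `|h t|) T by move=> t; rewrite ph.
have [||abs_eq _] := sl_minimizing_limit e_eig e_orth (F := \oo) psd cabs pabs um perpu.
- move=> d d0; near=> n => t; apply: le_trans (close n t) _; apply: ltW.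
  by near: n; exact: near_infty_natSinv_lt (PosNum d0).
- move=> d d0; pose K := `|int (fun t => r t - l * w t)| + 1.
  have K0 : 0 < K by rewrite ltr_wpDl.
  have bound n : int (fun t => m n t * u n t) - l * wdot (u n) (u n) <= eps n * K.
    have cun := cu n; have cmn := cm' n.
    have -> : eps n * K = eps n * K + 0 by rewrite addr0.
    apply: (@le_trans _ _ (eps n ^+ 2 * int (fun t => r t - l * w t))).
      rewrite /wdot -!intTZ // -?intTB //; try by continuity.
      apply: intT_le => //; try by continuity.
      move=> t; have un0' := un0 n t.
      have -> : m n t * u n t - l * (w t * u n t * u n t) =
        eps n ^+ 2 * (r t - l * w t) - p t * dh t ^+ 2 * eps n ^+ 2 / u n t ^+ 2.
        have ee : eps n ^+ 2 = u n t * u n t - h t ^+ 2 by rewrite uu /s addrC addKr.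
        by rewrite /m /dF /F ee; field.
      (* The gradient term lowers the energy. *)
      rewrite gerBl divr_ge0 ?sqr_ge0 // mulr_ge0 ?sqr_ge0 //.
      by rewrite mulr_ge0 ?sqr_ge0 // ltW.
    have e1' : eps n <= 1 by rewrite invf_le1 // ler1n.
    rewrite addr0 expr2 -mulrA ler_wpM2l ?(ltW (eps0 n)) //.
    apply: le_trans (ler_norm _) _; rewrite normrM (gtr0_norm (eps0 n)).
    by rewrite /K (le_trans (ler_piMl _ _)) // lerDl.
  have dK : 0 < d / K by rewrite divr_gt0.
  near=> n; apply: le_trans (bound n) _; rewrite -ler_pdivlMr //; apply: ltW.
  by near: n; exact: near_infty_natSinv_lt (PosNum dK).
pose k t := 1 * h t + 1 * `|h t|.
have k_eq : sl_eq k (fun t => l * w t * k t).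
  have -> : (fun t => l * w t * k t) =
     (fun t => 1 * (l * w t * h t) + 1 * (l * w t * `|h t|)).
    by apply/funext => t; rewrite /k; ring.
  exact: (sl_lin 1 1 hl abs_eq).
have [_ _ [dk hk _]] := k_eq.
have k_near : \forall t \near b, 0 = k t.
  near=> t; have ht : h t < 0 by near: t; exact: (cvgr_lt _ (ch b) _ hb).
  by rewrite /k ltr0_norm //; ring.
have dkb : dk b = 0.
  have [_ <-] := near_eq_is_derive k_near (is_derive_const b (1 : R) 0).
  by have [_ <-] := hk b.
have plw : periodic (fun t => l * w t) T by move=> t; rewrite pw.
have := sl_unique cl plw k_eq hk (esym (nbhs_singleton k_near)) dkb a.
by rewrite /k gtr0_norm //; lra.
Unshelve. all: by end_near. Qed.
End SturmLiouville.

(** * Comparison of spectra *)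
Lemma left_kernel_vector (F : fieldType) (m n : nat) (A : 'M[F]_(m, n)) :
  (n < m)%N -> exists2 c : 'I_m -> F, exists i, c i != 0 &
    forall j, \sum_i c i * A i j = 0.
Proof.
move=> nm; have : kermx A != 0.
  by rewrite kermx_eq0 -row_leq_rank -ltnNge (leq_ltn_trans (rank_leq_col A)).
case/matrix0Pn => i [j kij]; exists (kermx A i); first by exists j.
move=> j'; have := mulmx_ker A => /matrixP/(_ i j').
by rewrite !mxE.
Qed.

Section Spectrum.
Variables (R : realType) (T : R) (p w r : R -> R).
Hypotheses (T_gt0 : 0 < T).
Hypotheses (cp : continuous p) (pp : periodic p T) (p_gt0 : forall t, 0 < p t).
Hypotheses (cw : continuous w) (pw : periodic w T) (w_gt0 : forall t, 0 < w t).
Hypotheses (cr : continuous r) (pr : periodic r T).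

Local Notation eigen r l h := (sl_eq T p r h (fun t => l * w t * h t)).
Local Notation wdot := (wdot T w).

Lemma sl_eigen_orth l1 l2 u v : eigen r l1 u -> eigen r l2 v -> l1 != l2 ->
  wdot u v = 0.
Proof.
move=> hu hv l12; have cu := sl_continuous hu; have cv := sl_continuous hv.
have := sl_sym T_gt0 cp pp p_gt0 cr hu hv.
have -> : (fun t => l1 * w t * u t * v t) = (fun t => l1 * (w t * u t * v t)).
  by apply/funext => t; ring.
have -> : (fun t => u t * (l2 * w t * v t)) = (fun t => l2 * (w t * u t * v t)).
  by apply/funext => t; ring.
rewrite !intTZ //; try by continuity.
move=> h; have /eqP : (l1 - l2) * wdot u v = 0 by rewrite mulrBl; apply/eqP; rewrite subr_eq0; apply/eqP.
by rewrite mulf_eq0 subr_eq0 (negbTE l12) => /eqP.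
Qed.

Lemma orthogonal_lin_indep (I : finType) (h : I -> R -> R) (c : I -> R) :
  (forall i, continuous (h i)) -> (forall i, periodic (h i) T) ->
  (forall i, exists t, h i t != 0) ->
  (forall i j, i != j -> wdot (h i) (h j) = 0) ->
  (forall t, \sum_i c i * h i t = 0) -> forall i, c i = 0.
Proof.
move=> ch ph nz orth sum0 i.
have : wdot (fun t => \sum_i c i * h i t) (h i) = 0.
  rewrite -[RHS](intT0 T_gt0); congr intT; apply/funext => t.
  by rewrite sum0 mulr0 mul0r.
rewrite wdot_sum // (bigD1 i) //= big1 ?addr0; last first.
  by move=> j ij; rewrite orth // mulr0.
move/eqP; rewrite mulf_eq0 => /orP[/eqP //|].
by rewrite gt_eqF // wdot_gt0.
Qed.

(** The min-max principle. Since n < m, a nonzero combination U of the u i is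
   orthogonal to all the e j. Its energy for r is at most 0, hence its energy for
   r' is negative, and so is the minimum of the Rayleigh quotient for r' on the
   orthogonal of the e j. *)
Lemma sl_eigen_compare (r' : R -> R) (m n : nat) (u : 'I_m -> R -> R)
    (lam : 'I_m -> R) (e : 'I_n -> R -> R) (mu : 'I_n -> R) :
  continuous r' -> periodic r' T -> (forall t, r' t < r t) -> (n < m)%N ->
  (forall i, eigen r (lam i) (u i)) -> (forall i, lam i <= 0) ->
  (forall i, exists t, u i t != 0) ->
  (forall i j, i != j -> wdot (u i) (u j) = 0) ->
  (forall j, eigen r' (mu j) (e j)) ->
  (forall i j, i != j -> wdot (e i) (e j) = 0) ->
  exists l g, [/\ l < 0, eigen r' l g, forall j, wdot g (e j) = 0 &
     exists t, g t != 0].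
Proof.
move=> cr' pr' r'r nm hu lam0 nzu orthu he orthe.
pose A : 'M[R]_(m, n) := \matrix_(i, j) wdot (u i) (e j).
have [c [i0 ci0] hc] := left_kernel_vector A nm.
have cu i : continuous (u i) by exact: sl_continuous (hu i).
have pu i : periodic (u i) T by have [] := hu i.
have ce j : continuous (e j) by exact: sl_continuous (he j).
pose U t := \sum_i c i * u i t.
pose M t := \sum_i c i * (lam i * w t * u i t).
have UM : sl_eq T p r U M by exact: sl_sum.
have cU := sl_continuous UM; have [cM pU [dU hU hpU]] := UM.
have UM' : sl_eq T p r' U (fun t => M t - (r t - r' t) * U t).
  split=> //; first by continuity.
  by exists dU => // t; apply: (is_derive_eq (hpU t)); ring.
have nzU : exists t, U t != 0.
  apply/not_existsP => z.
  have U0 t : U t = 0 by apply/eqP/negPn/negP/z.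
  by move: ci0; rewrite (orthogonal_lin_indep cu pu nzu orthu U0) eqxx.
have perpU : perp T w e U.
  move=> j; rewrite wdot_sum // -[RHS](hc j); apply: eq_bigr => i _.
  by rewrite mxE.
have he' j : sl_eq T p r' (e j) (fun t => mu j * (w t * e j t)).
  by under [X in sl_eq _ _ _ _ X]eq_fun do rewrite mulrA; exact: he.
have [l [g [hl geq gperp _ gnz]]] := sl_min_eigenfunction T_gt0 cp pp p_gt0 cw pw
  w_gt0 cr' pr' he' orthe UM' perpU nzU.
exists l, g; split=> //.
have NU : 0 < wdot U U by apply: wdot_gt0.
rewrite -(pmulr_llt0 _ NU); apply: le_lt_trans hl _.
have e1 : intT T (fun t => M t * U t) = \sum_i c i * (lam i * (c i * wdot (u i) (u i))).
  have -> : (fun t => M t * U t) = (fun t => w t * (\sum_i (c i * lam i) * u i t) * U t).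
    apply/funext => t; congr (_ * _); rewrite /M mulr_sumr; apply: eq_bigr => i _.
    by ring.
  rewrite -/(wdot _ U) wdot_sum //; apply: eq_bigr => i _; rewrite mulrA; congr (_ * _).
  rewrite wdotC wdot_sum // (bigD1 i) //= big1 ?addr0 // => j ji.
  by rewrite orthu // mulr0.
have -> : (fun t => (M t - (r t - r' t) * U t) * U t) =
   (fun t => M t * U t - (r t - r' t) * U t * U t) by apply/funext => t; ring.
rewrite intTB //; try by continuity.
have : intT T (fun t => M t * U t) <= 0.
  rewrite e1 -oppr_ge0 -sumrN; apply: sumr_ge0 => i _.
  have -> : - (c i * (lam i * (c i * wdot (u i) (u i)))) =
     (- lam i) * ((c i) ^+ 2 * wdot (u i) (u i)) by ring.
  by rewrite mulr_ge0 ?oppr_ge0 // mulr_ge0 ?sqr_ge0 // wdot_ge0.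
have : 0 < intT T (fun t => (r t - r' t) * U t * U t).
  apply: intT_gt0 => //; first by continuity.
  - by move=> t; rewrite pr pr' pU.
  - by move=> t; rewrite -mulrA mulr_ge0 ?subr_ge0 ?(ltW (r'r t)) // -expr2 sqr_ge0.
  - have [t Ut] := nzU; exists t; rewrite !mulf_neq0 // subr_eq0 gt_eqF //.
by lra.
Qed.
End Spectrum.

(** * Smooth functions of one variable *)
Section SmoothLine.
Variable R : realType.
Implicit Types f g h : R -> R.

(** The successive derivatives are existentially quantified, so that closure under
   the operations is proved without any formula for them. *)
Fixpoint diffn (m : nat) f : Prop :=
  if m is m'.+1 then exists2 f', has_deriv f f' & diffn m' f' else True.

Lemma diffnW m f : diffn m.+1 f -> diffn m f.
Proof. by elim: m f => [//|m IH] f [f' hf /IH h]; exists f'. Qed.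

Lemma has_deriv_derive1 f f' : has_deriv f f' -> f' = derive1 f.
Proof. by move=> h; apply/funext => t; rewrite derive1E; have [_ ->] := h t. Qed.

Lemma smooth_lineP f : smooth_line f <-> forall m, diffn m f.
Proof.
split.
  move=> sf m; have {sf} : forall i t, derivable (derive1n i f) t 1 by [].
  elim: m f => [//|m IH] f sf; exists (derive1 f).
    by move=> t; rewrite derive1E; apply: derivableP; exact: (sf 0).
  by apply: IH => i t; rewrite -derive1Sn; exact: (sf i.+1).
move=> df m t; have := df m.+1; elim: m f {df} => [|m IH] f [f' hf df'].
  by have [] := hf t.
by rewrite derive1Sn -(has_deriv_derive1 hf); exact: IH.
Qed.

Lemma diffn_const m (c : R) : diffn m (fun=> c).
Proof.
elim: m c => [//|m IH] c; exists (fun=> 0) => // t; exact: is_derive_const.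
Qed.

Lemma diffn_add m f g : diffn m f -> diffn m g -> diffn m (fun t => f t + g t).
Proof.
elim: m f g => [//|m IH] f g [f' hf df] [g' hg dg].
by exists (fun t => f' t + g' t); [move=> t; derivation|exact: IH].
Qed.

Lemma diffn_mul m f g : diffn m f -> diffn m g -> diffn m (fun t => f t * g t).
Proof.
elim: m f g => [//|m IH] f g hf0 hg0.
have := hf0; have := hg0; move=> [g' hg dg] [f' hf df].
exists (fun t => f t * g' t + g t * f' t); first by move=> t; derivation.
by apply: diffn_add; apply: IH => //; exact: diffnW.
Qed.

Lemma diffn_opp m f : diffn m f -> diffn m (fun t => - f t).
Proof.
move=> h; have -> : (fun t => - f t) = (fun t => -1 * f t).
  by apply/funext => t; rewrite mulN1r.
by apply: diffn_mul => //; exact: diffn_const.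
Qed.

Lemma diffn_inv m f : (forall t, f t != 0) -> diffn m f ->
  diffn m (fun t => (f t)^-1).
Proof.
move=> f0; elim: m => [//|m IH] hf0; have := hf0; move=> [f' hf df].
exists (fun t => - ((f t)^-1 * (f t)^-1) * f' t).
  by move=> t; have ft := f0 t; derive_by; field.
have := IH (diffnW hf0) => hi.
by apply: diffn_mul => //; apply: diffn_opp; exact: diffn_mul.
Qed.

Lemma diffn_exp m f n : diffn m f -> diffn m (fun t => f t ^+ n).
Proof.
move=> hf; elim: n => [|n IH].
  by under eq_fun do rewrite expr0; exact: diffn_const.
by under eq_fun do rewrite exprS; exact: diffn_mul.
Qed.

Lemma diffn_sqrt m f : (forall t, 0 < f t) -> diffn m f ->
  diffn m (fun t => Num.sqrt (f t)).
Proof.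
move=> f0; elim: m => [//|m IH] hf0; have := hf0; move=> [f' hf df].
exists (fun t => (2 * Num.sqrt (f t))^-1 * f' t).
  by move=> t; derivation; exact: f0.
apply: diffn_mul => //; apply: diffn_inv.
  by move=> t; rewrite mulf_neq0 // gt_eqF // sqrtr_gt0.
by apply: diffn_mul; [exact: diffn_const|exact: IH (diffnW hf0)].
Qed.

Lemma smooth_line_deriv f : smooth_line f -> has_deriv f (derive1 f).
Proof. by move=> sf t; rewrite derive1E; apply: derivableP; exact: (sf 0). Qed.

Lemma smooth_line_derive1 f : smooth_line f -> smooth_line (derive1 f).
Proof. by move=> sf m t; rewrite -derive1Sn; exact: (sf m.+1). Qed.

Lemma smooth_line_continuous f : smooth_line f -> continuous f.
Proof. by move=> /smooth_line_deriv/has_deriv_continuous. Qed.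

Lemma smooth_line_const c : smooth_line (fun=> c : R).
Proof. by apply/smooth_lineP => m; exact: diffn_const. Qed.

Lemma smooth_line_add f g : smooth_line f -> smooth_line g ->
  smooth_line (fun t => f t + g t).
Proof. by move=> /smooth_lineP hf /smooth_lineP hg; apply/smooth_lineP => m; exact: diffn_add. Qed.

Lemma smooth_line_opp f : smooth_line f -> smooth_line (fun t => - f t).
Proof. by move=> /smooth_lineP hf; apply/smooth_lineP => m; exact: diffn_opp. Qed.

Lemma smooth_line_mul f g : smooth_line f -> smooth_line g ->
  smooth_line (fun t => f t * g t).
Proof. by move=> /smooth_lineP hf /smooth_lineP hg; apply/smooth_lineP => m; exact: diffn_mul. Qed.

Lemma smooth_line_exp f n : smooth_line f -> smooth_line (fun t => f t ^+ n).
Proof. by move=> /smooth_lineP hf; apply/smooth_lineP => m; exact: diffn_exp. Qed.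

Lemma smooth_line_inv f : (forall t, f t != 0) -> smooth_line f ->
  smooth_line (fun t => (f t)^-1).
Proof. by move=> f0 /smooth_lineP hf; apply/smooth_lineP => m; exact: diffn_inv. Qed.

Lemma smooth_line_sqrt f : (forall t, 0 < f t) -> smooth_line f ->
  smooth_line (fun t => Num.sqrt (f t)).
Proof. by move=> f0 /smooth_lineP hf; apply/smooth_lineP => m; exact: diffn_sqrt. Qed.

(** Solutions of a Sturm-Liouville equation with smooth coefficients gain two
   derivatives at each use of the equation. *)
Lemma sl_smooth (T : R) p r V u : (forall t, 0 < p t) ->
  smooth_line p -> smooth_line r -> smooth_line V ->
  sl_eq T p r u (fun t => V t * u t) -> smooth_line u.
Proof.
move=> p0 /smooth_lineP sp /smooth_lineP sr /smooth_lineP sV [_ _ [du hu hpu]].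
have du_eq : du = fun t => (p t)^-1 * (p t * du t).
  by apply/funext => t; rewrite mulKf // gt_eqF.
suff H m : diffn m u /\ diffn m (fun t => p t * du t).
  by apply/smooth_lineP => m; have [] := H m.
elim: m => [//|m [Hu Hp]]; split.
  exists du => //; rewrite du_eq; apply: diffn_mul => //.
  by apply: diffn_inv => // t; rewrite gt_eqF.
exists (fun t => r t * u t - V t * u t) => //.
by apply: diffn_add; [|apply: diffn_opp]; exact: diffn_mul.
Qed.
End SmoothLine.

Ltac smoothness := repeat first
 [ match goal with
   | H : smooth_line ?f |- smooth_line ?f => exact: H
   end
 | lazymatch goal with
   | |- smooth_line (fun _ => ?c) => exact: smooth_line_const
   | |- smooth_line (fun x => @?f x + @?g x) => apply: (@smooth_line_add _ f g)
   | |- smooth_line (fun x => - @?f x) => apply: (@smooth_line_opp _ f)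
   | |- smooth_line (fun x => @?f x * @?g x) => apply: (@smooth_line_mul _ f g)
   | |- smooth_line (fun x => (@?f x)^-1) => apply: (@smooth_line_inv _ f)
   | |- smooth_line (fun x => @?f x ^+ ?n) => apply: (@smooth_line_exp _ f n)
   | |- smooth_line (fun x => Num.sqrt (@?f x)) => apply: (@smooth_line_sqrt _ f)
   | |- smooth_line (fun t => ?f t) => progress change (smooth_line f)
   end ].

(** * The frame of the profile curve *)
Section FrameAlgebra.
Variable R : realType.

(** A square matrix with orthonormal rows has orthonormal columns; the third row
   is the cross product of the first two. *)
Lemma frame_col_diag (g1 g2 g3 t1 t2 t3 : R) :
  g1 ^+ 2 + g2 ^+ 2 + g3 ^+ 2 = 1 -> t1 ^+ 2 + t2 ^+ 2 + t3 ^+ 2 = 1 ->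
  g1 * t1 + g2 * t2 + g3 * t3 = 0 ->
  g1 ^+ 2 + t1 ^+ 2 + (g2 * t3 - g3 * t2) ^+ 2 = 1.
Proof.
move=> gg tt gt.
have -> : (g2 * t3 - g3 * t2) ^+ 2 =
  (g2 ^+ 2 + g3 ^+ 2) * (t2 ^+ 2 + t3 ^+ 2) - (g2 * t2 + g3 * t3) ^+ 2 by ring.
have -> : g2 ^+ 2 + g3 ^+ 2 = 1 - g1 ^+ 2 by rewrite -gg; ring.
have -> : t2 ^+ 2 + t3 ^+ 2 = 1 - t1 ^+ 2 by rewrite -tt; ring.
have -> : g2 * t2 + g3 * t3 = - (g1 * t1) by apply/eqP; rewrite -addr_eq0 -gt; apply/eqP; ring.
by ring.
Qed.

Lemma frame_col_off (g1 g2 g3 t1 t2 t3 : R) :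
  g1 ^+ 2 + g2 ^+ 2 + g3 ^+ 2 = 1 -> t1 ^+ 2 + t2 ^+ 2 + t3 ^+ 2 = 1 ->
  g1 * t1 + g2 * t2 + g3 * t3 = 0 ->
  g1 * g2 + t1 * t2 + (g2 * t3 - g3 * t2) * (g3 * t1 - g1 * t3) = 0.
Proof.
move=> gg tt gt.
have e1 : g3 ^+ 2 = 1 - g1 ^+ 2 - g2 ^+ 2 by rewrite -gg; ring.
have e2 : t3 ^+ 2 = 1 - t1 ^+ 2 - t2 ^+ 2 by rewrite -tt; ring.
have e3 : g3 * t3 = - (g1 * t1 + g2 * t2) by apply/eqP; rewrite -addr_eq0 -gt; apply/eqP; ring.
have -> : (g2 * t3 - g3 * t2) * (g3 * t1 - g1 * t3) =
  (g3 * t3) * (g2 * t1 + g1 * t2) - g1 * g2 * t3 ^+ 2 - t1 * t2 * g3 ^+ 2 by ring.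
by rewrite e1 e2 e3; ring.
Qed.
End FrameAlgebra.

Lemma deriv_dot3 (R : realType) (a1 a2 a3 b1 b2 b3 a1' a2' a3' b1' b2' b3' : R -> R) c :
  has_deriv a1 a1' -> has_deriv a2 a2' -> has_deriv a3 a3' ->
  has_deriv b1 b1' -> has_deriv b2 b2' -> has_deriv b3 b3' ->
  (forall t, a1 t * b1 t + a2 t * b2 t + a3 t * b3 t = c) ->
  forall t, a1' t * b1 t + a2' t * b2 t + a3' t * b3 t +
    (a1 t * b1' t + a2 t * b2' t + a3 t * b3' t) = 0.
Proof.
move=> ha1 ha2 ha3 hb1 hb2 hb3 hc t.
have [_ <-] : is_derive t 1 (fun t => a1 t * b1 t + a2 t * b2 t + a3 t * b3 t) 0.
  by under eq_fun do rewrite hc; exact: is_derive_const.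
suff [_ ->] : is_derive t 1 (fun t => a1 t * b1 t + a2 t * b2 t + a3 t * b3 t)
  (a1' t * b1 t + a2' t * b2 t + a3' t * b3 t +
    (a1 t * b1' t + a2 t * b2' t + a3 t * b3' t)) by [].
by derive_by; ring.
Qed.

Lemma pairwise_nth2 (X : Type) (D : X -> X -> Prop) (x y : X) :
  (forall u v, D u v -> D v u) -> D x y ->
  forall i j : 'I_2, i != j -> D (nth x [:: x; y] i) (nth x [:: x; y] j).
Proof.
by move=> sD Dxy; case=> -[|[|//]] ? [] [|[|//]] ? //= _; exact: sD.
Qed.

Lemma pairwise_nth3 (X : Type) (D : X -> X -> Prop) (x y z : X) :
  (forall u v, D u v -> D v u) -> D x y -> D x z -> D y z ->
  forall i j : 'I_3, i != j -> D (nth x [:: x; y; z] i) (nth x [:: x; y; z] j).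
Proof.
move=> sD Dxy Dxz Dyz.
by case=> -[|[|[|//]]] ? [] [|[|[|//]]] ? //= _; exact: sD.
Qed.

Section Frame.
Variables (R : realType) (T : R) (k l : nat) (g1 g2 g3 : R -> R).
Hypothesis T_gt0 : 0 < T.
Hypotheses (sg1 : smooth_line g1) (sg2 : smooth_line g2) (sg3 : smooth_line g3).
Hypotheses (pg1 : periodic g1 T) (pg2 : periodic g2 T) (pg3 : periodic g3 T).
Hypotheses (g1_gt0 : forall t, 0 < g1 t) (g2_gt0 : forall t, 0 < g2 t).
Hypothesis g_unit : forall t, g1 t ^+ 2 + g2 t ^+ 2 + g3 t ^+ 2 = 1.

(** The curve lies on the unit sphere of dimension 2. With its unit tangent tan
   and the normal nor = g x tan within that sphere, it forms an orthonormal
   frame. *)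
Definition speed2 t := derive1 g1 t ^+ 2 + derive1 g2 t ^+ 2 + derive1 g3 t ^+ 2.
Definition speed t := Num.sqrt (speed2 t).
Definition tan1 t := derive1 g1 t / speed t.
Definition tan2 t := derive1 g2 t / speed t.
Definition tan3 t := derive1 g3 t / speed t.
Definition nor1 t := g2 t * tan3 t - g3 t * tan2 t.
Definition nor2 t := g3 t * tan1 t - g1 t * tan3 t.
Definition nor3 t := g1 t * tan2 t - g2 t * tan1 t.

(** Up to sign, the sum of the principal curvatures in the directions of the two
   spheres. Minimality makes the geodesic curvature of the curve equal to it. *)
Definition gcurv t := k%:R * nor1 t / g1 t + l%:R * nor2 t / g2 t.

Hypothesis speed2_gt0 : forall t, 0 < speed2 t.
Hypothesis minimality : forall t,
  nor1 t * derive1 tan1 t + nor2 t * derive1 tan2 t + nor3 t * derive1 tan3 t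
  = speed t * gcurv t.

Lemma speed_gt0 t : 0 < speed t. Proof. by rewrite sqrtr_gt0. Qed.
Lemma speed_neq0 t : speed t != 0. Proof. by rewrite gt_eqF // speed_gt0. Qed.
Let g1n0 t : g1 t != 0. Proof. by rewrite gt_eqF. Qed.
Let g2n0 t : g2 t != 0. Proof. by rewrite gt_eqF. Qed.
Hint Resolve speed_neq0 speed_gt0 g1n0 g2n0 : core.

Let sd1 := smooth_line_derive1 sg1.
Let sd2 := smooth_line_derive1 sg2.
Let sd3 := smooth_line_derive1 sg3.

Lemma smooth_speed2 : smooth_line speed2.
Proof. by rewrite /speed2; smoothness. Qed.
Lemma smooth_speed : smooth_line speed.
Proof. by rewrite /speed /speed2; smoothness. Qed.
Lemma smooth_tan1 : smooth_line tan1.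
Proof. by have := smooth_speed => ?; rewrite /tan1; smoothness. Qed.
Lemma smooth_tan2 : smooth_line tan2.
Proof. by have := smooth_speed => ?; rewrite /tan2; smoothness. Qed.
Lemma smooth_tan3 : smooth_line tan3.
Proof. by have := smooth_speed => ?; rewrite /tan3; smoothness. Qed.
Let st1 := smooth_tan1.
Let st2 := smooth_tan2.
Let st3 := smooth_tan3.
Lemma smooth_nor1 : smooth_line nor1. Proof. by rewrite /nor1; smoothness. Qed.
Lemma smooth_nor2 : smooth_line nor2. Proof. by rewrite /nor2; smoothness. Qed.
Lemma smooth_nor3 : smooth_line nor3. Proof. by rewrite /nor3; smoothness. Qed.
Let sn1 := smooth_nor1.
Let sn2 := smooth_nor2.
Let sn3 := smooth_nor3.
Lemma smooth_gcurv : smooth_line gcurv.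
Proof. by rewrite /gcurv; smoothness. Qed.

Lemma deriv_g1 : has_deriv g1 (fun t => speed t * tan1 t).
Proof.
by move=> t; apply: (is_derive_eq (smooth_line_deriv sg1 t)); rewrite /tan1 mulrC divfK.
Qed.
Lemma deriv_g2 : has_deriv g2 (fun t => speed t * tan2 t).
Proof.
by move=> t; apply: (is_derive_eq (smooth_line_deriv sg2 t)); rewrite /tan2 mulrC divfK.
Qed.
Lemma deriv_g3 : has_deriv g3 (fun t => speed t * tan3 t).
Proof.
by move=> t; apply: (is_derive_eq (smooth_line_deriv sg3 t)); rewrite /tan3 mulrC divfK.
Qed.

Lemma tan_unit t : tan1 t ^+ 2 + tan2 t ^+ 2 + tan3 t ^+ 2 = 1.
Proof.
have e : speed t ^+ 2 = speed2 t by rewrite sqr_sqrtr // ltW.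
rewrite /tan1 /tan2 /tan3 !expr_div_n e -!mulrDl -/(speed2 t).
by rewrite divff // gt_eqF // speed2_gt0.
Qed.

Lemma g_tan t : g1 t * tan1 t + g2 t * tan2 t + g3 t * tan3 t = 0.
Proof.
have gg x : g1 x * g1 x + g2 x * g2 x + g3 x * g3 x = 1 by rewrite -!expr2.
have := deriv_dot3 deriv_g1 deriv_g2 deriv_g3 deriv_g1 deriv_g2 deriv_g3 gg t.
move: (speed_neq0 t); set s := speed t => s0 e.
have /eqP : 2 * s * (g1 t * tan1 t + g2 t * tan2 t + g3 t * tan3 t) = 0.
  by rewrite -e; ring.
by rewrite mulf_eq0 mulf_eq0 pnatr_eq0 (negbTE s0) => /eqP.
Qed.

Lemma col11 t : g1 t ^+ 2 + tan1 t ^+ 2 + nor1 t ^+ 2 = 1.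
Proof. exact: frame_col_diag (g_unit t) (tan_unit t) (g_tan t). Qed.
Lemma col12 t : g1 t * g2 t + tan1 t * tan2 t + nor1 t * nor2 t = 0.
Proof. exact: frame_col_off (g_unit t) (tan_unit t) (g_tan t). Qed.

Let cyc (a b c : R) x : a + b + c = x -> b + c + a = x.
Proof. by move=> <-; ring. Qed.

Lemma col22 t : g2 t ^+ 2 + tan2 t ^+ 2 + nor2 t ^+ 2 = 1.
Proof.
exact: frame_col_diag (cyc (g_unit t)) (cyc (tan_unit t)) (cyc (g_tan t)).
Qed.
Lemma col23 t : g2 t * g3 t + tan2 t * tan3 t + nor2 t * nor3 t = 0.
Proof.
exact: frame_col_off (cyc (g_unit t)) (cyc (tan_unit t)) (cyc (g_tan t)).
Qed.
Lemma col33 t : g3 t ^+ 2 + tan3 t ^+ 2 + nor3 t ^+ 2 = 1.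
Proof.
exact: frame_col_diag (cyc (cyc (g_unit t))) (cyc (cyc (tan_unit t))) (cyc (cyc (g_tan t))).
Qed.
Lemma col31 t : g3 t * g1 t + tan3 t * tan1 t + nor3 t * nor1 t = 0.
Proof.
exact: frame_col_off (cyc (cyc (g_unit t))) (cyc (cyc (tan_unit t))) (cyc (cyc (g_tan t))).
Qed.

Let g_dtan t : g1 t * derive1 tan1 t + g2 t * derive1 tan2 t + g3 t * derive1 tan3 t = - speed t.
Proof.
have := deriv_dot3 deriv_g1 deriv_g2 deriv_g3 (smooth_line_deriv st1)
  (smooth_line_deriv st2) (smooth_line_deriv st3) g_tan t.
have := tan_unit t; set s := speed t; set a := tan1 t; set b := tan2 t; set c := tan3 t.
set x := _ + _ + g3 t * _ => e.
have -> : s * a * a + s * b * b + s * c * c = s * (a ^+ 2 + b ^+ 2 + c ^+ 2) by ring.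
by rewrite e mulr1 => /eqP; rewrite addrC addr_eq0 => /eqP.
Qed.

Let tan_dtan t : tan1 t * derive1 tan1 t + tan2 t * derive1 tan2 t + tan3 t * derive1 tan3 t = 0.
Proof.
have tt x : tan1 x * tan1 x + tan2 x * tan2 x + tan3 x * tan3 x = 1.
  by rewrite -!expr2 tan_unit.
have := deriv_dot3 (smooth_line_deriv st1) (smooth_line_deriv st2)
  (smooth_line_deriv st3) (smooth_line_deriv st1) (smooth_line_deriv st2)
  (smooth_line_deriv st3) tt t.
set a := tan1 t; set b := tan2 t; set c := tan3 t.
set a' := derive1 tan1 t; set b' := derive1 tan2 t; set c' := derive1 tan3 t.
move=> e; have /eqP : 2 * (a * a' + b * b' + c * c') = 0 by rewrite -e; ring.
by rewrite mulf_eq0 pnatr_eq0 => /eqP.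
Qed.

(* The expansion of the derivative of tan in the frame. *)
Let tan_expand t (gi ti ni e1 e2 e3 : R) :
  gi * g1 t + ti * tan1 t + ni * nor1 t = e1 ->
  gi * g2 t + ti * tan2 t + ni * nor2 t = e2 ->
  gi * g3 t + ti * tan3 t + ni * nor3 t = e3 ->
  derive1 tan1 t * e1 + derive1 tan2 t * e2 + derive1 tan3 t * e3 =
  speed t * (gcurv t * ni - gi).
Proof.
have := g_dtan t; have := tan_dtan t; have := minimality t.
move: (derive1 tan1 t) (derive1 tan2 t) (derive1 tan3 t) => a b c m1 m2 m3 <- <- <-.
transitivity (gi * (g1 t * a + g2 t * b + g3 t * c) +
  ti * (tan1 t * a + tan2 t * b + tan3 t * c) +
  ni * (nor1 t * a + nor2 t * b + nor3 t * c)); first by ring.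
by rewrite m1 m2 m3; ring.
Qed.

Let sq3 (x y z : R) c : x ^+ 2 + y ^+ 2 + z ^+ 2 = c -> x * x + y * y + z * z = c.
Proof. by rewrite !expr2. Qed.
Let swap3 (x x' y y' z z' : R) c : x * x' + y * y' + z * z' = c ->
  x' * x + y' * y + z' * z = c.
Proof. by move=> <-; ring. Qed.

Lemma deriv_tan1 : has_deriv tan1 (fun t => speed t * (gcurv t * nor1 t - g1 t)).
Proof.
move=> t; apply: (is_derive_eq (smooth_line_deriv st1 t)).
apply: etrans _ (tan_expand (sq3 (col11 t)) (col12 t) (swap3 (col31 t))).
by move: (derive1 tan1 t) (derive1 tan2 t) (derive1 tan3 t) => a b c; ring.
Qed.

Lemma deriv_tan2 : has_deriv tan2 (fun t => speed t * (gcurv t * nor2 t - g2 t)).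
Proof.
move=> t; apply: (is_derive_eq (smooth_line_deriv st2 t)).
apply: etrans _ (tan_expand (swap3 (col12 t)) (sq3 (col22 t)) (col23 t)).
by move: (derive1 tan1 t) (derive1 tan2 t) (derive1 tan3 t) => a b c; ring.
Qed.

Lemma deriv_tan3 : has_deriv tan3 (fun t => speed t * (gcurv t * nor3 t - g3 t)).
Proof.
move=> t; apply: (is_derive_eq (smooth_line_deriv st3 t)).
apply: etrans _ (tan_expand (col31 t) (swap3 (col23 t)) (sq3 (col33 t))).
by move: (derive1 tan1 t) (derive1 tan2 t) (derive1 tan3 t) => a b c; ring.
Qed.

Lemma deriv_nor1 : has_deriv nor1 (fun t => - (speed t * gcurv t * tan1 t)).
Proof.
have h2 := deriv_g2; have h3 := deriv_g3; have h5 := deriv_tan2; have h6 := deriv_tan3.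
move=> t; rewrite {1}/nor1; derive_by.
transitivity (speed t * gcurv t * (g1 t * (g1 t * tan1 t + g2 t * tan2 t + g3 t * tan3 t)
   - tan1 t * (g1 t ^+ 2 + g2 t ^+ 2 + g3 t ^+ 2))).
  by rewrite /nor2 /nor3; ring.
by rewrite g_tan g_unit; ring.
Qed.

Lemma deriv_nor2 : has_deriv nor2 (fun t => - (speed t * gcurv t * tan2 t)).
Proof.
have h1 := deriv_g1; have h3 := deriv_g3; have h4 := deriv_tan1; have h6 := deriv_tan3.
move=> t; rewrite {1}/nor2; derive_by.
transitivity (speed t * gcurv t * (g2 t * (g1 t * tan1 t + g2 t * tan2 t + g3 t * tan3 t)
   - tan2 t * (g1 t ^+ 2 + g2 t ^+ 2 + g3 t ^+ 2))).
  by rewrite /nor1 /nor3; ring.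
by rewrite g_tan g_unit; ring.
Qed.

Lemma deriv_nor3 : has_deriv nor3 (fun t => - (speed t * gcurv t * tan3 t)).
Proof.
have h1 := deriv_g1; have h2 := deriv_g2; have h4 := deriv_tan1; have h5 := deriv_tan2.
move=> t; rewrite {1}/nor3; derive_by.
transitivity (speed t * gcurv t * (g3 t * (g1 t * tan1 t + g2 t * tan2 t + g3 t * tan3 t)
   - tan3 t * (g1 t ^+ 2 + g2 t ^+ 2 + g3 t ^+ 2))).
  by rewrite /nor1 /nor2; ring.
by rewrite g_tan g_unit; ring.
Qed.

Lemma deriv_gcurv : has_deriv gcurv (fun t => speed t *
  (- k%:R * (gcurv t * tan1 t / g1 t + nor1 t * tan1 t / g1 t ^+ 2)
   - l%:R * (gcurv t * tan2 t / g2 t + nor2 t * tan2 t / g2 t ^+ 2))).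
Proof.
have h1 := deriv_g1; have h2 := deriv_g2; have h3 := deriv_nor1; have h4 := deriv_nor2.
move=> t; have a1 := g1n0 t; have a2 := g2n0 t.
by rewrite {1}/gcurv; derive_by; field; rewrite a1 a2.
Qed.

(** For a, b in {0, 1} these are the coefficients of the operator obtained by
   separating variables, on the products of h(t) with a coordinate of the first
   sphere if a = 1 and with a coordinate of the second sphere if b = 1. *)
Definition sl_vol t := g1 t ^+ k * g2 t ^+ l.
Definition sl_p t := sl_vol t / speed t.
Definition sl_w t := speed t * sl_vol t.
Definition norm2A t := k%:R * (nor1 t / g1 t) ^+ 2 + l%:R * (nor2 t / g2 t) ^+ 2 + gcurv t ^+ 2.
Definition sl_q (a b : R) t :=
  a * k%:R / g1 t ^+ 2 + b * l%:R / g2 t ^+ 2 - (k + l + 1)%:R - norm2A t.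
Definition sl_r (a b : R) t := sl_w t * sl_q a b t.

Lemma deriv_vol : has_deriv sl_vol (fun t => sl_vol t * speed t *
   (k%:R * tan1 t / g1 t + l%:R * tan2 t / g2 t)).
Proof.
have h1 := deriv_g1; have h2 := deriv_g2.
have pw (x : R) n : x != 0 -> n%:R * x ^+ n.-1 = n%:R * (x ^+ n / x).
  by move=> x0; case: n => [|n]; [rewrite !mul0r|rewrite exprSr mulfK].
move=> t; rewrite {1}/sl_vol; derive_by; rewrite !pw // /sl_vol.
have a1 := g1n0 t; have a2 := g2n0 t; field.
by rewrite a1 a2.
Qed.

(** The functions gi, ti, ni are the i-th components of g, tan, nor, and a, b the
   inner products of column i of the frame with its first two columns. *)
Section Eigen.
Variables (gi ti ni : R -> R) (a b : R).
Hypotheses (hti : has_deriv ti (fun t => speed t * (gcurv t * ni t - gi t))).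
Hypotheses (hni : has_deriv ni (fun t => - (speed t * gcurv t * ti t))).
Hypotheses (ca : forall t, g1 t * gi t + tan1 t * ti t + nor1 t * ni t = a).
Hypotheses (cb : forall t, g2 t * gi t + tan2 t * ti t + nor2 t * ni t = b).
Hypotheses (hgi : has_deriv gi (fun t => speed t * ti t)).
Hypotheses (pti : periodic ti T) (pni : periodic ni T).
Hypotheses (na : forall t, a * nor1 t = a * ni t) (nb : forall t, b * nor2 t = b * ni t).
Hypotheses (ta : forall t, a * tan1 t = a * ti t) (tb : forall t, b * tan2 t = b * ti t).

Lemma cont_sl_r a' b' : continuous (sl_r a' b').
Proof.
have := smooth_speed => ss; have := smooth_gcurv => sc; apply: smooth_line_continuous.
rewrite /sl_r /sl_w /sl_q /norm2A /sl_vol; smoothness => t //; by rewrite expf_neq0.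
Qed.

(** On a minimal hypersurface of the sphere the coordinates N of the unit normal
   satisfy Delta N = - |A|^2 N, hence J(N) = - n N. These coordinates are the
   products of nor1 and nor2 with the coordinates of the spheres, and nor3. *)
Lemma sl_eigen_nor : sl_eq T sl_p (sl_r a b) ni
  (fun t => - (k + l + 1)%:R * sl_w t * ni t).
Proof.
have cni := has_deriv_continuous hni; have cr := cont_sl_r.
have csp := smooth_line_continuous smooth_speed.
have cvol := has_deriv_continuous deriv_vol.
split=> //; first by rewrite /sl_w; continuity.
exists (fun t => - (speed t * gcurv t * ti t)) => //.
have -> : (fun t => sl_p t * - (speed t * gcurv t * ti t)) =
   (fun t => - (sl_vol t * gcurv t * ti t)).
  by apply/funext => t; rewrite /sl_p; field.
have h1 := deriv_vol; have h2 := deriv_gcurv => t; derive_by.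
have a1 := g1n0 t; have a2 := g2n0 t.
transitivity (sl_w t * (k%:R * nor1 t * (tan1 t * ti t) / g1 t ^+ 2 +
   l%:R * nor2 t * (tan2 t * ti t) / g2 t ^+ 2 + gcurv t * gi t - gcurv t ^+ 2 * ni t)).
  by rewrite /sl_w; field; rewrite a1 a2.
have -> : tan1 t * ti t = a - g1 t * gi t - nor1 t * ni t by rewrite -(ca t); ring.
have -> : tan2 t * ti t = b - g2 t * gi t - nor2 t * ni t by rewrite -(cb t); ring.
have -> : k%:R * nor1 t * (a - g1 t * gi t - nor1 t * ni t) =
  k%:R * ((a * nor1 t) - nor1 t * g1 t * gi t - nor1 t ^+ 2 * ni t) by ring.
have -> : l%:R * nor2 t * (b - g2 t * gi t - nor2 t * ni t) =
  l%:R * ((b * nor2 t) - nor2 t * g2 t * gi t - nor2 t ^+ 2 * ni t) by ring.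
have ec : gcurv t * gi t = (k%:R * nor1 t / g1 t + l%:R * nor2 t / g2 t) * gi t by [].
rewrite na nb ec /sl_r /sl_q /norm2A; set c := gcurv t; set s := sl_w t.
by field; rewrite a1 a2.
Qed.

(** Rotations preserve minimality, so that the normal component of a rotation
   field is in the kernel of J. For the plane of two coordinate axes taken in two
   different factors, it is up to sign the product of the coordinates on the
   spheres with the component of tan on the remaining factor. *)
Lemma sl_eigen_tan : sl_eq T sl_p (sl_r (1 - a) (1 - b)) ti
  (fun t => 0 * sl_w t * ti t).
Proof.
have cti := has_deriv_continuous hti; have cr := cont_sl_r.
have csp := smooth_line_continuous smooth_speed.
have cvol := has_deriv_continuous deriv_vol.
split=> //; first by rewrite /sl_w; continuity.
exists (fun t => speed t * (gcurv t * ni t - gi t)) => //.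
have -> : (fun t => sl_p t * (speed t * (gcurv t * ni t - gi t))) =
   (fun t => sl_vol t * (gcurv t * ni t - gi t)).
  by apply/funext => t; rewrite /sl_p; field.
have h1 := deriv_vol; have h2 := deriv_gcurv => t; derive_by.
have a1 := g1n0 t; have a2 := g2n0 t.
transitivity (sl_w t * (- (k%:R * tan1 t * (g1 t * gi t + nor1 t * ni t) / g1 t ^+ 2) -
   l%:R * tan2 t * (g2 t * gi t + nor2 t * ni t) / g2 t ^+ 2 - ti t - gcurv t ^+ 2 * ti t)).
  by rewrite /sl_w; field; rewrite a1 a2.
have -> : g1 t * gi t + nor1 t * ni t = a - tan1 t * ti t by rewrite -(ca t); ring.
have -> : g2 t * gi t + nor2 t * ni t = b - tan2 t * ti t by rewrite -(cb t); ring.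
have -> : k%:R * tan1 t * (a - tan1 t * ti t) =
  k%:R * ((a * tan1 t) - tan1 t ^+ 2 * ti t) by ring.
have -> : l%:R * tan2 t * (b - tan2 t * ti t) =
  l%:R * ((b * tan2 t) - tan2 t ^+ 2 * ti t) by ring.
have -> : tan1 t ^+ 2 = 1 - g1 t ^+ 2 - nor1 t ^+ 2 by rewrite -(col11 t); ring.
have -> : tan2 t ^+ 2 = 1 - g2 t ^+ 2 - nor2 t ^+ 2 by rewrite -(col22 t); ring.
rewrite ta tb /sl_r /sl_q /norm2A !natrD; set c := gcurv t; set s := sl_w t.
by field; rewrite a1 a2.
Qed.
End Eigen.

Lemma periodic_speed : periodic speed T.
Proof.
have p1 := periodic_deriv (smooth_line_deriv sg1) pg1.
have p2 := periodic_deriv (smooth_line_deriv sg2) pg2.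
have p3 := periodic_deriv (smooth_line_deriv sg3) pg3.
by move=> t; rewrite /speed /speed2 p1 p2 p3.
Qed.
Lemma periodic_tan1 : periodic tan1 T.
Proof.
by move=> t; rewrite /tan1 periodic_speed (periodic_deriv (smooth_line_deriv sg1) pg1).
Qed.
Lemma periodic_tan2 : periodic tan2 T.
Proof.
by move=> t; rewrite /tan2 periodic_speed (periodic_deriv (smooth_line_deriv sg2) pg2).
Qed.
Lemma periodic_tan3 : periodic tan3 T.
Proof.
by move=> t; rewrite /tan3 periodic_speed (periodic_deriv (smooth_line_deriv sg3) pg3).
Qed.
Lemma periodic_nor1 : periodic nor1 T.
Proof. by move=> t; rewrite /nor1 pg2 pg3 periodic_tan2 periodic_tan3. Qed.
Lemma periodic_nor2 : periodic nor2 T.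
Proof. by move=> t; rewrite /nor2 pg1 pg3 periodic_tan1 periodic_tan3. Qed.
Lemma periodic_nor3 : periodic nor3 T.
Proof. by move=> t; rewrite /nor3 pg1 pg2 periodic_tan2 periodic_tan1. Qed.

Local Notation eigen a b lam h :=
  (sl_eq T sl_p (sl_r a b) h (fun t => lam * sl_w t * h t)).
Local Notation dim := (k + l + 1)%:R.

Let zero_mul (x y : R -> R) t : 0 * x t = 0 * y t. Proof. by rewrite !mul0r. Qed.
Lemma eigen_nor1 : eigen 1 0 (- dim) nor1.
Proof.
exact: (sl_eigen_nor deriv_tan1 deriv_nor1 (fun t => sq3 (col11 t))
  (fun t => swap3 (col12 t)) periodic_nor1 (fun=> erefl) (zero_mul nor2 nor1)).
Qed.

Lemma eigen_nor2 : eigen 0 1 (- dim) nor2.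
Proof.
exact: (sl_eigen_nor deriv_tan2 deriv_nor2 col12 (fun t => sq3 (col22 t))
  periodic_nor2 (zero_mul nor1 nor2) (fun=> erefl)).
Qed.

Lemma eigen_nor3 : eigen 0 0 (- dim) nor3.
Proof.
exact: (sl_eigen_nor deriv_tan3 deriv_nor3 (fun t => swap3 (col31 t)) col23
  periodic_nor3 (zero_mul nor1 nor3) (zero_mul nor2 nor3)).
Qed.

Lemma eigen_tan2 : eigen 1 0 0 tan2.
Proof.
have := sl_eigen_tan deriv_tan2 deriv_nor2 col12 (fun t => sq3 (col22 t))
  deriv_g2 periodic_tan2 (zero_mul tan1 tan2) (fun=> erefl).
by rewrite subr0 subrr.
Qed.

Lemma eigen_tan3 : eigen 1 1 0 tan3.
Proof.
have := sl_eigen_tan deriv_tan3 deriv_nor3 (fun t => swap3 (col31 t)) col23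
  deriv_g3 periodic_tan3 (zero_mul tan1 tan3) (zero_mul tan2 tan3).
by rewrite subr0.
Qed.

Let critical F f : has_deriv F f -> periodic F T -> exists t, f t = 0.
Proof.
move=> hF pF; have [t _|||c _ [_ h]] := @Rolle R F 0 T T_gt0.
- by have [] := hF t.
- exact/continuous_subspaceT/has_deriv_continuous/hF.
- by rewrite -[T in RHS]add0r pF.
by exists c; have [_ <-] := hF c.
Qed.

Let prod0 (x y : R) : x != 0 -> x * y = 0 -> y = 0.
Proof. by move=> x0 /eqP; rewrite mulf_eq0 (negbTE x0) => /eqP. Qed.

Let not_all_zero t : ~ [/\ tan1 t = 0, tan2 t = 0 & tan3 t = 0].
Proof.
case=> a b c; have := tan_unit t; rewrite a b c expr0n /= !addr0 => /eqP.
by rewrite eq_sym oner_eq0.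
Qed.

Let crit1 : exists t, tan1 t = 0.
Proof.
have [t h] := critical deriv_g1 pg1; exists t.
by apply: (mulfI (speed_neq0 t)); rewrite mulr0.
Qed.
Let crit2 : exists t, tan2 t = 0.
Proof.
have [t h] := critical deriv_g2 pg2; exists t.
by apply: (mulfI (speed_neq0 t)); rewrite mulr0.
Qed.
Let crit3 : exists t, tan3 t = 0.
Proof.
have [t h] := critical deriv_g3 pg3; exists t.
by apply: (mulfI (speed_neq0 t)); rewrite mulr0.
Qed.

Lemma tan2_nz : exists t, tan2 t != 0.
Proof.
apply/not_existsP => z; have z2 t : tan2 t = 0 by apply/eqP/negPn/negP/z.
have [t t3] := crit3; apply: (@not_all_zero t); split=> //.
by have := g_tan t; rewrite z2 t3 !mulr0 !addr0; exact: prod0.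
Qed.

Lemma tan3_nz : exists t, tan3 t != 0.
Proof.
apply/not_existsP => z; have z3 t : tan3 t = 0 by apply/eqP/negPn/negP/z.
have [t t1] := crit1; apply: (@not_all_zero t); split=> //.
by have := g_tan t; rewrite z3 t1 !mulr0 addr0 add0r; exact: prod0.
Qed.

(* For two components x, y of g, the bracket is up to sign a component of nor. *)
Let slope (x y dx dy : R -> R) : has_deriv x (fun t => speed t * dx t) ->
  has_deriv y (fun t => speed t * dy t) -> (forall t, x t != 0) ->
  has_deriv (fun t => y t / x t) (fun t => speed t / x t ^+ 2 * (x t * dy t - y t * dx t)).
Proof. by move=> hx hy x0 t; have x0t := x0 t; derive_by; field. Qed.

Let slope_const (x y dx dy : R -> R) : has_deriv x (fun t => speed t * dx t) ->
  has_deriv y (fun t => speed t * dy t) -> (forall t, x t != 0) ->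
  (forall t, x t * dy t - y t * dx t = 0) ->
  exists c, forall t, y t = c * x t /\ dy t = c * dx t.
Proof.
move=> hx hy x0 z; have hs := slope hx hy x0.
have h0 : has_deriv (fun t => y t / x t) (fun=> 0).
  by apply: has_deriv_eq hs => t; rewrite z mulr0.
exists (y 0 / x 0) => t; have yc : y t = y 0 / x 0 * x t.
  by rewrite -(deriv0_const h0 t 0) divfK.
split=> //; apply: (mulfI (x0 t)); have /eqP := z t; rewrite subr_eq0 => /eqP ->.
by rewrite {1}yc; ring.
Qed.

(** Otherwise g3 / g2 is constant, and at a critical point of g2 the components
   tan2 and tan3 vanish; as tan is orthogonal to g and g1 > 0, so does tan1. *)
Lemma nor1_nz : exists t, nor1 t != 0.
Proof.
apply/not_existsP => z; have z1 t : nor1 t = 0 by apply/eqP/negPn/negP/z.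
have [c hc] := slope_const deriv_g2 deriv_g3 g2n0 z1.
have [t t2] := crit2; apply: (@not_all_zero t).
have t3 : tan3 t = 0 by rewrite (hc t).2 t2 mulr0.
by split=> //; have := g_tan t; rewrite t2 t3 !mulr0 !addr0; exact: prod0.
Qed.

Lemma nor2_nz : exists t, nor2 t != 0.
Proof.
apply/not_existsP => z; have z2 t : nor2 t = 0 by apply/eqP/negPn/negP/z.
have z2' t : g1 t * tan3 t - g3 t * tan1 t = 0 by rewrite -oppr0 -(z2 t) opprB.
have [c hc] := slope_const deriv_g1 deriv_g3 g1n0 z2'.
have [t t1] := crit1; apply: (@not_all_zero t).
have t3 : tan3 t = 0 by rewrite (hc t).2 t1 mulr0.
by split=> //; have := g_tan t; rewrite t1 t3 !mulr0 addr0 add0r; exact: prod0.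
Qed.

Lemma nor3_nz : exists t, nor3 t != 0.
Proof.
apply/not_existsP => z; have z3 t : nor3 t = 0 by apply/eqP/negPn/negP/z.
have [c hc] := slope_const deriv_g1 deriv_g2 g1n0 z3.
have [t t3] := crit3; apply: (@not_all_zero t).
have := g_tan t; rewrite t3 mulr0 addr0 (hc t).1 (hc t).2.
have -> : g1 t * tan1 t + c * g1 t * (c * tan1 t) = g1 t * (1 + c ^+ 2) * tan1 t by ring.
move/prod0 => -> //; first by rewrite mulr0.
by rewrite mulf_neq0 // gt_eqF // ltr_pwDl // sqr_ge0.
Qed.

(* The function h is, up to the positive factor rho, the derivative of a periodic
   function, so that it has mean zero for the weight rho. *)
Let mean_zero_signs F (rho h : R -> R) : has_deriv F (fun t => rho t * h t) ->
  periodic F T -> (forall t, 0 < rho t) -> continuous rho -> continuous h ->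
  (exists t, h t != 0) -> (exists a, 0 < h a) /\ (exists b, h b < 0).
Proof.
move=> hF pF rho0 crho ch [t0 ht0].
have cf : continuous (fun t => rho t * h t) by continuity.
have pf := periodic_deriv hF pF.
have int0 := intT_deriv_periodic T_gt0 cf hF pF.
have nz : rho t0 * h t0 != 0 by rewrite mulf_neq0 // gt_eqF.
split; apply/not_existsP => hn; move: nz; apply/negP; rewrite negbK.
  have f0 t : 0 <= - (rho t * h t).
    by rewrite -mulrN mulr_ge0 ?(ltW (rho0 t)) // oppr_ge0 leNgt; apply/negP/hn.
  have e := @intT_eq0 R T T_gt0 (fun t => - (rho t * h t)) _ _ f0 _ t0.
  rewrite -oppr_eq0 e //; first by continuity.
    by move=> t; rewrite (pf t).
  by rewrite intTN // int0 oppr0.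
have f0 t : 0 <= rho t * h t.
  by rewrite mulr_ge0 ?(ltW (rho0 t)) // leNgt; apply/negP/hn.
by rewrite (intT_eq0 T_gt0 cf pf f0 int0).
Qed.

Let rho_pos (x : R -> R) t : (forall t, x t != 0) -> 0 < speed t / x t ^+ 2.
Proof. by move=> x0; rewrite divr_gt0 ?speed_gt0 // exprn_even_gt0 // x0. Qed.

Let rho_cont (x : R -> R) : continuous x -> (forall t, x t != 0) ->
  continuous (fun t => speed t / x t ^+ 2).
Proof.
move=> cx x0; have csp := smooth_line_continuous smooth_speed; continuity => t.
by rewrite expf_neq0.
Qed.

Lemma nor1_signs : (exists a, 0 < nor1 a) /\ (exists b, nor1 b < 0).
Proof.
apply: (mean_zero_signs (slope deriv_g2 deriv_g3 g2n0)).
- by move=> t; rewrite pg2 pg3.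
- by move=> t; exact: rho_pos.
- by apply: rho_cont => //; exact: has_deriv_continuous deriv_g2.
- exact: smooth_line_continuous sn1.
- exact: nor1_nz.
Qed.

Lemma nor2_signs : (exists a, 0 < nor2 a) /\ (exists b, nor2 b < 0).
Proof.
have e t : g1 t * tan3 t - g3 t * tan1 t = - nor2 t by rewrite /nor2 opprB.
have [|||||[a ha] [b hb]] := mean_zero_signs (slope deriv_g1 deriv_g3 g1n0).
- by move=> t; rewrite pg1 pg3.
- by move=> t; exact: rho_pos.
- by apply: rho_cont => //; exact: has_deriv_continuous deriv_g1.
- by under eq_fun do rewrite e; apply: continuous_opp; exact: smooth_line_continuous sn2.
- by have [t ht] := nor2_nz; exists t; rewrite e oppr_eq0.
by split; [exists b; rewrite -oppr_lt0 -e|exists a; rewrite -oppr_gt0 -e].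
Qed.

Lemma nor3_signs : (exists a, 0 < nor3 a) /\ (exists b, nor3 b < 0).
Proof.
apply: (mean_zero_signs (slope deriv_g1 deriv_g2 g1n0)).
- by move=> t; rewrite pg1 pg2.
- by move=> t; exact: rho_pos.
- by apply: rho_cont => //; exact: has_deriv_continuous deriv_g1.
- exact: smooth_line_continuous sn3.
- exact: nor3_nz.
Qed.

Lemma tan3_signs : (exists a, 0 < tan3 a) /\ (exists b, tan3 b < 0).
Proof.
apply: (mean_zero_signs deriv_g3 pg3) => //.
- exact: smooth_line_continuous smooth_speed.
- exact: smooth_line_continuous st3.
- exact: tan3_nz.
Qed.

Let cp : continuous sl_p.
Proof.
have csp := smooth_line_continuous smooth_speed.
by have cvol := has_deriv_continuous deriv_vol; rewrite /sl_p; continuity.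
Qed.
Let pvol : periodic sl_vol T. Proof. by move=> t; rewrite /sl_vol pg1 pg2. Qed.
Let pp : periodic sl_p T. Proof. by move=> t; rewrite /sl_p pvol periodic_speed. Qed.
Let vol_gt0 t : 0 < sl_vol t. Proof. by rewrite mulr_gt0 ?exprn_gt0. Qed.
Let p_gt0 t : 0 < sl_p t. Proof. by rewrite divr_gt0. Qed.
Let cw : continuous sl_w.
Proof.
have csp := smooth_line_continuous smooth_speed.
by have cvol := has_deriv_continuous deriv_vol; rewrite /sl_w; continuity.
Qed.
Let pw : periodic sl_w T. Proof. by move=> t; rewrite /sl_w pvol periodic_speed. Qed.
Lemma sl_w_gt0 t : 0 < sl_w t. Proof. by rewrite mulr_gt0. Qed.
Let pr a b : periodic (sl_r a b) T.
Proof.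
move=> t; rewrite /sl_r /sl_q /norm2A /gcurv pw pg1 pg2.
by rewrite periodic_nor1 periodic_nor2.
Qed.
Let sw : smooth_line sl_w.
Proof. by have := smooth_speed => ?; rewrite /sl_w /sl_vol; smoothness. Qed.
Let sp : smooth_line sl_p.
Proof. by have := smooth_speed => ?; rewrite /sl_p /sl_vol; smoothness. Qed.
Let sr a b : smooth_line (sl_r a b).
Proof.
have := smooth_speed => ss; have := smooth_gcurv => sc.
rewrite /sl_r /sl_q /norm2A; smoothness => t //; by rewrite expf_neq0.
Qed.

Definition negative_modes (a b : R) (d : nat) := exists (h : 'I_d -> R -> R) lam,
  [/\ forall i, eigen a b (lam i) (h i), forall i, lam i < 0,
      forall i, smooth_line (h i) &
      forall c, (forall t, \sum_i c i * h i t = 0) -> forall i, c i = 0].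

Let orthogonal_modes a b d (h : 'I_d -> R -> R) lam :
  (forall i, eigen a b (lam i) (h i)) -> (forall i, lam i < 0) ->
  (forall i, exists t, h i t != 0) ->
  (forall i j, i != j -> wdot T sl_w (h i) (h j) = 0) -> negative_modes a b d.
Proof.
move=> he lam0 nz orth; exists h, lam; split; [exact: he|exact: lam0|move=> i|move=> c].
  have sV : smooth_line (fun t => lam i * sl_w t) by smoothness.
  exact: (sl_smooth p_gt0 sp (@sr a b) sV (he i)).
have ch i : continuous (h i) := sl_continuous (he i).
have ph i : periodic (h i) T by have [] := he i.
exact: (orthogonal_lin_indep T_gt0 cw pw sl_w_gt0 ch ph nz orth).
Qed.

Let smaller a b lam h : eigen a b lam h -> (exists t, 0 < h t) /\ (exists t, h t < 0) ->
  exists l g, [/\ l < lam, eigen a b l g & exists t, g t != 0].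
Proof.
move=> hl [[x hx] [y hy]].
exact: (sl_sign_change T_gt0 cp pp p_gt0 cw pw sl_w_gt0 (@cont_sl_r a b) (@pr a b) hl hx hy).
Qed.

Let orth a b l1 l2 u v : eigen a b l1 u -> eigen a b l2 v -> l1 != l2 ->
  wdot T sl_w u v = 0.
Proof. exact: (sl_eigen_orth T_gt0 cp pp p_gt0 cw (@cont_sl_r a b)). Qed.

Let ltr_neq (x y : R) : x < y -> x != y. Proof. by move=> xy; rewrite lt_eqF. Qed.

Let orthC u v : wdot T sl_w u v = 0 -> wdot T sl_w v u = 0.
Proof. by rewrite wdotC. Qed.

Let dim_lt0 : - dim < 0 :> R. Proof. by rewrite oppr_lt0 ltr0n addn1. Qed.

(** An eigenfunction that changes sign has a smaller eigenvalue below its own.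
   This gives one negative eigenvalue below the eigenvalue 0 of tan3, and in the
   next two lemmas one below the eigenvalue - n of nor1, of nor2. *)
Lemma negative_modes11 : negative_modes 1 1 1.
Proof.
have [mu [g [mu_lt geq gnz]]] := smaller eigen_tan3 tan3_signs.
apply: (@orthogonal_modes _ _ _ (fun=> g) (fun=> mu)) => // i j.
by rewrite !ord1 eqxx.
Qed.

Let two_modes a b l1 l2 u v : eigen a b l1 u -> eigen a b l2 v ->
  l1 < l2 -> l2 < 0 -> (exists t, u t != 0) -> (exists t, v t != 0) ->
  negative_modes a b 2.
Proof.
move=> hu hv l12 l20 nu nv; have ouv := orth hu hv (ltr_neq l12).
apply: (@orthogonal_modes _ _ _ (fun i => nth u [:: u; v] i) (fun i => nth l1 [:: l1; l2] i)).
- by case=> -[|[|//]].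
- by case=> -[|[|//]] //= _; exact: lt_trans l12 l20.
- by case=> -[|[|//]].
- exact: (pairwise_nth2 orthC ouv).
Qed.

Lemma negative_modes10 : negative_modes 1 0 2.
Proof.
have [mu [g [mu_lt geq gnz]]] := smaller eigen_nor1 nor1_signs.
exact: (two_modes geq eigen_nor1 mu_lt dim_lt0 gnz nor1_nz).
Qed.

Lemma negative_modes01 : negative_modes 0 1 2.
Proof.
have [mu [g [mu_lt geq gnz]]] := smaller eigen_nor2 nor2_signs.
exact: (two_modes geq eigen_nor2 mu_lt dim_lt0 gnz nor2_nz).
Qed.

(** The first two eigenvalues come from nor3 as before. For the third, the operator
   with a = 1, b = 0 has three nonpositive eigenvalues: those of tan2 and of nor1,
   and a smaller one. It exceeds the operator with a = b = 0 by the positive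
   term k / g1^2, which by comparison has three negative eigenvalues. *)
Lemma negative_modes00 : (0 < k)%N -> negative_modes 0 0 3.
Proof.
move=> k0.
have [l1 [v [l1d veq vnz]]] := smaller eigen_nor3 nor3_signs.
have [l2 [u [l2d ueq unz]]] := smaller eigen_nor1 nor1_signs.
have ovn := orth veq eigen_nor3 (ltr_neq l1d).
have oun := orth ueq eigen_nor1 (ltr_neq l2d).
have l20 := lt_trans l2d dim_lt0.
have out := orth ueq eigen_tan2 (ltr_neq l20).
have ont := orth eigen_nor1 eigen_tan2 (ltr_neq dim_lt0).
have [|||||||| l3 [g [l30 geq gperp gnz]]] := @sl_eigen_compare R T sl_p sl_w (sl_r 1 0)
  T_gt0 cp pp p_gt0 cw pw sl_w_gt0 (@cont_sl_r 1 0) (@pr 1 0) (sl_r 0 0) 3 2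
  (fun i => nth u [:: u; nor1; tan2] i) (fun i => nth 0 [:: l2; - dim; 0] i)
  (fun i => nth v [:: v; nor3] i) (fun i => nth 0 [:: l1; - dim] i)
  (@cont_sl_r 0 0) (@pr 0 0).
- move=> t; rewrite ltr_pM2l ?sl_w_gt0 // /sl_q !mul0r mul1r addr0.
  rewrite !ltrD2r ltrDr; first by rewrite divr_gt0 ?ltr0n // exprn_gt0.
- by [].
- by case=> -[|[|[|//]]] /= _; [exact: ueq|exact: eigen_nor1|exact: eigen_tan2].
- by case=> -[|[|[|//]]] //= _; exact: ltW.
- by case=> -[|[|[|//]]] //= _; [exact: nor1_nz|exact: tan2_nz].
- exact: (pairwise_nth3 orthC oun out ont).
- by case=> -[|[|//]] /= _; [exact: veq|exact: eigen_nor3].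
- exact: (pairwise_nth2 orthC ovn).
have ogv : wdot T sl_w g v = 0 by exact: (gperp ord0).
have ogn : wdot T sl_w g nor3 = 0 by exact: (gperp (lift ord0 ord0)).
apply: (@orthogonal_modes _ _ _ (fun i => nth g [:: g; v; nor3] i)
  (fun i => nth 0 [:: l3; l1; - dim] i)).
- by case=> -[|[|[|//]]] /= _; [exact: geq|exact: veq|exact: eigen_nor3].
- by case=> -[|[|[|//]]] //= _; exact: lt_trans l1d _.
- by case=> -[|[|[|//]]] //= _; exact: nor3_nz.
- exact: (pairwise_nth3 orthC ogv ogn ovn).
Qed.

End Frame.

(** * Partial derivatives *)
Section PartialDerivatives.
Variable R : realType.

(** Functions on the chart depend on blocks of coordinates through an affine map P,
   along which directional derivatives transform without differentiability. *)
Lemma is_derive_comp_affine (V W : normedModType R) (P : V -> W) (F : W -> R)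
    (x v : V) (pv : W) (d : R) :
  (forall h : R, P (h *: v + x) = h *: pv + P x) ->
  is_derive (P x) pv F d -> is_derive x v (fun z => F (P z)) d.
Proof.
move=> hP []; rewrite /derivable /derive.
have -> : (fun h : R => h^-1 *: ((F \o shift (P x)) (h *: pv) - F (P x))) =
    (fun h : R => h^-1 *: (((fun z => F (P z)) \o shift x) (h *: v) - F (P x))).
  by apply/funext => h /=; rewrite hP.
by move=> d1 d2; apply: DeriveDef.
Qed.

Lemma is_derive_zero_dir (V : normedModType R) (F : V -> R) (x : V) :
  is_derive x 0 F 0.
Proof. exact: is_derive0. Qed.

Definition has_pd (n : nat) (i : 'I_n) (h h' : 'rV[R]_n -> R) :=
  forall x, is_derive x (delta_mx 0 i) h (h' x).

Lemma has_pdE n (i : 'I_n) h h' : has_pd i h h' -> pd i h = h'.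
Proof. by move=> hd; apply/funext => x; have [] := hd x. Qed.

Lemma Cdiff_cont n m (h : 'rV[R]_n -> R) : Cdiff m h -> continuous h.
Proof. by case: m => [|m] []. Qed.

Lemma CdiffS n m (h : 'rV[R]_n -> R) : continuous h ->
  (forall i, exists2 h', has_pd i h h' & Cdiff m h') -> Cdiff m.+1 h.
Proof.
move=> ch hp; split=> // i; have [h' hd dh'] := hp i; split.
  by move=> x; have [] := hd x.
by rewrite (_ : (fun x => 'D_(delta_mx 0 i) h x) = h') //; exact: has_pdE.
Qed.

Lemma CdiffSP n m (h : 'rV[R]_n -> R) : Cdiff m.+1 h ->
  forall i, has_pd i h (pd i h) /\ Cdiff m (pd i h).
Proof. by move=> [_ hp] i; have [d c] := hp i; split=> // x; exact: derivableP. Qed.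

Lemma CdiffW n m (h : 'rV[R]_n -> R) : Cdiff m.+1 h -> Cdiff m h.
Proof.
elim: m h => [|m IH] h hd; first by split=> //; exact: Cdiff_cont hd.
apply: CdiffS (Cdiff_cont hd) _ => i; have [h1 h2] := CdiffSP hd i.
by exists (pd i h) => //; exact: IH.
Qed.

Lemma Cdiff_const n m (c : R) : Cdiff m (fun _ : 'rV[R]_n => c).
Proof.
elim: m c => [|m IH] c; first by split=> //; exact: continuous_const.
apply: CdiffS => [|i]; first exact: continuous_const.
by exists (fun=> 0) => // x; exact: is_derive_const.
Qed.

Lemma Cdiff_add n m (f g : 'rV[R]_n -> R) : Cdiff m f -> Cdiff m g ->
  Cdiff m (fun x => f x + g x).
Proof.
elim: m f g => [|m IH] f g hf hg.
  by split=> //; apply: continuous_add; [exact: Cdiff_cont hf|exact: Cdiff_cont hg].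
apply: CdiffS => [|i].
  by apply: continuous_add; [exact: Cdiff_cont hf|exact: Cdiff_cont hg].
have [f1 f2] := CdiffSP hf i; have [g1 g2] := CdiffSP hg i.
exists (fun x => pd i f x + pd i g x); last exact: IH.
by move=> x; apply: is_derive_add; [exact: f1|exact: g1].
Qed.

Lemma Cdiff_mul n m (f g : 'rV[R]_n -> R) : Cdiff m f -> Cdiff m g ->
  Cdiff m (fun x => f x * g x).
Proof.
elim: m f g => [|m IH] f g hf hg.
  by split=> //; apply: continuous_mul; [exact: Cdiff_cont hf|exact: Cdiff_cont hg].
apply: CdiffS => [|i].
  by apply: continuous_mul; [exact: Cdiff_cont hf|exact: Cdiff_cont hg].
have [f1 f2] := CdiffSP hf i; have [g1 g2] := CdiffSP hg i.
exists (fun x => f x * pd i g x + g x * pd i f x).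
  by move=> x; apply: is_derive_mul; [exact: f1|exact: g1].
by apply: Cdiff_add; apply: IH => //; exact: CdiffW.
Qed.

Lemma Cdiff_inv n m (f : 'rV[R]_n -> R) : (forall x, f x != 0) -> Cdiff m f ->
  Cdiff m (fun x => (f x)^-1).
Proof.
move=> f0; elim: m => [|m IH] hf.
  by split=> //; apply: continuous_inv => //; exact: Cdiff_cont hf.
apply: CdiffS => [|i]; first by apply: continuous_inv => //; exact: Cdiff_cont hf.
have [f1 f2] := CdiffSP hf i; have hi := IH (CdiffW hf).
exists (fun x => (-1 * ((f x)^-1 * (f x)^-1)) * pd i f x).
  move=> x; apply: (is_derive_eq (is_derive_inv (f0 x) (f1 x))).
  by have := f0 x => fx0; field.
by apply: Cdiff_mul => //; apply: Cdiff_mul; [exact: Cdiff_const|exact: Cdiff_mul].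
Qed.

Lemma Cdiff_sum n m (I : finType) (f : I -> 'rV[R]_n -> R) :
  (forall i, Cdiff m (f i)) -> Cdiff m (fun x => \sum_i f i x).
Proof.
move=> hf; elim: (index_enum I) => [|i s IH].
  by under eq_fun do rewrite big_nil; exact: Cdiff_const.
by under eq_fun do rewrite big_cons; exact: Cdiff_add.
Qed.

Lemma has_pd_coord n (i j : 'I_n) : has_pd i (fun x => x 0 j) (fun=> (i == j)%:R).
Proof.
move=> x.
have hP (h : R) : (h *: delta_mx 0 i + x) 0 j = h *: ((i == j)%:R : R) + x 0 j.
  by rewrite !mxE eqxx eq_sym.
exact: (is_derive_comp_affine (P := fun z : 'rV[R]_n => z 0 j) hP (is_derive_id _ _)).
Qed.

Lemma Cdiff_coord n m (j : 'I_n) : Cdiff m (fun x : 'rV[R]_n => x 0 j).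
Proof.
have cc : continuous (fun x : 'rV[R]_n => x 0 j) by exact: coord_continuous.
case: m => [|m]; first by split.
apply: CdiffS => // i; exists (fun=> (i == j)%:R); last exact: Cdiff_const.
exact: has_pd_coord.
Qed.
End PartialDerivatives.

(** * Hypersurfaces in orthogonal coordinates *)
Section DiagonalMetric.
Variables (R : realType) (n p : nat) (X : 'rV[R]_n -> 'rV[R]_p).
Variable G : 'I_n -> 'rV[R]_n -> R.
Hypothesis G_neq0 : forall i x, G i x != 0.
Hypothesis metricE : forall x i j, metric X x i j = (G i x) *+ (i == j).

Let diagG x : 'rV[R]_n := \row_i G i x.

Lemma metric_diag x : metric X x = diag_mx (diagG x).
Proof. by apply/matrixP => i j; rewrite metricE !mxE; case: eqP => [->|]. Qed.

Lemma invmx_metric x : invmx (metric X x) = diag_mx (\row_i (G i x)^-1).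
Proof.
set D := diag_mx _.
have e : metric X x *m D = 1%:M.
  rewrite metric_diag mulmx_diag; apply/matrixP => i j; rewrite !mxE.
  by case: eqP => [->|//]; rewrite !mulr1n divff.
have [u _] := mulmx1_unit e.
by rewrite -[D](mulKmx u) e mulmx1.
Qed.

Lemma pd_metric x (i j q : 'I_n) :
  pd i (fun z => metric X z j q) x = pd i (G j) x *+ (j == q).
Proof.
have -> : (fun z => metric X z j q) = fun z => G j z *+ (j == q).
  by apply/funext => z; rewrite metricE.
case: eqP => // _; rewrite /pd mulr0n.
by have [_ ->] := is_derive_const x (delta_mx 0 i) (0 : R).
Qed.

(** The trace involves only Christoffel symbols with equal lower indices. Apart
   from a term in the derivative of G i, they give the logarithmic derivative of
   the volume density, which is half the sum of those of the G j. *)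
Lemma laplacian_diag v x : laplacian X v x =
  \sum_i (G i x)^-1 * (pd i (pd i v) x +
    (2^-1 * (\sum_j pd i (G j) x / G j x) - pd i (G i) x / G i x) * pd i v x).
Proof.
rewrite /laplacian invmx_metric /mxtrace.
have chr m i : christoffel X m i i x =
  2^-1 * (G m x)^-1 * ((pd i (G i) x *+ 2) *+ (m == i) - pd m (G i) x).
  rewrite /christoffel (bigD1 m) //= big1 ?addr0; last first.
    by move=> q qm; rewrite invmx_metric !mxE eq_sym (negbTE qm) mulr0n !mul0r.
  rewrite invmx_metric !mxE eqxx mulr1n !pd_metric eqxx mulr1n.
  rewrite [i == m]eq_sym; case: eqP => [->|_]; first by rewrite !mulr1n mulr2n; ring.
  by rewrite !mulr0n; ring.
under eq_bigr => i _.
  rewrite mul_diag_mx mxE [X in X * _]mxE [hessian _ _ _ _ _]mxE.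
  under eq_bigr => m _ do rewrite chr.
  over.
have split_i i : \sum_(m < n) 2^-1 / G m x *
      (pd i (G i) x *+ 2 *+ (m == i) - pd m (G i) x) * pd m v x =
  (G i x)^-1 * pd i (G i) x * pd i v x -
  \sum_m 2^-1 / G m x * pd m (G i) x * pd m v x.
  rewrite (eq_bigr (fun m => 2^-1 / G m x * (pd i (G i) x *+ 2 *+ (m == i)) * pd m v x +
     - (2^-1 / G m x * pd m (G i) x * pd m v x))); last by move=> m _; ring.
  rewrite big_split /= sumrN; congr (_ - _).
  rewrite (bigD1 i) //= big1 ?addr0; last first.
    by move=> m mi; rewrite (negbTE mi) mulr0n mulr0 mul0r.
  by rewrite eqxx mulr1n mulr2n; field; rewrite G_neq0.
under eq_bigr => i _ do rewrite split_i.
rewrite (eq_bigr (fun i => (G i x)^-1 * (pd i (pd i v) x - pd i (G i) x / G i x * pd i v x)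
   + \sum_m (G i x)^-1 * (2^-1 / G m x * pd m (G i) x * pd m v x))); last first.
  by move=> i _; rewrite -mulr_sumr; ring.
rewrite big_split /= exchange_big /= -big_split /=.
apply: eq_bigr => i _.
rewrite (eq_bigr (fun m => (G i x)^-1 * 2^-1 * pd i v x * (pd i (G m) x / G m x))); last first.
  by move=> m _; ring.
by rewrite -mulr_sumr; ring.
Qed.

End DiagonalMetric.

Lemma dotpC (R : realType) m (u v : 'rV[R]_m) : dotp u v = dotp v u.
Proof. by rewrite /dotp !mxE; apply: eq_bigr => i _; rewrite !mxE mulrC. Qed.

Lemma dotpE (R : realType) m (u v : 'rV[R]_m) : dotp u v = \sum_c u 0 c * v 0 c.
Proof. by rewrite /dotp mxE; apply: eq_bigr => c _; rewrite mxE. Qed.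

Lemma dotp_eq0 (R : realType) m (u : 'rV[R]_m) : dotp u u = 0 -> u = 0.
Proof.
rewrite dotpE => /eqP; rewrite psumr_eq0 => [/allP h|i _]; last first.
  by rewrite -expr2 sqr_ge0.
apply/rowP => i; rewrite mxE; apply/eqP.
by have := h i (mem_index_enum _); rewrite mulf_eq0 orbb.
Qed.

Section UnitNormal.
Variables (R : realType) (n : nat) (p : nat) (X : 'rV[R]_n -> 'rV[R]_p).
Variables (x : 'rV[R]_n) (N : 'rV[R]_p).
Hypotheses (pE : p = n.+2) (imm : row_free (jac X x)).
Hypotheses (XX : dotp (X x) (X x) = 1) (XJ : forall i, dotp (X x) (row i (jac X x)) = 0).
Hypothesis hN : is_unit_normal X x N.

(** The tangent vectors, X and N form a basis, on which the inner products with
   another unit normal are those of a multiple of N. *)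
Lemma unit_normal_sign : exists e : R, e * e = 1 /\ unit_normal X x = e *: N.
Proof.
have : is_unit_normal X x (unit_normal X x).
  exact: (@xgetPex _ 0 (is_unit_normal X x) (ex_intro _ N hN)).
set N' := unit_normal X x => -[N'1 N'X N'J]; have [N1 NX NJ] := hN.
pose J := jac X x.
pose M := col_mx J (col_mx (X x) N).
have Jdot (u : 'rV[R]_p) : J *m u^T = \col_i dotp u (row i J).
  apply/colP => i; rewrite !mxE /dotp !mxE; apply: eq_bigr => j _.
  by rewrite !mxE mulrC.
have JN : J *m N^T = 0 by rewrite Jdot; apply/colP => i; rewrite !mxE NJ.
have JX : J *m (X x)^T = 0 by rewrite Jdot; apply/colP => i; rewrite !mxE XJ.
have free : row_free M.
  rewrite -kermx_eq0; apply/rowV0P => u /sub_kermxP.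
  rewrite -[u]hsubmxK -[rsubmx u]hsubmxK; set a := lsubmx u.
  set b := lsubmx _; set c := rsubmx _.
  rewrite !mul_row_col => e.
  have dm q (y z : 'rV[R]_q) : y *m z^T = (dotp y z)%:M by rewrite [LHS]mx11_scalar.
  have c0 : c = 0.
    have := congr1 (mulmx^~ N^T) e; rewrite !mulmxDl -!mulmxA JN mul0mx mulmx0 add0r.
    by rewrite !dm [dotp (X x) N]dotpC NX N1 raddf0 mulmx0 add0r mulmx1.
  have b0 : b = 0.
    have := congr1 (mulmx^~ (X x)^T) e; rewrite !mulmxDl -!mulmxA JX mul0mx mulmx0 add0r.
    by rewrite c0 mul0mx addr0 !dm XX mulmx1.
  have a0 : a = 0.
    move: e; rewrite b0 c0 !mul0mx !addr0 => e.
    by apply: (row_free_inj imm); rewrite mul0mx.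
  by rewrite a0 b0 c0 !row_mx0.
have full : row_full M.
  by move: free; rewrite /row_full /row_free => /eqP ->; rewrite pE addn1 !addnS addn0.
pose e := dotp N N'.
have eqN : N' = e *: N.
  suff h : (N' - e *: N)^T = 0.
    by apply/eqP; rewrite -subr_eq0 -[_ - _]trmxK h trmx0.
  apply: (row_full_inj full); rewrite mulmx0 !mul_col_mx.
  have JD : J *m (N' - e *: N)^T = 0.
    by rewrite linearB linearZ /= mulmxBr -scalemxAr JN scaler0 subr0 Jdot; apply/colP => i; rewrite !mxE N'J.
  have dD (u : 'rV[R]_p) : u *m (N' - e *: N)^T = (dotp u N' - e * dotp u N)%:M.
    rewrite [LHS]mx11_scalar; congr (_%:M).
    rewrite /dotp !mxE mulr_sumr -sumrB; apply: eq_bigr => j _; rewrite !mxE; ring.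
  by rewrite JD !dD ![dotp (X x) _]dotpC N'X NX mulr0 subr0 N1 mulr1 subrr raddf0 !col_mx0.
exists e; split=> //.
by move: N'1; rewrite eqN dotpZ N1 mulr1.
Qed.
End UnitNormal.

Section PrincipalCurvatures.
Variables (R : realType) (n p : nat) (X : 'rV[R]_n -> 'rV[R]_p) (x : 'rV[R]_n).

(** The roots of the characteristic polynomial are determined up to order. *)
Lemma sqnormA_diag (c : 'I_n -> R) :
  (forall i j, shape_op X x i j = c i *+ (i == j)) ->
  sqnormA X x = \sum_i c i ^+ 2.
Proof.
move=> hS; rewrite /sqnormA.
have trig : is_trig_mx (shape_op X x).
  by apply/is_trig_mxP => i j ij; rewrite hS -val_eqE /= ltn_eqF.
have cp : char_poly (shape_op X x) = \prod_(a <- codom c) ('X - a%:P).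
  rewrite char_poly_trig // big_map big_enum /=; apply: eq_bigr => i _.
  by rewrite hS eqxx mulr1n.
pose P := [set s : seq R | char_poly (shape_op X x) = \prod_(c <- s) ('X - c%:P)].
have : P (principal_curvatures X x) by exact: (@xgetPex _ [::] P (ex_intro _ _ cp)).
rewrite /P /= cp => e; rewrite -(perm_big _ (prod_XsubC_eq e)).
by rewrite big_map big_enum.
Qed.
End PrincipalCurvatures.

(** * Stereographic charts of the sphere *)
Section Stereographic.
Variables (R : realType) (m : nat) (b : bool).
Implicit Types (x : 'rV[R]_m) (i j : 'I_m) (a : 'I_(m + 1)).

Definition stereo_coord a x : R := stereo_vec b x 0 a.

Let s x : R := 1 + dotp x x.
Let sE x : s x = 1 + \sum_j x 0 j * x 0 j.
Proof. by rewrite /s /dotp mxE; congr (_ + _); apply: eq_bigr => j _; rewrite mxE. Qed.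
Let s_neq0 x : s x != 0.
Proof. by rewrite gt_eqF // ltr_wpDr ?dotp_ge0. Qed.

(* The coordinate functions are all of the form 2 u / s + c with u affine. *)
Let u a x : R := match fintype.split a with inl j => x 0 j | inr _ => - (-1) ^+ b end.
Let d i a : R := match fintype.split a with inl j => (i == j)%:R | inr _ => 0 end.
Let c a : R := match fintype.split a with inl _ => 0 | inr _ => (-1) ^+ b end.

Let coordE a x : stereo_coord a x = 2 * u a x * (s x)^-1 + c a.
Proof.
have s0 := s_neq0 x.
rewrite /stereo_coord /stereo_vec -/(s x) /u /c -{1}(@fintype.splitK m 1 a); case: (fintype.split a) => j /=.
  by rewrite mxE row_mxEl !mxE addr0 mulrC.
rewrite mxE row_mxEr !mxE !ord1 eqxx mulr1n.
have -> : dotp x x = s x - 1 by rewrite /s addrC addKr.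
by field.
Qed.

Let pd_s i : has_pd i s (fun x => 2 * x 0 i).
Proof.
move=> x; rewrite (funext sE).
have h : is_derive x (delta_mx 0 i) (fun x => 1 + \sum_j x 0 j * x 0 j)
    (0 + \sum_j (x 0 j * (i == j)%:R + x 0 j * (i == j)%:R)).
  apply: (is_derive_add (is_derive_const x (delta_mx 0 i) 1)).
  by apply: is_derive_bigsum => j; exact: (is_derive_mul (has_pd_coord i j x) (has_pd_coord i j x)).
apply: (is_derive_eq h); rewrite (bigD1 i) //= big1 => [|j /negbTE ji].
  by rewrite eqxx mulr1n; ring.
by rewrite eq_sym ji !mulr0 addr0.
Qed.

Let pd_u i a : has_pd i (u a) (fun=> d i a).
Proof.
rewrite /u /d; case: (fintype.split a) => j; first exact: has_pd_coord.
by move=> x; exact: is_derive_const.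
Qed.

Let dy i a x : R := 2 * d i a * (s x)^-1 - 4 * u a x * x 0 i * ((s x)^-1) ^+ 2.

Lemma pd_stereo i a : has_pd i (stereo_coord a)
  (fun x => 2 * d i a * (s x)^-1 - 4 * u a x * x 0 i * ((s x)^-1) ^+ 2).
Proof.
move=> x; rewrite (funext (coordE a)); have s0 := s_neq0 x.
have hu := pd_u i a x; have hs := pd_s i x.
by derive_by; field.
Qed.

Let pd_dy i a : has_pd i (dy i a) (fun x => - 8 * d i a * x 0 i * ((s x)^-1) ^+ 2
   - 4 * u a x * ((s x)^-1) ^+ 2 + 16 * u a x * x 0 i ^+ 2 * ((s x)^-1) ^+ 3).
Proof.
move=> x; rewrite /dy; have s0 := s_neq0 x.
have hu := pd_u i a x; have hs := pd_s i x; have hx := has_pd_coord i i x.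
rewrite eqxx in hx.
by derive_by; rewrite /=; field.
Qed.

Definition stereo_conf x : R := 4 * ((s x)^-1) ^+ 2.

Lemma stereo_conf_gt0 x : 0 < stereo_conf x.
Proof. by rewrite mulr_gt0 // exprn_gt0 // invr_gt0 ltr_wpDr ?dotp_ge0. Qed.

Lemma pd_stereo_conf i : has_pd i stereo_conf
  (fun x => (- 4 * x 0 i * (s x)^-1) * stereo_conf x).
Proof.
move=> x; rewrite /stereo_conf; have s0 := s_neq0 x.
have hs := pd_s i x.
by derive_by; rewrite /=; field.
Qed.

Let sum_d_x a x : \sum_i d i a * x 0 i = u a x + c a.
Proof.
rewrite /d /u /c; case: (fintype.split a) => j.
  rewrite (bigD1 j) //= big1 ?addr0; last by move=> i /negbTE ->; rewrite mul0r.
  by rewrite eqxx mul1r.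
by rewrite big1 ?addNr // => i _; rewrite mul0r.
Qed.

(** The left-hand side is stereo_conf times the Laplacian of the round sphere, by
   the formula for a conformal metric; the coordinates of the sphere are
   eigenfunctions with eigenvalue - m. *)
Lemma stereo_laplacian a x :
  \sum_i (pd i (pd i (stereo_coord a)) x + (2^-1 * m%:R - 1) *
    (pd i stereo_conf x / stereo_conf x) * pd i (stereo_coord a) x)
  = - m%:R * stereo_conf x * stereo_coord a x.
Proof.
have s0 := s_neq0 x.
rewrite (eq_bigr (fun i => - 4 * u a x * ((s x)^-1) ^+ 2 + (d i a * x 0 i) *
      (- 4 * m%:R * ((s x)^-1) ^+ 2)
    + (x 0 i * x 0 i) * (8 * m%:R * u a x * ((s x)^-1) ^+ 3))); last first.
  move=> i _.
  rewrite (has_pdE (pd_stereo i a)) (has_pdE (pd_dy i a)) (has_pdE (pd_stereo_conf i)).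
  by rewrite mulfK ?gt_eqF ?stereo_conf_gt0 //=; field.
rewrite !big_split /= -!mulr_suml sum_d_x sumr_const card_ord -mulr_natl.
have -> : \sum_i x 0 i * x 0 i = s x - 1 by rewrite sE addrC addKr.
by rewrite coordE /stereo_conf; field.
Qed.

Let sum_split (F : 'I_m -> R) (g : R) :
  \sum_(a < m + 1) (match fintype.split a with inl j => F j | inr _ => g end) = \sum_j F j + g.
Proof.
rewrite big_split_ord big_ord1 /=; congr (_ + _).
  by apply: eq_bigr => j _; rewrite (@unsplitK m 1 (inl j)).
by rewrite (@unsplitK m 1 (inr ord0)).
Qed.

Lemma stereo_metric i j x :
  \sum_a pd i (stereo_coord a) x * pd j (stereo_coord a) x
  = stereo_conf x *+ (i == j).
Proof.
have s0 := s_neq0 x.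
have pick (q : 'I_m) (F : 'I_m -> R) : \sum_l (q == l)%:R * F l = F q.
  rewrite (bigD1 q) //= big1 ?addr0 => [|l /negbTE ql]; first by rewrite eqxx mul1r.
  by rewrite [q == l]eq_sym ql mul0r.
have e1 : \sum_a d i a * d j a = (i == j)%:R.
  have := sum_split (fun q => (i == q)%:R * (j == q)%:R) 0.
  rewrite pick addr0 [j == i]eq_sym => <-.
  by apply: eq_bigr => a _; rewrite /d; case: (fintype.split a) => //= _; rewrite mul0r.
have e2 q : \sum_a d q a * u a x = x 0 q.
  have := sum_split (fun l => (q == l)%:R * x 0 l) 0.
  rewrite pick addr0 => <-.
  by apply: eq_bigr => a _; rewrite /d /u; case: (fintype.split a) => //= _; rewrite mul0r.
have e3 : \sum_a u a x * u a x = s x.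
  have := sum_split (fun l => x 0 l * x 0 l) 1.
  rewrite addrC -sE => <-.
  apply: eq_bigr => a _; rewrite /u; case: (fintype.split a) => //= _.
  by rewrite mulrNN -expr2 sqrr_sign.
rewrite (eq_bigr (fun a => (d i a * d j a) * (4 * ((s x)^-1) ^+ 2) +
     (d i a * u a x) * (- 8 * x 0 j * ((s x)^-1) ^+ 3) +
     (d j a * u a x) * (- 8 * x 0 i * ((s x)^-1) ^+ 3) +
     (u a x * u a x) * (16 * x 0 i * x 0 j * ((s x)^-1) ^+ 4))); last first.
  by move=> a _; rewrite (has_pdE (pd_stereo i a)) (has_pdE (pd_stereo j a)) /=; ring.
rewrite !big_split /= -!mulr_suml e1 !e2 e3 -mulr_natr /stereo_conf.
by field.
Qed.

Lemma Cdiff_stereo n a : Cdiff n (stereo_coord a).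
Proof.
rewrite (funext (coordE a)).
have hs : Cdiff n s.
  rewrite (funext sE); apply: Cdiff_add; first exact: Cdiff_const.
  by apply: Cdiff_sum => j; apply: Cdiff_mul; exact: Cdiff_coord.
apply: Cdiff_add; last exact: Cdiff_const.
apply: Cdiff_mul; last exact: Cdiff_inv.
apply: Cdiff_mul; first exact: Cdiff_const.
by rewrite /u; case: (fintype.split a) => j; [exact: Cdiff_coord|exact: Cdiff_const].
Qed.

Lemma stereo_sum_sqr x : \sum_a stereo_coord a x * stereo_coord a x = 1.
Proof.
rewrite -[RHS](stereo_vecP b x) /dotp [RHS]mxE; apply: eq_bigr => a _.
by congr (_ * _); rewrite [RHS]mxE.
Qed.

Let pd_y i a := (CdiffSP (@Cdiff_stereo 2 a) i).1.

Lemma stereo_radial i x : \sum_a stereo_coord a x * pd i (stereo_coord a) x = 0.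
Proof.
have h : has_pd i (fun x => \sum_a stereo_coord a x * stereo_coord a x)
   (fun x => \sum_a (stereo_coord a x * pd i (stereo_coord a) x +
      stereo_coord a x * pd i (stereo_coord a) x)).
  move=> z; apply: is_derive_bigsum => a; apply: is_derive_mul; exact: pd_y.
have := h x; rewrite (funext stereo_sum_sqr) => -[_].
have [_ ->] := is_derive_const x (delta_mx 0 i) (1 : R).
by rewrite big_split /=; lra.
Qed.

End Stereographic.

(** Restrictions of functions of the round sphere of dimension m to a
   stereographic chart, with eigenvalue alpha of minus the Laplacian. *)
Definition sphere_eigen (R : realType) (m : nat) (Y : 'rV[R]_m -> R) (alpha : R) :=
  (forall n, Cdiff n Y) /\ forall x,
  \sum_i (pd i (pd i Y) x + (2^-1 * m%:R - 1) *
    (pd i (@stereo_conf R m) x / stereo_conf x) * pd i Y x)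
  = - alpha * stereo_conf x * Y x.

Lemma sphere_eigen_coord (R : realType) (m : nat) b a :
  sphere_eigen (@stereo_coord R m b a) m%:R.
Proof. by split=> [n|x]; [exact: Cdiff_stereo|exact: stereo_laplacian]. Qed.

Lemma sphere_eigen_const (R : realType) (m : nat) :
  sphere_eigen (fun _ : 'rV[R]_m => 1) 0.
Proof.
split=> [n|x]; first exact: Cdiff_const.
have z i (c : R) : pd i (fun _ : 'rV[R]_m => c) = fun=> 0.
  by apply: has_pdE => y; exact: is_derive_const.
by rewrite big1 => [|i _]; rewrite ?z ?z ?mulr0 ?addr0 // oppr0 !mul0r.
Qed.

(** * Separated variables *)
Section Chart.
Variables (R : realType) (k l : nat) (b : bool * bool).
Local Notation n := (k + l + 1)%N.
Local Notation p := ((k + 1) + (l + 1) + 1)%N.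
Implicit Types (x : 'rV[R]_n).

Definition in1 (i : 'I_k) : 'I_n := lshift 1 (lshift l i).
Definition in2 (j : 'I_l) : 'I_n := lshift 1 (rshift k j).
Definition in3 : 'I_n := rshift (k + l) ord0.

Let P1 x : 'rV[R]_k := lsubmx (lsubmx x).
Let P2 x : 'rV[R]_l := rsubmx (lsubmx x).
Let P3 x : R := rsubmx x 0 0.

Lemma in_split (i : 'I_n) :
  [\/ exists i', i = in1 i', exists j', i = in2 j' | i = in3].
Proof.
case: (split_ordP i) => [i' ->|j ->]; last by apply: Or33; rewrite ord1.
case: (split_ordP i') => [i1 ->|i2 ->]; [by apply: Or31; exists i1|].
by apply: Or32; exists i2.
Qed.

Lemma sum_in (F : 'I_n -> R) :
  \sum_i F i = \sum_i F (in1 i) + \sum_j F (in2 j) + F in3.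
Proof. by rewrite !big_split_ord big_ord1. Qed.

Lemma in1_eq i j : (in1 i == in1 j) = (i == j).
Proof. by rewrite !(inj_eq (@lshift_inj _ _)). Qed.
Lemma in2_eq i j : (in2 i == in2 j) = (i == j).
Proof. by rewrite (inj_eq (@lshift_inj _ _)) (inj_eq (@rshift_inj _ _)). Qed.
Lemma in12_eq i j : (in1 i == in2 j) = false.
Proof. by rewrite (inj_eq (@lshift_inj _ _)) eq_lrshift. Qed.
Lemma in13_eq i : (in1 i == in3) = false.
Proof. by rewrite eq_lrshift. Qed.
Lemma in23_eq i : (in2 i == in3) = false.
Proof. by rewrite eq_lrshift. Qed.

Definition sep (Y : 'rV[R]_k -> R) (Z : 'rV[R]_l -> R) (h : R -> R) x : R :=
  Y (P1 x) * Z (P2 x) * h (P3 x).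

Let P1_in1 i x (h : R) : P1 (h *: delta_mx 0 (in1 i) + x) = h *: delta_mx 0 i + P1 x.
Proof. by apply/rowP => j; rewrite !mxE eqxx in1_eq. Qed.
Let P1_in2 i x (h : R) : P1 (h *: delta_mx 0 (in2 i) + x) = h *: 0 + P1 x.
Proof. by apply/rowP => j; rewrite !mxE eqxx (in12_eq j i). Qed.
Let P1_in3 x (h : R) : P1 (h *: delta_mx 0 in3 + x) = h *: 0 + P1 x.
Proof. by apply/rowP => j; rewrite !mxE eqxx (in13_eq j). Qed.
Let P2_in1 i x (h : R) : P2 (h *: delta_mx 0 (in1 i) + x) = h *: 0 + P2 x.
Proof. by apply/rowP => j; rewrite !mxE eqxx eq_sym (in12_eq i j). Qed.
Let P2_in2 i x (h : R) : P2 (h *: delta_mx 0 (in2 i) + x) = h *: delta_mx 0 i + P2 x.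
Proof. by apply/rowP => j; rewrite !mxE eqxx in2_eq. Qed.
Let P2_in3 x (h : R) : P2 (h *: delta_mx 0 in3 + x) = h *: 0 + P2 x.
Proof. by apply/rowP => j; rewrite !mxE eqxx (in23_eq j). Qed.
Let P3_in1 i x (h : R) : P3 (h *: delta_mx 0 (in1 i) + x) = h *: (0 : R) + P3 x.
Proof. by rewrite /P3 !mxE eqxx eq_sym in13_eq. Qed.
Let P3_in2 i x (h : R) : P3 (h *: delta_mx 0 (in2 i) + x) = h *: (0 : R) + P3 x.
Proof. by rewrite /P3 !mxE eqxx eq_sym in23_eq. Qed.
Let P3_in3 x (h : R) : P3 (h *: delta_mx 0 in3 + x) = h *: (1 : R) + P3 x.
Proof. by rewrite /P3 !mxE !eqxx. Qed.

Lemma sep_pd1 i Y Y' Z h : has_pd i Y Y' -> has_pd (in1 i) (sep Y Z h) (sep Y' Z h).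
Proof.
move=> hY x.
have d1 := is_derive_comp_affine (P1_in1 i x) (hY (P1 x)).
have d2 := is_derive_comp_affine (P2_in1 i x) (is_derive_zero_dir Z (P2 x)).
have d3 := is_derive_comp_affine (P3_in1 i x) (is_derive_zero_dir h (P3 x)).
by apply: (is_derive_eq (is_derive_mul (is_derive_mul d1 d2) d3)); rewrite /sep; ring.
Qed.

Lemma sep_pd2 i Y Z Z' h : has_pd i Z Z' -> has_pd (in2 i) (sep Y Z h) (sep Y Z' h).
Proof.
move=> hZ x.
have d1 := is_derive_comp_affine (P1_in2 i x) (is_derive_zero_dir Y (P1 x)).
have d2 := is_derive_comp_affine (P2_in2 i x) (hZ (P2 x)).
have d3 := is_derive_comp_affine (P3_in2 i x) (is_derive_zero_dir h (P3 x)).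
by apply: (is_derive_eq (is_derive_mul (is_derive_mul d1 d2) d3)); rewrite /sep; ring.
Qed.

Lemma sep_pd3 Y Z h h' : has_deriv h h' -> has_pd in3 (sep Y Z h) (sep Y Z h').
Proof.
move=> hh x.
have d1 := is_derive_comp_affine (P1_in3 x) (is_derive_zero_dir Y (P1 x)).
have d2 := is_derive_comp_affine (P2_in3 x) (is_derive_zero_dir Z (P2 x)).
have d3 := is_derive_comp_affine (P3_in3 x) (hh (P3 x)).
by apply: (is_derive_eq (is_derive_mul (is_derive_mul d1 d2) d3)); rewrite /sep; ring.
Qed.

Let continuous_sep Y Z h : continuous Y -> continuous Z -> continuous h ->
  continuous (sep Y Z h).
Proof.
move=> cY cZ ch.
have c1 : continuous P1.
  move=> x; apply: (@continuous_comp _ _ _ (@lsubmx R 1 (k + l) 1) (@lsubmx R 1 k l));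
    exact/differentiable_continuous/differentiable_lsubmx.
have c2 : continuous P2.
  move=> x; apply: (@continuous_comp _ _ _ (@lsubmx R 1 (k + l) 1) (@rsubmx R 1 k l)).
    exact/differentiable_continuous/differentiable_lsubmx.
  exact/differentiable_continuous/differentiable_rsubmx.
have c3 : continuous P3.
  rewrite (_ : P3 = fun x => x 0 in3); last by apply/funext => x; rewrite /P3 mxE.
  exact: coord_continuous.
apply: continuous_mul; first apply: continuous_mul.
- by move=> x; apply: continuous_comp; [exact: c1|exact: cY].
- by move=> x; apply: continuous_comp; [exact: c2|exact: cZ].
- by move=> x; apply: continuous_comp; [exact: c3|exact: ch].
Qed.

Lemma Cdiff_sep m Y Z h : Cdiff m Y -> Cdiff m Z -> smooth_line h ->
  Cdiff m (sep Y Z h).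
Proof.
elim: m Y Z h => [|m IH] Y Z h hY hZ hh;
  have cs := continuous_sep (Cdiff_cont hY) (Cdiff_cont hZ) (smooth_line_continuous hh).
  by split.
apply: CdiffS cs _ => i; have [[i' ->]|[i' ->]|->] := in_split i.
- have [d c] := CdiffSP hY i'; exists (sep (pd i' Y) Z h); first exact: sep_pd1.
  by apply: IH => //; exact: CdiffW.
- have [d c] := CdiffSP hZ i'; exists (sep Y (pd i' Z) h); first exact: sep_pd2.
  by apply: IH => //; exact: CdiffW.
- exists (sep Y Z (derive1 h)); first exact/sep_pd3/smooth_line_deriv.
  by apply: IH; [exact: CdiffW|exact: CdiffW|exact: smooth_line_derive1].
Qed.

Let one1 : 'rV[R]_k -> R := fun=> 1.
Let one2 : 'rV[R]_l -> R := fun=> 1.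
Let zero1 : 'rV[R]_k -> R := fun=> 0.
Let zero2 : 'rV[R]_l -> R := fun=> 0.
Let pd_one1 i : has_pd i one1 zero1. Proof. by move=> x; exact: is_derive_const. Qed.
Let pd_one2 i : has_pd i one2 zero2. Proof. by move=> x; exact: is_derive_const. Qed.
Let y1 a := stereo_coord b.1 a : 'rV[R]_k -> R.
Let y2 a := stereo_coord b.2 a : 'rV[R]_l -> R.
Let L1 : 'rV[R]_k -> R := @stereo_conf R k.
Let L2 : 'rV[R]_l -> R := @stereo_conf R l.
Let pd_y1 i a : has_pd i (y1 a) (pd i (y1 a)).
Proof. exact: (CdiffSP (@Cdiff_stereo R k b.1 1 a) i).1. Qed.
Let pd_y2 i a : has_pd i (y2 a) (pd i (y2 a)).
Proof. exact: (CdiffSP (@Cdiff_stereo R l b.2 1 a) i).1. Qed.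

Definition out1 (a : 'I_(k + 1)) : 'I_p := lshift 1 (lshift (l + 1) a).
Definition out2 (a : 'I_(l + 1)) : 'I_p := lshift 1 (rshift (k + 1) a).
Definition out3 : 'I_p := rshift (k + 1 + (l + 1)) ord0.

Lemma sum_out (F : 'I_p -> R) :
  \sum_i F i = \sum_i F (out1 i) + \sum_j F (out2 j) + F out3.
Proof. by rewrite big_split_ord big_ord1 big_split_ord. Qed.

(** The vector field (w1 y, w2 z, w3) on the product of spheres. The immersion and
   its unit normal are both of this form, so that both fundamental forms are
   instances of [vec_gram]. *)
Definition vec (w1 w2 w3 : R -> R) (c : 'I_p) : 'rV[R]_n -> R :=
  match fintype.split c with
  | inl c' => match fintype.split c' with
              | inl a => sep (y1 a) one2 w1
              | inr a => sep one1 (y2 a) w2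
              end
  | inr _ => sep one1 one2 w3
  end.

Lemma vec_out1 w1 w2 w3 a : vec w1 w2 w3 (out1 a) = sep (y1 a) one2 w1.
Proof. by rewrite /vec (unsplitK (inl _)) (unsplitK (inl _)). Qed.
Lemma vec_out2 w1 w2 w3 a : vec w1 w2 w3 (out2 a) = sep one1 (y2 a) w2.
Proof. by rewrite /vec (unsplitK (inl _)) (unsplitK (inr _)). Qed.
Lemma vec_out3 w1 w2 w3 : vec w1 w2 w3 out3 = sep one1 one2 w3.
Proof. by rewrite /vec (unsplitK (inr _)). Qed.

Lemma pd_vec_in1 w1 w2 w3 i :
  [/\ forall a, pd (in1 i) (vec w1 w2 w3 (out1 a)) = sep (pd i (y1 a)) one2 w1,
     forall a, pd (in1 i) (vec w1 w2 w3 (out2 a)) = (fun=> 0) &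
     pd (in1 i) (vec w1 w2 w3 out3) = (fun=> 0)].
Proof.
have z Z h : sep zero1 Z h = (fun=> 0).
  by apply/funext => x; rewrite /sep /zero1 !mul0r.
split=> [a|a|]; rewrite ?vec_out1 ?vec_out2 ?vec_out3.
- exact: has_pdE (sep_pd1 _ _ (pd_y1 i a)).
- by rewrite (has_pdE (sep_pd1 _ _ (pd_one1 i))) z.
- by rewrite (has_pdE (sep_pd1 _ _ (pd_one1 i))) z.
Qed.

Lemma pd_vec_in2 w1 w2 w3 i :
  [/\ forall a, pd (in2 i) (vec w1 w2 w3 (out1 a)) = (fun=> 0),
     forall a, pd (in2 i) (vec w1 w2 w3 (out2 a)) = sep one1 (pd i (y2 a)) w2 &
     pd (in2 i) (vec w1 w2 w3 out3) = (fun=> 0)].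
Proof.
have z Y h : sep Y zero2 h = (fun=> 0).
  by apply/funext => x; rewrite /sep /zero2 mulr0 mul0r.
split=> [a|a|]; rewrite ?vec_out1 ?vec_out2 ?vec_out3.
- by rewrite (has_pdE (sep_pd2 _ _ (pd_one2 i))) z.
- exact: has_pdE (sep_pd2 _ _ (pd_y2 i a)).
- by rewrite (has_pdE (sep_pd2 _ _ (pd_one2 i))) z.
Qed.

Lemma pd_vec_in3 w1 w2 w3 w1' w2' w3' c : has_deriv w1 w1' -> has_deriv w2 w2' ->
  has_deriv w3 w3' -> has_pd in3 (vec w1 w2 w3 c) (vec w1' w2' w3' c).
Proof.
move=> h1 h2 h3; rewrite /vec; case: (fintype.split c) => [c'|_]; last exact: sep_pd3.
by case: (fintype.split c') => a; exact: sep_pd3.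
Qed.

Lemma Cdiff_vec m w1 w2 w3 c : smooth_line w1 -> smooth_line w2 ->
  smooth_line w3 -> Cdiff m (vec w1 w2 w3 c).
Proof.
move=> h1 h2 h3; rewrite /vec; case: (fintype.split c) => [c'|_]; last first.
  by apply: Cdiff_sep => //; exact: Cdiff_const.
case: (fintype.split c') => a; apply: Cdiff_sep => //; try exact: Cdiff_const.
  exact: Cdiff_stereo.
exact: Cdiff_stereo.
Qed.

(** The entries of the two fundamental forms, which are diagonal in the charts. *)
Definition gramG (a1 a2 a3 : R -> R) (i : 'I_n) : 'rV[R]_n -> R :=
  match fintype.split i with
  | inl i' => match fintype.split i' with
              | inl _ => sep L1 one2 a1
              | inr _ => sep one1 L2 a2
              end
  | inr _ => sep one1 one2 a3
  end.

Lemma gramG_in1 a1 a2 a3 i : gramG a1 a2 a3 (in1 i) = sep L1 one2 a1.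
Proof. by rewrite /gramG (unsplitK (inl _)) (unsplitK (inl _)). Qed.
Lemma gramG_in2 a1 a2 a3 i : gramG a1 a2 a3 (in2 i) = sep one1 L2 a2.
Proof. by rewrite /gramG (unsplitK (inl _)) (unsplitK (inr _)). Qed.
Lemma gramG_in3 a1 a2 a3 : gramG a1 a2 a3 in3 = sep one1 one2 a3.
Proof. by rewrite /gramG (unsplitK (inr _)). Qed.

Lemma vec_dot w1 w2 w3 v1 v2 v3 x :
  \sum_c vec w1 w2 w3 c x * vec v1 v2 v3 c x =
  w1 (P3 x) * v1 (P3 x) + w2 (P3 x) * v2 (P3 x) + w3 (P3 x) * v3 (P3 x).
Proof.
rewrite sum_out !vec_out3.
under eq_bigr => a _ do rewrite !vec_out1 /sep /one2 mulr1 mulrACA.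
under [X in _ + X + _]eq_bigr => a _ do rewrite !vec_out2 /sep /one1 mul1r mulrACA.
by rewrite -!mulr_suml !stereo_sum_sqr /sep /one1 /one2; ring.
Qed.

Let cross12 w1 w2 w3 v1 v2 v3 i j x :
  \sum_c pd (in1 i) (vec w1 w2 w3 c) x * pd (in2 j) (vec v1 v2 v3 c) x = 0.
Proof.
have [_ a2 a3] := pd_vec_in1 w1 w2 w3 i; have [b1 _ b3] := pd_vec_in2 v1 v2 v3 j.
rewrite sum_out a3 mul0r !big1 ?addr0 // => a _.
  by rewrite a2 mul0r.
by rewrite b1 mulr0.
Qed.

Let tangent1 w1 w2 w3 v1 v2 v3 i x :
  \sum_c vec v1 v2 v3 c x * pd (in1 i) (vec w1 w2 w3 c) x = 0.
Proof.
have [a1 a2 a3] := pd_vec_in1 w1 w2 w3 i.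
rewrite sum_out a3 mulr0 addr0 [X in _ + X]big1 ?addr0; last first.
  by move=> a _; rewrite a2 mulr0.
under eq_bigr => a _ do rewrite a1 vec_out1 /sep /one2 !mulr1 mulrACA.
by rewrite -mulr_suml stereo_radial mul0r.
Qed.

Let tangent2 w1 w2 w3 v1 v2 v3 i x :
  \sum_c vec v1 v2 v3 c x * pd (in2 i) (vec w1 w2 w3 c) x = 0.
Proof.
have [a1 a2 a3] := pd_vec_in2 w1 w2 w3 i.
rewrite sum_out a3 mulr0 addr0 [X in X + _]big1 ?add0r; last first.
  by move=> a _; rewrite a1 mulr0.
under eq_bigr => a _ do rewrite a2 vec_out2 /sep /one1 !mul1r mulrACA.
by rewrite -mulr_suml stereo_radial mul0r.
Qed.

Lemma vec_normal w1 w2 w3 v1 v2 v3 w1' w2' w3' i x :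
  has_deriv w1 w1' -> has_deriv w2 w2' -> has_deriv w3 w3' ->
  \sum_c vec v1 v2 v3 c x * pd i (vec w1 w2 w3 c) x =
  (v1 (P3 x) * w1' (P3 x) + v2 (P3 x) * w2' (P3 x) + v3 (P3 x) * w3' (P3 x))
  *+ (i == in3).
Proof.
move=> hw1 hw2 hw3; have [[i' ->]|[i' ->]|->] := in_split i.
- by rewrite in13_eq mulr0n tangent1.
- by rewrite in23_eq mulr0n tangent2.
rewrite eqxx mulr1n -vec_dot; apply: eq_bigr => c _.
by rewrite (has_pdE (pd_vec_in3 c hw1 hw2 hw3)).
Qed.

Lemma vec_gram w1 w2 w3 v1 v2 v3 w1' w2' w3' v1' v2' v3' i j x :
  has_deriv w1 w1' -> has_deriv w2 w2' -> has_deriv w3 w3' ->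
  has_deriv v1 v1' -> has_deriv v2 v2' -> has_deriv v3 v3' ->
  \sum_c pd i (vec w1 w2 w3 c) x * pd j (vec v1 v2 v3 c) x =
  gramG (fun t => w1 t * v1 t) (fun t => w2 t * v2 t)
    (fun t => w1' t * v1' t + w2' t * v2' t + w3' t * v3' t) i x *+ (i == j).
Proof.
move=> hw1 hw2 hw3 hv1 hv2 hv3.
have dw c : pd in3 (vec w1 w2 w3 c) = vec w1' w2' w3' c.
  exact: has_pdE (pd_vec_in3 c hw1 hw2 hw3).
have dv c : pd in3 (vec v1 v2 v3 c) = vec v1' v2' v3' c.
  exact: has_pdE (pd_vec_in3 c hv1 hv2 hv3).
have e1 (A B C D : R) : A * 1 * B * (C * 1 * D) = A * B * (C * D) by rewrite !mulr1.
have e2 (A B C D : R) : 1 * A * B * (1 * C * D) = A * B * (C * D) by rewrite !mul1r.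
have [[i' ->]|[i' ->]|->] := in_split i; have [[j' ->]|[j' ->]|->] := in_split j.
- rewrite in1_eq gramG_in1; have [a1 a2 a3] := pd_vec_in1 w1 w2 w3 i'.
  have [b1 _ _] := pd_vec_in1 v1 v2 v3 j'.
  rewrite sum_out a3 mul0r addr0 [X in _ + X]big1 ?addr0; last first.
    by move=> a _; rewrite a2 mul0r.
  rewrite (eq_bigr (fun a => (pd i' (y1 a) (P1 x) * pd j' (y1 a) (P1 x)) *
    (w1 (P3 x) * v1 (P3 x)))); last first.
    move=> a _; rewrite mulrACA.
    apply: etrans (congr2 *%R (congr1 (@^~ x) (a1 a)) (congr1 (@^~ x) (b1 a))) _.
    exact: (e1 (pd i' (y1 a) (P1 x)) (w1 (P3 x)) (pd j' (y1 a) (P1 x)) (v1 (P3 x))).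
  by rewrite -mulr_suml stereo_metric -mulr_natr mulrAC mulr_natr /sep /one2 mulr1.
- by rewrite in12_eq mulr0n cross12.
- by rewrite in13_eq mulr0n (eq_bigr _ (fun c _ => mulrC _ _)); under eq_bigr do rewrite dv; rewrite tangent1.
- by rewrite eq_sym in12_eq mulr0n (eq_bigr _ (fun c _ => mulrC _ _)) cross12.
- rewrite in2_eq gramG_in2; have [a1 a2 a3] := pd_vec_in2 w1 w2 w3 i'.
  have [_ b1 _] := pd_vec_in2 v1 v2 v3 j'.
  rewrite sum_out a3 mul0r addr0 [X in X + _]big1 ?add0r; last first.
    by move=> a _; rewrite a1 mul0r.
  rewrite (eq_bigr (fun a => (pd i' (y2 a) (P2 x) * pd j' (y2 a) (P2 x)) *
    (w2 (P3 x) * v2 (P3 x)))); last first.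
    move=> a _; rewrite mulrACA.
    apply: etrans (congr2 *%R (congr1 (@^~ x) (a2 a)) (congr1 (@^~ x) (b1 a))) _.
    exact: (e2 (pd i' (y2 a) (P2 x)) (w2 (P3 x)) (pd j' (y2 a) (P2 x)) (v2 (P3 x))).
  by rewrite -mulr_suml stereo_metric -mulr_natr mulrAC mulr_natr /sep /one1 mul1r.
- by rewrite in23_eq mulr0n (eq_bigr _ (fun c _ => mulrC _ _)); under eq_bigr do rewrite dv; rewrite tangent2.
- by rewrite eq_sym in13_eq mulr0n; under eq_bigr do rewrite dw; rewrite tangent1.
- by rewrite eq_sym in23_eq mulr0n; under eq_bigr do rewrite dw; rewrite tangent2.
- rewrite eqxx mulr1n gramG_in3; under eq_bigr do rewrite dw dv.
  by rewrite vec_dot /sep /one1 /one2; ring.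
Qed.
End Chart.

(** * Geometry of the immersion *)

(** In [profile_minimality], s is the sigma, (x, y, z) the tangent, (a, b, c) the
   derivative of the normal and B the product of the normal with the derivative
   of the tangent. *)
Lemma curvature_balance (R : realType) (s a b c x y z B c0 : R) : s != 0 ->
  x * a + y * b + z * c + B = 0 ->
  (s * a * x + s * b * y + s * c * z) / s ^+ 2 = - c0 -> B = s * c0.
Proof.
move=> s0 e; have -> : s * a * x + s * b * y + s * c * z = s * (x * a + y * b + z * c).
  by ring.
have -> : x * a + y * b + z * c = - B by apply/eqP; rewrite -addr_eq0 e.
by move=> h; apply: oppr_inj; rewrite -mulrN -h; field.
Qed.

Section Hypersurface.
Variables (R : realType) (k l : nat) (f1 f2 : R -> R).
Local Notation n := (k + l + 1)%N.
Local Notation p := ((k + 1) + (l + 1) + 1)%N.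
Local Notation g1 := (profile f1 f2).
Local Notation g2 := f2.
Local Notation g3 := f1.
Hypotheses (sg1 : smooth_line g1) (sg2 : smooth_line g2) (sg3 : smooth_line g3).
Hypotheses (g1_gt0 : forall t, 0 < g1 t) (g2_gt0 : forall t, 0 < g2 t).
Hypothesis g_unit : forall t, g1 t ^+ 2 + g2 t ^+ 2 + g3 t ^+ 2 = 1.
Variable b : bool * bool.
Let X (x : 'rV[R]_n) : 'rV[R]_p := phi_map f1 f2 (chart b x).
Local Notation fld := (@vec R k l b).
Local Notation sigma2 := (speed2 g1 g2 g3).
Local Notation sigma := (speed g1 g2 g3).
Local Notation nu1 := (nor1 g1 g2 g3).
Local Notation nu2 := (nor2 g1 g2 g3).
Local Notation nu3 := (nor3 g1 g2 g3).
Local Notation tau1 := (tan1 g1 g2 g3).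
Local Notation tau2 := (tan2 g1 g2 g3).
Local Notation tau3 := (tan3 g1 g2 g3).
Implicit Types (x : 'rV[R]_n).
Local Notation time x := (rsubmx x 0 0).
Local Notation chart1 x := (lsubmx (lsubmx x)).
Local Notation chart2 x := (rsubmx (lsubmx x)).

Lemma phi_comp c : (fun x => X x 0 c) = fld g1 g2 g3 c.
Proof.
apply/funext => x; rewrite /X /phi_map /chart /vec.
case: (split_ordP c) => [c' ->|c' ->].
  rewrite row_mxEl; case: (split_ordP c') => [a ->|a ->].
    by rewrite row_mxEl mxE /sep mulr1 mulrC.
  by rewrite row_mxEr mxE /sep mul1r mulrC.
by rewrite row_mxEr !ord1 mxE eqxx mulr1n /sep !mul1r.
Qed.

Lemma phi_compE x c : X x 0 c = fld g1 g2 g3 c x.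
Proof. by rewrite -phi_comp. Qed.

Let d1 := smooth_line_deriv sg1.
Let d2 := smooth_line_deriv sg2.
Let d3 := smooth_line_deriv sg3.

Lemma jac_comp x i c : jac X x i c = pd i (fld g1 g2 g3 c) x.
Proof. by rewrite mxE phi_comp. Qed.

Definition metric_coef := @gramG R k l (fun t => g1 t * g1 t) (fun t => g2 t * g2 t)
    (fun t => derive1 g1 t * derive1 g1 t + derive1 g2 t * derive1 g2 t
      + derive1 g3 t * derive1 g3 t).

Lemma metric_comp x i j : metric X x i j = metric_coef i x *+ (i == j).
Proof.
rewrite /metric mxE -(vec_gram b i j x d1 d2 d3 d1 d2 d3); apply: eq_bigr => c _.
by rewrite jac_comp mxE jac_comp.
Qed.

Lemma phi_unit x : dotp (X x) (X x) = 1.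
Proof.
rewrite dotpE -(g_unit (time x)) !expr2 -(vec_dot b).
by apply: eq_bigr => c _; rewrite -!phi_comp.
Qed.

Hypothesis imm : forall x, row_free (jac X x).

Lemma time_surj t : exists x : 'rV[R]_n, time x = t.
Proof. by exists (row_mx 0 t%:M); rewrite row_mxKr mxE eqxx mulr1n. Qed.

(** This is the squared norm of a row of the Jacobian, which has no zero row. *)
Lemma speed2_gt0 t : 0 < sigma2 t.
Proof.
have [x <-] := time_surj t.
rewrite lt_neqAle andbC addr_ge0 ?addr_ge0 ?sqr_ge0 //= eq_sym; apply/eqP => s0.
have r0 : row (in3 k l) (jac X x) = 0.
  apply: dotp_eq0; rewrite dotpE.
  transitivity (metric X x (in3 k l) (in3 k l)).
    by rewrite [RHS]mxE; apply: eq_bigr => c _; rewrite !mxE.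
  by rewrite metric_comp eqxx /metric_coef gramG_in3 /sep !mul1r -!expr2 mulr1n.
have : delta_mx 0 (in3 k l) = 0 :> 'rV[R]_n.
  by apply: (row_free_inj (imm x)); rewrite /= mul0mx -rowE.
by move/rowP/(_ (in3 k l))/eqP; rewrite !mxE !eqxx oner_eq0.
Qed.

Let sn1 : smooth_line nu1 := smooth_nor1 sg1 sg2 sg3 speed2_gt0.
Let sn2 : smooth_line nu2 := smooth_nor2 sg1 sg2 sg3 speed2_gt0.
Let sn3 : smooth_line nu3 := smooth_nor3 sg1 sg2 sg3 speed2_gt0.
Let dn1 := smooth_line_deriv sn1.
Let dn2 := smooth_line_deriv sn2.
Let dn3 := smooth_line_deriv sn3.

Let nor_unit t : nu1 t * nu1 t + nu2 t * nu2 t + nu3 t * nu3 t = 1.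
Proof.
have h1 := col11 sg1 sg2 sg3 g_unit speed2_gt0 t.
have h2 := col22 sg1 sg2 sg3 g_unit speed2_gt0 t.
have h3 := col33 sg1 sg2 sg3 g_unit speed2_gt0 t.
have h4 := tan_unit speed2_gt0 t; have h5 := g_unit t.
rewrite -!expr2; lra.
Qed.

Let g_nor t : nu1 t * g1 t + nu2 t * g2 t + nu3 t * g3 t = 0.
Proof. by rewrite /nor1 /nor2 /nor3; ring. Qed.

Let tan_nor t : nu1 t * tau1 t + nu2 t * tau2 t + nu3 t * tau3 t = 0.
Proof. by rewrite /nor1 /nor2 /nor3; ring. Qed.

Let dg_nor t : nu1 t * derive1 g1 t + nu2 t * derive1 g2 t + nu3 t * derive1 g3 t = 0.
Proof.
have s0 := gt_eqF (speed_gt0 speed2_gt0 t).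
have := tan_nor t; rewrite /tan1 /tan2 /tan3 !mulrA -!mulrDl => /eqP.
by rewrite mulf_eq0 invr_eq0 s0 orbF => /eqP.
Qed.

Definition normal_field x : 'rV[R]_p := \row_c fld nu1 nu2 nu3 c x.

Lemma normal_fieldP x : is_unit_normal X x (normal_field x).
Proof.
split.
- rewrite dotpE -(nor_unit (time x)) -(vec_dot b).
  by apply: eq_bigr => c _; rewrite !mxE.
- rewrite dotpE -[RHS](g_nor (time x)) -(vec_dot b).
  by apply: eq_bigr => c _; rewrite mxE -phi_comp.
- move=> i; rewrite dotpE.
  have h := vec_normal b nu1 nu2 nu3 i x d1 d2 d3.
  rewrite dg_nor mul0rn in h; rewrite -[RHS]h.
  by apply: eq_bigr => c _; rewrite !mxE phi_comp.
Qed.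

Definition second_coef := @gramG R k l (fun t => g1 t * nu1 t) (fun t => g2 t * nu2 t)
    (fun t => derive1 g1 t * derive1 nu1 t + derive1 g2 t * derive1 nu2 t
      + derive1 g3 t * derive1 nu3 t).

(** The Weingarten equation: differentiating the orthogonality of the normal to the
   tangent vectors trades the second derivatives of the immersion for first
   derivatives of the normal. The sign e is that of the chosen unit normal. *)
Lemma second_form_comp x : exists2 e : R, e * e = 1 & forall i j,
  second_form X x i j = - e * (second_coef i x *+ (i == j)).
Proof.
have pE : p = n.+2 by rewrite !addn1 addSn addnS.
have XJ i : dotp (X x) (row i (jac X x)) = 0.
  have gg t : g1 t * derive1 g1 t + g2 t * derive1 g2 t + g3 t * derive1 g3 t = 0.
    have h0 s : g1 s * g1 s + g2 s * g2 s + g3 s * g3 s = 1 by rewrite -!expr2.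
    by have := deriv_dot3 d1 d2 d3 d1 d2 d3 h0 t; lra.
  have h := vec_normal b g1 g2 g3 i x d1 d2 d3.
  rewrite gg mul0rn in h; rewrite dotpE -[RHS]h.
  by apply: eq_bigr => c _; rewrite [row _ _ _ _]mxE jac_comp phi_compE.
have [e [ee eN]] := unit_normal_sign pE (imm x) (phi_unit x) XJ (normal_fieldP x).
exists e => // i j; rewrite mxE eN dotpE.
have pj c := CdiffSP (Cdiff_vec b 2 c sg1 sg2 sg3) j.
have pij c := (CdiffSP (pj c).2 i).1.
have pn c := (CdiffSP (Cdiff_vec b 1 c sn1 sn2 sn3) i).1.
have h0 : has_pd i (fun z => \sum_c fld nu1 nu2 nu3 c z * pd j (fld g1 g2 g3 c) z)
   (fun z => \sum_c (fld nu1 nu2 nu3 c z * pd i (pd j (fld g1 g2 g3 c)) z +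
      pd j (fld g1 g2 g3 c) z * pd i (fld nu1 nu2 nu3 c) z)).
  move=> z; apply: is_derive_bigsum => c; apply: is_derive_mul; first exact: pn.
  exact: pij.
have z0 : (fun z => \sum_c fld nu1 nu2 nu3 c z * pd j (fld g1 g2 g3 c) z) = fun=> 0.
  by apply/funext => z; rewrite (vec_normal b _ _ _ _ _ d1 d2 d3) dg_nor mul0rn.
have := h0 x; rewrite z0 => -[_].
have [_ ->] := is_derive_const x (delta_mx 0 i) (0 : R).
rewrite big_split /= (vec_gram b j i x d1 d2 d3 dn1 dn2 dn3).
set S := \sum_c _ => h.
have -> : \sum_c (\row_a pd i (pd j (fun z => X z 0 a)) x) 0 c * (e *: normal_field x) 0 c = e * S.
  rewrite /S mulr_sumr; apply: eq_bigr => c _; rewrite !mxE phi_comp; ring.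
have -> : second_coef i x *+ (i == j) = second_coef j x *+ (j == i).
  by rewrite eq_sym; case: eqP => [->|].
rewrite mulNr -mulrN; congr (_ * _); apply/eqP; rewrite -addr_eq0 eq_sym; exact/eqP.
Qed.

Lemma metric_coef_gt0 i x : 0 < metric_coef i x.
Proof.
rewrite /metric_coef; have [[i' ->]|[i' ->]|->] := in_split i.
- by rewrite gramG_in1 /sep mulr1 mulr_gt0 ?stereo_conf_gt0 ?mulr_gt0.
- by rewrite gramG_in2 /sep mul1r mulr_gt0 ?stereo_conf_gt0 ?mulr_gt0.
- by rewrite gramG_in3 /sep !mul1r -!expr2; exact: speed2_gt0.
Qed.

Let metric_coef_neq0 i x : metric_coef i x != 0.
Proof. by rewrite gt_eqF // metric_coef_gt0. Qed.

Let shape_coef i x := second_coef i x / metric_coef i x.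

Let shape_coef_in1 i x : shape_coef (in1 l i) x = nu1 (time x) / g1 (time x).
Proof.
rewrite /shape_coef /second_coef /metric_coef !gramG_in1 /sep !mulr1.
have c0 := gt_eqF (stereo_conf_gt0 (chart1 x)); have g0 := gt_eqF (g1_gt0 (time x)).
by field; rewrite c0 g0.
Qed.

Let shape_coef_in2 i x : shape_coef (in2 k i) x = nu2 (time x) / g2 (time x).
Proof.
rewrite /shape_coef /second_coef /metric_coef !gramG_in2 /sep !mul1r.
have c0 := gt_eqF (stereo_conf_gt0 (chart2 x)); have g0 := gt_eqF (g2_gt0 (time x)).
by field; rewrite c0 g0.
Qed.

Let sum_shape (F : R -> R) x : \sum_i F (shape_coef i x) =
  k%:R * F (nu1 (time x) / g1 (time x)) + l%:R * F (nu2 (time x) / g2 (time x))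
  + F (shape_coef (in3 k l) x).
Proof.
rewrite sum_in; congr (_ + _ + _).
  by under eq_bigr do rewrite shape_coef_in1; rewrite sumr_const card_ord mulr_natl.
by under eq_bigr do rewrite shape_coef_in2; rewrite sumr_const card_ord mulr_natl.
Qed.

Lemma shape_op_comp x : exists2 e : R, e * e = 1 & forall i j,
  shape_op X x i j = - e * shape_coef i x *+ (i == j).
Proof.
have [e ee he] := second_form_comp x; exists e => // i j.
rewrite /shape_op (@invmx_metric R n p X metric_coef metric_coef_neq0 metric_comp) mul_mx_diag mxE he mxE.
by case: eqP => [->|]; rewrite ?mulr1n ?mulr0n ?mulr0 ?mul0r // mulrA.
Qed.

Let G := metric_coef.

Let c1 i x := pd i (@stereo_conf R k) (chart1 x) / stereo_conf (chart1 x).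
Let c2 i x := pd i (@stereo_conf R l) (chart2 x) / stereo_conf (chart2 x).

Let one (m : nat) : 'rV[R]_m -> R := fun=> 1.
Let pd_one m i : has_pd i (@one m) (fun=> 0).
Proof. by move=> x; exact: is_derive_const. Qed.
Let pd_conf m i : has_pd i (@stereo_conf R m) (pd i (@stereo_conf R m)).
Proof. by move=> x; rewrite (has_pdE (pd_stereo_conf i)); exact: pd_stereo_conf. Qed.

Let zero_ratio (A B : R) : A = 0 -> A / B = 0. Proof. by move=> ->; rewrite mul0r. Qed.

Let sepx (Y : 'rV[R]_k -> R) (Z : 'rV[R]_l -> R) h x :
  sep Y Z h x = Y (chart1 x) * Z (chart2 x) * h (time x).
Proof. by []. Qed.

Let ratio1 i j x : pd (in1 l i) (G (in1 l j)) x / G (in1 l j) x = c1 i x.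
Proof.
rewrite /G /metric_coef gramG_in1 (has_pdE (sep_pd1 _ _ (pd_conf i))) !sepx /c1.
set P := pd i _ _; have s0 := stereo_conf_gt0 (chart1 x).
have := g1_gt0 (time x); move: (g1 (time x)) => g g0.
by rewrite !mulr1 -mulf_div divff ?mulr1 // gt_eqF // mulr_gt0.
Qed.

Let ratio2 i j x : pd (in2 k i) (G (in2 k j)) x / G (in2 k j) x = c2 i x.
Proof.
rewrite /G /metric_coef gramG_in2 (has_pdE (sep_pd2 _ _ (pd_conf i))) !sepx /c2.
set P := pd i _ _; have s0 := stereo_conf_gt0 (chart2 x).
have := g2_gt0 (time x); move: (g2 (time x)) => g g0.
by rewrite !mul1r -mulf_div divff ?mulr1 // gt_eqF // mulr_gt0.
Qed.

Let logd1 i x : \sum_j pd (in1 l i) (G j) x / G j x = k%:R * c1 i x.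
Proof.
rewrite sum_in [X in _ + X + _]big1 => [|j _]; last first.
  apply: zero_ratio; rewrite /G /metric_coef gramG_in2.
  by rewrite (has_pdE (sep_pd1 _ _ (pd_one i))) sepx !mul0r.
rewrite addr0 zero_ratio ?addr0; last first.
  rewrite /G /metric_coef gramG_in3.
  by rewrite (has_pdE (sep_pd1 _ _ (pd_one i))) sepx !mul0r.
by rewrite (eq_bigr (fun=> c1 i x)) => [|j _]; rewrite ?ratio1 // sumr_const card_ord mulr_natl.
Qed.

Let logd2 i x : \sum_j pd (in2 k i) (G j) x / G j x = l%:R * c2 i x.
Proof.
rewrite sum_in [X in X + _ + _]big1 => [|j _]; last first.
  apply: zero_ratio; rewrite /G /metric_coef gramG_in1.
  by rewrite (has_pdE (sep_pd2 _ _ (pd_one i))) sepx mulr0 mul0r.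
rewrite add0r [X in _ + X]zero_ratio ?addr0; last first.
  rewrite /G /metric_coef gramG_in3.
  by rewrite (has_pdE (sep_pd2 _ _ (pd_one i))) sepx mulr0 mul0r.
by rewrite (eq_bigr (fun=> c2 i x)) => [|j _]; rewrite ?ratio2 // sumr_const card_ord mulr_natl.
Qed.

Let dspeed2 := smooth_line_deriv (smooth_speed2 sg1 sg2 sg3).
Let G3 x : G (in3 k l) x = sigma2 (time x).
Proof. by rewrite /G /metric_coef gramG_in3 sepx !mul1r -!expr2. Qed.
Let pdG3 x : pd (in3 k l) (G (in3 k l)) x = derive1 sigma2 (time x).
Proof.
have -> : G (in3 k l) = sep (@one k) (@one l) sigma2.
  by apply/funext => z; rewrite G3 sepx !mul1r.
by rewrite (has_pdE (sep_pd3 _ _ dspeed2)) sepx !mul1r.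
Qed.

Let logd3 x : \sum_j pd (in3 k l) (G j) x / G j x =
  k%:R * (2 * (derive1 g1 (time x) / g1 (time x))) +
  l%:R * (2 * (derive1 g2 (time x) / g2 (time x))) +
  derive1 sigma2 (time x) / sigma2 (time x).
Proof.
have sq (g g' : R -> R) : has_deriv g g' -> has_deriv (fun t => g t * g t) (fun t => 2 * g t * g' t).
  by move=> hg t; apply: (is_derive_eq (is_derive_mul (hg t) (hg t))); ring.
have alg (c g d : R) : c != 0 -> g != 0 -> c * (2 * g * d) / (c * (g * g)) = 2 * (d / g).
  by move=> c0 g0; field; rewrite c0 g0.
rewrite sum_in pdG3 G3; congr (_ + _ + _).
  rewrite (eq_bigr (fun=> 2 * (derive1 g1 (time x) / g1 (time x)))) => [|j _].
    by rewrite sumr_const card_ord [RHS]mulr_natl.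
  rewrite /G /metric_coef gramG_in1 (has_pdE (sep_pd3 _ _ (sq _ _ d1))) !sepx.
  by rewrite !mulr1 alg // gt_eqF // stereo_conf_gt0.
rewrite (eq_bigr (fun=> 2 * (derive1 g2 (time x) / g2 (time x)))) => [|j _].
  by rewrite sumr_const card_ord [RHS]mulr_natl.
rewrite /G /metric_coef gramG_in2 (has_pdE (sep_pd3 _ _ (sq _ _ d2))) !sepx.
by rewrite !mul1r alg // gt_eqF // stereo_conf_gt0.
Qed.

Lemma laplacian_sep Y Z h alpha beta x :
  sphere_eigen Y alpha -> sphere_eigen Z beta -> smooth_line h ->
  laplacian X (sep Y Z h) x =
  Y (chart1 x) * Z (chart2 x) *
  ((derive1 (derive1 h) (time x) + (k%:R * (derive1 g1 (time x) / g1 (time x)) +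
     l%:R * (derive1 g2 (time x) / g2 (time x))
     - 2^-1 * (derive1 sigma2 (time x) / sigma2 (time x))) * derive1 h (time x))
    / sigma2 (time x)
   - alpha / g1 (time x) ^+ 2 * h (time x) - beta / g2 (time x) ^+ 2 * h (time x)).
Proof.
move=> [sY eY] [sZ eZ] sh.
rewrite (@laplacian_diag R n p X metric_coef metric_coef_neq0 metric_comp) sum_in.
have Y1 i : has_pd i Y (pd i Y) := (CdiffSP (sY 2%N) i).1.
have Y2 i : has_pd i (pd i Y) (pd i (pd i Y)) := (CdiffSP (CdiffSP (sY 2%N) i).2 i).1.
have Z1 i : has_pd i Z (pd i Z) := (CdiffSP (sZ 2%N) i).1.
have Z2 i : has_pd i (pd i Z) (pd i (pd i Z)) := (CdiffSP (CdiffSP (sZ 2%N) i).2 i).1.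
have h1 := smooth_line_deriv sh; have h2 := smooth_line_deriv (smooth_line_derive1 sh).
set y := chart1 x; set z := chart2 x; set t := time x.
have L1 := stereo_conf_gt0 y; have L2 := stereo_conf_gt0 z.
have g10 := g1_gt0 t; have g20 := g2_gt0 t.
have G1 i : G (in1 l i) x = stereo_conf y * g1 t ^+ 2.
  by rewrite /G /metric_coef gramG_in1 sepx mulr1 expr2.
have G2 i : G (in2 k i) x = stereo_conf z * g2 t ^+ 2.
  by rewrite /G /metric_coef gramG_in2 sepx mul1r expr2.
have block1 : \sum_i (G (in1 l i) x)^-1 * (pd (in1 l i) (pd (in1 l i) (sep Y Z h)) x +
    (2^-1 * (\sum_j pd (in1 l i) (G j) x / G j x) -
     pd (in1 l i) (G (in1 l i)) x / G (in1 l i) x) * pd (in1 l i) (sep Y Z h) x)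
    = - alpha / g1 t ^+ 2 * (Y y * Z z * h t).
  have eYy : \sum_i (pd i (pd i Y) y + (2^-1 * k%:R - 1) * c1 i x * pd i Y y) =
    - alpha * stereo_conf y * Y y := eY y.
  transitivity ((Z z * h t / (stereo_conf y * g1 t ^+ 2)) *
     \sum_i (pd i (pd i Y) y + (2^-1 * k%:R - 1) * c1 i x * pd i Y y)).
    rewrite mulr_sumr; apply: eq_bigr => i _.
    have e1 : pd (in1 l i) (sep Y Z h) = sep (pd i Y) Z h := has_pdE (sep_pd1 Z h (Y1 i)).
    have e2 : pd (in1 l i) (sep (pd i Y) Z h) = sep (pd i (pd i Y)) Z h :=
      has_pdE (sep_pd1 Z h (Y2 i)).
    rewrite logd1 ratio1 G1 e1 e2 !sepx -/y -/z -/t.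
    by move: (pd i (pd i Y) y) (pd i Y y) (c1 i x) => A B C; ring.
  rewrite eYy; move: (Y y) (Z z) (h t) => A B C.
  by field; rewrite !gt_eqF.
have block2 : \sum_i (G (in2 k i) x)^-1 * (pd (in2 k i) (pd (in2 k i) (sep Y Z h)) x +
    (2^-1 * (\sum_j pd (in2 k i) (G j) x / G j x) -
     pd (in2 k i) (G (in2 k i)) x / G (in2 k i) x) * pd (in2 k i) (sep Y Z h) x)
    = - beta / g2 t ^+ 2 * (Y y * Z z * h t).
  have eZz : \sum_i (pd i (pd i Z) z + (2^-1 * l%:R - 1) * c2 i x * pd i Z z) =
    - beta * stereo_conf z * Z z := eZ z.
  transitivity ((Y y * h t / (stereo_conf z * g2 t ^+ 2)) *
     \sum_i (pd i (pd i Z) z + (2^-1 * l%:R - 1) * c2 i x * pd i Z z)).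
    rewrite mulr_sumr; apply: eq_bigr => i _.
    have e1 : pd (in2 k i) (sep Y Z h) = sep Y (pd i Z) h := has_pdE (sep_pd2 Y h (Z1 i)).
    have e2 : pd (in2 k i) (sep Y (pd i Z) h) = sep Y (pd i (pd i Z)) h :=
      has_pdE (sep_pd2 Y h (Z2 i)).
    rewrite logd2 ratio2 G2 e1 e2 !sepx -/y -/z -/t.
    by move: (pd i (pd i Z) z) (pd i Z z) (c2 i x) => A B C; ring.
  rewrite eZz; move: (Y y) (Z z) (h t) => A B C.
  by field; rewrite !gt_eqF.
apply: etrans (congr2 +%R (congr2 +%R block1 block2) _) _; first by [].
have e1 : pd (in3 k l) (sep Y Z h) = sep Y Z (derive1 h) := has_pdE (sep_pd3 Y Z h1).
have e2 : pd (in3 k l) (sep Y Z (derive1 h)) = sep Y Z (derive1 (derive1 h)) :=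
  has_pdE (sep_pd3 Y Z h2).
rewrite -/G logd3 e1 e2 pdG3 G3 !sepx -/y -/z -/t.
have s0 := speed2_gt0 t; move: s0.
move: (sigma2 t) (derive1 sigma2 t) (derive1 (derive1 h) t) (derive1 h t) => S S' h'' h' S0.
move: g10 g20; move: (g1 t) (g2 t) (derive1 g1 t) (derive1 g2 t) => u v u' v' u0 v0.
move: (Y y) (Z z) (h t) => A B C.
by field; rewrite !gt_eqF.
Qed.

Hypothesis minimal : forall x, mean_curvature X x = 0.

Let shape_coef_in3 x : shape_coef (in3 k l) x = - gcurv k l g1 g2 g3 (time x).
Proof.
have [e ee he] := shape_op_comp x.
have n0 : n%:R != 0 :> R by rewrite pnatr_eq0 addn1.
have := minimal x; rewrite /mean_curvature => /eqP.
rewrite mulf_eq0 invr_eq0 (negbTE n0) /= /mxtrace.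
under eq_bigr do rewrite he eqxx mulr1n.
rewrite -mulr_sumr mulf_eq0 oppr_eq0 => /orP[/eqP e0|].
  by move: ee; rewrite e0 mul0r => /eqP; rewrite eq_sym oner_eq0.
rewrite (sum_shape id) addrC addr_eq0 => /eqP ->.
by rewrite /gcurv !mulrA.
Qed.

(** By minimality the principal curvature along the profile curve is the opposite
   of the sum of the others; it is also the geodesic curvature of the curve. *)
Lemma profile_minimality t :
  nu1 t * derive1 tau1 t + nu2 t * derive1 tau2 t + nu3 t * derive1 tau3 t
  = sigma t * gcurv k l g1 g2 g3 t.
Proof.
have [x <-] := time_surj t; set s := time x.
have := shape_coef_in3 x; rewrite /shape_coef /second_coef /metric_coef !gramG_in3.
rewrite /sep !mul1r -!expr2 -/s.
have e1 := deriv_dot3 dn1 dn2 dn3 (smooth_line_deriv (smooth_tan1 sg1 sg2 sg3 speed2_gt0))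
  (smooth_line_deriv (smooth_tan2 sg1 sg2 sg3 speed2_gt0))
  (smooth_line_deriv (smooth_tan3 sg1 sg2 sg3 speed2_gt0)) tan_nor s.
have s0 := speed_gt0 speed2_gt0 s; have s1 : sigma s != 0 by rewrite gt_eqF.
have s2 : sigma s ^+ 2 = derive1 g1 s ^+ 2 + derive1 g2 s ^+ 2 + derive1 g3 s ^+ 2.
  by rewrite sqr_sqrtr // ltW // speed2_gt0.
rewrite -s2.
have t1 : derive1 g1 s = sigma s * tau1 s by rewrite /tan1 mulrC divfK.
have t2 : derive1 g2 s = sigma s * tau2 s by rewrite /tan2 mulrC divfK.
have t3 : derive1 g3 s = sigma s * tau3 s by rewrite /tan3 mulrC divfK.
by rewrite t1 t2 t3 => e2; exact: (curvature_balance s1 e1 e2).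
Qed.

Lemma sqnormA_comp x : sqnormA X x = norm2A k l g1 g2 g3 (time x).
Proof.
have [e ee he] := shape_op_comp x.
rewrite (sqnormA_diag he).
rewrite (eq_bigr (fun i => shape_coef i x ^+ 2)); last first.
  by move=> i _; rewrite exprMn sqrrN expr2 ee mul1r.
by rewrite (sum_shape (fun c => c ^+ 2)) shape_coef_in3 sqrrN.
Qed.

(* The logarithmic derivative of p is the first-order coefficient of the
   Laplacian in the last variable. *)
Let deriv_p : has_deriv (sl_p k l g1 g2 g3) (fun t => sl_p k l g1 g2 g3 t *
  (k%:R * (derive1 g1 t / g1 t) + l%:R * (derive1 g2 t / g2 t)
   - 2^-1 * (derive1 sigma2 t / sigma2 t))).
Proof.
move=> t; have s0 := speed_gt0 speed2_gt0 t; have s1 : sigma t != 0 by rewrite gt_eqF.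
have hv := deriv_vol k l sg1 sg2 g1_gt0 g2_gt0 speed2_gt0 t.
have hs := is_derive_sqrt (speed2_gt0 t) (dspeed2 t).
apply: (is_derive_eq (is_derive_mul hv (is_derive_inv s1 hs))).
have t1 : sigma t * tau1 t = derive1 g1 t by rewrite /tan1 mulrC divfK.
have t2 : sigma t * tau2 t = derive1 g2 t by rewrite /tan2 mulrC divfK.
rewrite -t1 -t2 /sl_p -/(sigma t).
have -> : sigma2 t = sigma t ^+ 2 by rewrite sqr_sqrtr // ltW // speed2_gt0.
have a0 := g1_gt0 t; have b0 := g2_gt0 t; move: a0 b0 s0.
move: (sigma t) (sl_vol k l g1 g2 t) (g1 t) (g2 t) (tau1 t) (tau2 t) (derive1 sigma2 t).
by move=> s v u u' c c' S u0 u0' s0; field; rewrite !gt_eqF.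
Qed.

(** The spherical parts contribute a k / g1^2 + c l / g2^2 to the potential. What
   remains of the Laplacian is (p h')' divided by the weight w = p * sigma2. *)
Lemma stability_sep T Y Z h (a c lam : R) x :
  sphere_eigen Y (a * k%:R) -> sphere_eigen Z (c * l%:R) -> smooth_line h ->
  sl_eq T (sl_p k l g1 g2 g3) (sl_r k l g1 g2 g3 a c) h
     (fun t => lam * sl_w k l g1 g2 g3 t * h t) ->
  stability_op X (sep Y Z h) x = lam * sep Y Z h x.
Proof.
move=> eY eZ sh [_ _ [dh hh hph]].
have edh := has_deriv_derive1 hh; rewrite edh in hph.
rewrite /stability_op (laplacian_sep x eY eZ sh) sqnormA_comp sepx.
set t := time x.
have [_ e1] := hph t.
have h2 := smooth_line_deriv (smooth_line_derive1 sh).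
have [_ e2] := is_derive_mul (deriv_p t) (h2 t).
have e3 := etrans (esym e2) e1.
have S0 := speed2_gt0 t.
have p0 : 0 < sl_p k l g1 g2 g3 t.
  by rewrite /sl_p divr_gt0 ?(speed_gt0 speed2_gt0) // mulr_gt0 // exprn_gt0.
have ew : sl_w k l g1 g2 g3 t = sl_p k l g1 g2 g3 t * sigma2 t.
  have s1 : sigma t != 0 by rewrite gt_eqF // (speed_gt0 speed2_gt0).
  have -> : sigma2 t = sigma t ^+ 2 by rewrite sqr_sqrtr // ltW.
  by rewrite /sl_w /sl_p; field.
rewrite /sl_r ew in e3.
set E := (k%:R * _ + _ - _) in e3 *.
have e4 : (derive1 (derive1 h) t + E * derive1 h t) / sigma2 t =
    (sl_q k l g1 g2 g3 a c t - lam) * h t.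
  move: e3 p0 S0; move: (sl_p k l g1 g2 g3 t) (sigma2 t) (derive1 (derive1 h) t)
    (derive1 h t) (sl_q k l g1 g2 g3 a c t) (h t) E => P S h'' h' q h0 E e3 P0 S0.
  apply: (mulfI (lt0r_neq0 P0)); apply: (mulIf (lt0r_neq0 S0)).
  rewrite mulrA divfK ?lt0r_neq0 //.
  transitivity (P * h'' + h' * (P * E)); first by ring.
  by rewrite e3; ring.
rewrite e4 /sl_q.
have a0 := g1_gt0 t; have b0 := g2_gt0 t; move: a0 b0.
move: (norm2A k l g1 g2 g3 t) (g1 t) (g2 t) (h t) (Y _) (Z _) => N u v h0 y z u0 v0.
by field; rewrite !gt_eqF.
Qed.
End Hypersurface.

(** * Lower bounds for the stability index *)
Section IndexLowerBound.
Variables (R : realType) (k l : nat) (T : R) (p : nat) (phi : SSR R k l -> 'rV[R]_p).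

Definition independent (I : finType) (u : I -> SSR R k l -> R) :=
  forall c : I -> R, (forall q, \sum_i c i * u i q = 0) -> forall i, c i = 0.

Lemma independent_nz (I : finType) (u : I -> SSR R k l -> R) i :
  independent u -> exists q, u i q != 0.
Proof.
move=> hu; apply/not_existsP => z.
have /hu /(_ i) : forall q, \sum_j (j == i)%:R * u j q = 0.
  move=> q; rewrite (bigD1 i) //= big1 => [|j /negbTE ->]; last by rewrite mul0r.
  by rewrite addr0; apply/eqP/negPn/negP => h; apply: (z q); move: h; rewrite eqxx mul1r.
by rewrite eqxx; apply/eqP; rewrite oner_eq0.
Qed.

Lemma multiplicity_ge (I : finType) (u : I -> SSR R k l -> R) (lam : I -> R) mu :
  (forall i, Defs.eigenspace T phi (lam i) (u i)) -> independent u ->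
  (#|[pred i | lam i == mu]|%:R%:E <= Defs.multiplicity T phi mu)%E.
Proof.
move=> hu ind; set P := [pred i | lam i == mu].
apply: ereal_sup_ubound; exists #|P| => //; exists (fun j => u (enum_val j)); split.
  by move=> j; have /eqP <- : enum_val j \in P := enum_valP j; exact: hu.
move=> c hc j.
pose C (i : I) : R := \sum_(j < #|P|) (enum_val j == i)%:R * c j.
have CE j0 : C (enum_val j0) = c j0.
  rewrite /C (bigD1 j0) //= eqxx mul1r big1 ?addr0 // => j1 j10.
  by rewrite (inj_eq enum_val_inj) (negbTE j10) mul0r.
have : forall q, \sum_i C i * u i q = 0.
  move=> q; rewrite -[RHS](hc q); under eq_bigr do rewrite mulr_suml.
  rewrite exchange_big /=; apply: eq_bigr => j0 _.
  rewrite (bigD1 (enum_val j0)) //= eqxx mul1r big1 ?addr0 // => i ij.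
  by rewrite eq_sym (negbTE ij) !mul0r.
by move=> /ind /(_ (enum_val j)); rewrite CE.
Qed.

(** The members of the family with a given eigenvalue are at most as many as its
   multiplicity. *)
Lemma stability_index_ge (I : finType) (u : I -> SSR R k l -> R) (lam : I -> R) :
  (forall i, Defs.eigenspace T phi (lam i) (u i)) -> (forall i, lam i < 0) ->
  independent u -> (#|I|%:R%:E <= stability_index T phi)%E.
Proof.
move=> hu lam0 ind; pose s := undup (codom lam).
apply: (@le_trans _ _ (\sum_(mu <- s) Defs.multiplicity T phi mu)%E).
  apply: (@le_trans _ _ (\sum_(mu <- s) #|[pred i | lam i == mu]|%:R%:E)%E); last first.
    by apply: lee_sum => mu _; exact: multiplicity_ge hu ind.
  rewrite sumEFin -natr_sum lee_fin ler_nat.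
  under eq_bigr do rewrite -sum1_card.
  rewrite (eq_bigr (fun mu => \sum_i (lam i == mu)%:R)%N); last first.
    by move=> mu _; rewrite big_mkcond; apply: eq_bigr => i _; rewrite inE; case: (lam i == mu).
  rewrite exchange_big /= -sum1_card; apply: leq_sum => i _.
  rewrite (bigD1_seq (lam i)) ?undup_uniq //= ?eqxx ?leq_addr //.
  by rewrite mem_undup codom_f.
apply: ereal_sup_ubound; exists [set` s]; last by rewrite -fsbig_seq ?undup_uniq.
split; first exact: finite_seq.
move=> mu /=; rewrite mem_undup => /codomP[i ->]; split=> //.
by exists (u i); [exact: hu|exact: independent_nz].
Qed.
End IndexLowerBound.

(** * Counting negative modes *)
Section Harmonics.
Variable R : realType.

(** The constant and the coordinate functions are the spherical harmonics of degree
   0 and 1. *)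
Definition harmonic (m : nat) (i : option 'I_(m + 1)) (y : sphere R m) : R :=
  if i is Some a then sval y 0 a else 1.

Lemma sphere_axis (m : nat) (a : 'I_(m + 1)) (e : R) : e * e = 1 ->
  exists y : sphere R m, forall a', sval y 0 a' = e *+ (a == a').
Proof.
move=> ee; have h : dotp (e *: delta_mx 0 a : 'rV[R]_(m + 1)) (e *: delta_mx 0 a) = 1.
  rewrite dotpE (bigD1 a) //= big1 => [|a' /negbTE aa]; rewrite !mxE.
    by rewrite !eqxx mulr1 ee addr0.
  by rewrite aa mulr0 mul0r.
exists (exist (fun y : 'rV[R]_(m + 1) => dotp y y = 1) _ h) => a'; rewrite /= !mxE eqxx eq_sym /=.
by case: eqP => _; rewrite ?mulr1 ?mulr0.
Qed.

Lemma big_option (V : Type) (idx : V) (op : Monoid.com_law idx) (I : finType)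
    (F : option I -> V) :
  \big[op/idx]_i F i = op (F None) (\big[op/idx]_i F (Some i)).
Proof.
rewrite (bigD1 None) //=; congr (op _ _).
rewrite (reindex_omap Some id) => [|[i|] //] /=.
by apply: eq_bigl => i; rewrite eqxx.
Qed.

(** At the points e and - e of an axis, only the constant and one coordinate
   contribute. *)
Lemma harmonic_free (m : nat) (c : option 'I_(m + 1) -> R) :
  (forall y, \sum_i c i * harmonic i y = 0) -> forall i, c i = 0.
Proof.
move=> hc.
have eval a (e : R) : e * e = 1 -> c None + c (Some a) * e = 0.
  move=> ee; have [y hy] := sphere_axis a ee.
  rewrite -[RHS](hc y) big_option /= mulr1 (bigD1 a) //= hy eqxx mulr1n big1 ?addr0 //.
  by move=> a' aa; rewrite hy eq_sym (negbTE aa) mulr0n mulr0.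
have c0 : c None = 0.
  have := eval (rshift m ord0) 1 (mulr1 (1 : R)); have := eval (rshift m ord0) (-1).
  by rewrite mulrNN => /(_ (mulr1 _)); lra.
case=> [a|//]; have := eval a 1 (mulr1 (1 : R)); rewrite c0 add0r mulr1 //.
Qed.
End Harmonics.

(** The number of negative eigenvalues found for each of the four operators in the
   last variable, according to the presence of a coordinate of each sphere. *)
Definition mode_count (a c : bool) : nat := 
  (if a then if c then 1 else 2 else if c then 2 else 3)%N.

Definition mode_index (k l : nat) :=
  {x : option 'I_(k + 1) * option 'I_(l + 1) &
     'I_(mode_count (isSome x.1) (isSome x.2))}.

Lemma card_mode_index (k l : nat) :
  #|{: mode_index k l}| = (k * l + 3 * k + 3 * l + 8)%N.
Proof.
rewrite card_tagged sumnE big_map big_enum /=.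
under eq_bigr do rewrite card_ord.
rewrite -(pair_bigA _ (fun i j => mode_count (isSome i) (isSome j))) /=.
under eq_bigr do rewrite big_option.
rewrite big_option /= !sum_nat_const !card_ord; lia.
Qed.

Section Main.
Variables (R : realType) (k l : nat) (T : R) (f1 f2 : R -> R).
Hypotheses (hk : (1 <= k)%N) (hT : 0 < T).
Hypotheses (f1_smooth : smooth_line f1) (f2_smooth : smooth_line f2)
  (f1_per : periodic f1 T) (f2_per : periodic f2 T)
  (f2_gt0 : forall t, 0 < f2 t)
  (f_gt0 : forall t, 0 < profile f1 f2 t)
  (hphi : minimal_immersion (@phi_map R k l f1 f2)).
Local Notation f := (profile f1 f2).

Let arg_gt0 t : 0 < 1 - f1 t ^+ 2 - f2 t ^+ 2.
Proof. by have := f_gt0 t; rewrite sqrtr_gt0. Qed.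

Let f_smooth : smooth_line f.
Proof. by rewrite /profile; smoothness. Qed.

Let f_per : periodic f T.
Proof. by move=> t; rewrite /profile f1_per f2_per. Qed.

Let g_unit t : f t ^+ 2 + f2 t ^+ 2 + f1 t ^+ 2 = 1.
Proof. by rewrite sqr_sqrtr ?ltW //; ring. Qed.

Let imm b x := (hphi b).1.2 x.
Let minimal b x := (hphi b).2 x.
Let b0 : bool * bool := (false, false).
Let sp t : 0 < speed2 f f2 f1 t :=
  speed2_gt0 f_smooth f2_smooth f1_smooth (imm b0) t.
Let balance t := profile_minimality f_smooth f2_smooth f1_smooth f_gt0 f2_gt0 g_unit
  (imm b0) (minimal b0) t.

Lemma profile_modes (a c : bool) :
  negative_modes T k l f f2 f1 a%:R c%:R (mode_count a c).
Proof.
case: a; case: c => /=.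
- exact: negative_modes11 balance.
- exact: negative_modes10 balance.
- exact: negative_modes01 balance.
- exact: negative_modes00 balance _.
Qed.

Let md a c := cid (profile_modes a c).
Let mode a c := projT1 (md a c).
Let mode_val a c := projT1 (cid (projT2 (md a c))).
Let modeP a c := projT2 (cid (projT2 (md a c))).

Definition mode_fun (i : mode_index k l) (q : SSR R k l) : R :=
  harmonic (tag i).1 q.1.1 * harmonic (tag i).2 q.1.2 *
  @mode (isSome (tag i).1) (isSome (tag i).2) (tagged i) q.2.

Definition mode_eigenvalue (i : mode_index k l) : R :=
  @mode_val (isSome (tag i).1) (isSome (tag i).2) (tagged i).

Lemma mode_eigen i : Defs.eigenspace T (@phi_map R k l f1 f2) (mode_eigenvalue i) (mode_fun i).
Proof.
case: i => -[i j] s; rewrite /mode_eigenvalue /mode_fun /=.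
have [he _ hs _] := modeP (isSome i) (isSome j).
have eig := he s; have sm := hs s; have [_ per _] := eig.
pose Y b : 'rV[R]_k -> R := if i is Some a then stereo_coord b a else fun=> 1.
pose Z b : 'rV[R]_l -> R := if j is Some a then stereo_coord b a else fun=> 1.
have eY b : sphere_eigen (Y b) ((isSome i)%:R * k%:R).
  rewrite /Y; case: (i) => [a|] /=; first by rewrite mul1r; exact: sphere_eigen_coord.
  by rewrite mul0r; exact: sphere_eigen_const.
have eZ b : sphere_eigen (Z b) ((isSome j)%:R * l%:R).
  rewrite /Z; case: (j) => [a|] /=; first by rewrite mul1r; exact: sphere_eigen_coord.
  by rewrite mul0r; exact: sphere_eigen_const.
have hY b y : harmonic i (stereo b y) = Y b y by rewrite /Y; case: (i).
have hZ b z : harmonic j (stereo b z) = Z b z by rewrite /Z; case: (j).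
have uE b : (fun x => harmonic i (chart b x).1.1 * harmonic j (chart b x).1.2 *
    @mode (isSome i) (isSome j) s (chart b x).2) =
    sep (Y b.1) (Z b.2) (@mode (isSome i) (isSome j) s).
  by apply/funext => x; rewrite hY hZ.
split; first split.
- by move=> y z t /=; congr (_ * _); exact: per.
- by move=> b m; rewrite uE; apply: Cdiff_sep => //; [exact: (eY b.1).1|exact: (eZ b.2).1].
- move=> b x; rewrite uE (congr1 (fun v => v x) (uE b)).
  exact: (stability_sep f_smooth f2_smooth f1_smooth f_gt0 f2_gt0 g_unit (imm b)
    (minimal b) x (eY b.1) (eZ b.2) sm eig).
Qed.

Lemma mode_lt0 i : mode_eigenvalue i < 0.
Proof. have [_ h _ _] := modeP (isSome (tag i).1) (isSome (tag i).2); exact: h. Qed.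

(** The independence of the harmonics is applied to each sphere in turn, and leaves
   the independence of the modes of a single operator. *)
Lemma mode_independent : independent mode_fun.
Proof.
move=> c hc.
pose C i j (s : 'I_(mode_count (isSome i) (isSome j))) : R :=
  c (@Tagged _ (i, j) (fun x => 'I_(mode_count (isSome x.1) (isSome x.2))) s).
have sumE y z t : \sum_i (\sum_j (\sum_s C i j s * @mode (isSome i) (isSome j) s t) *
    harmonic j z) * harmonic i y = 0.
  rewrite -[RHS](hc (y, z, t)).
  rewrite (eq_bigr (fun i => \sum_j \sum_s C i j s * @mode (isSome i) (isSome j) s t *
     harmonic j z * harmonic i y)); last first.
    move=> i _; rewrite mulr_suml; apply: eq_bigr => j _.
    by rewrite !mulr_suml.
  rewrite pair_bigA /= sig_big_dep /=; apply: eq_bigr => -[[i j] s] _.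
  by rewrite /mode_fun /C /=; ring.
have zero i j t : \sum_s C i j s * @mode (isSome i) (isSome j) s t = 0.
  apply: (@harmonic_free R l (fun j => \sum_s C i j s * @mode (isSome i) (isSome j) s t)) => z.
  apply: (@harmonic_free R k (fun i => \sum_j (\sum_s C i j s *
    @mode (isSome i) (isSome j) s t) * harmonic j z)) => y.
  exact: sumE.
case=> -[i j] s.
have [_ _ _ free] := modeP (isSome i) (isSome j).
exact: (free (C i j) (zero i j) s).
Qed.

Lemma stability_index_modes :
  (#|{: mode_index k l}|%:R%:E <= stability_index T (@phi_map R k l f1 f2))%E.
Proof. exact: stability_index_ge mode_eigen mode_lt0 mode_independent. Qed.
End Main.

Theorem corollary2p3 (R : realType) (k l : nat) (T : R) (f1 f2 : R -> R)
  (hk : (1 <= k)%N) (hl : (1 <= l)%N) (hT : 0 < T)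
  (f1_smooth : smooth_line f1) (f2_smooth : smooth_line f2)
  (f1_per : periodic f1 T) (f2_per : periodic f2 T)
  (f2_gt0 : forall t, 0 < f2 t)
  (f_gt0 : forall t, 0 < profile f1 f2 t)
  (hphi : minimal_immersion (@phi_map R k l f1 f2)) :
  ((k * l + 3 * k + 3 * l + 8)%:R%:E
    <= stability_index T (@phi_map R k l f1 f2))%E.
Proof.
rewrite -card_mode_index; exact: stability_index_modes.
Qed.
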